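(* Let $K\subset\mathbb{C}$ be a non-polar compact set, let $\mathcal{T}_n$ be the corresponding dual Chebyshev polynomials, and let $\omega_n$ (for $n\geq 2$) denote the unique measure of maximal entropy for $\mathcal{T}_n$. Then the sequence $\{\omega_n\}_n$ converges weak* to the equilibrium measure $\omega_K$ on $K$, i.e. $\omega_n\to\omega_K$ weak* as $n\to\infty$.
   Context: For a compactly supported Borel probability measure $\nu$ on $\mathbb{C}$ put $I(\nu)=\iint\log|z-w|\,d\nu(z)\,d\nu(w)\in[-\infty,\infty)$. A compact set $K$ is non-polar if $I(\nu)>-\infty$ for some Borel probability measure $\nu$ supported on $K$. In that case the equilibrium measure $\omega_K$ is the unique Borel probability measure supported on $K$ which maximizes $I(\nu)$ among all Borel probability measures supported on $K$. Dual Chebyshev polynomials: for an infinite compact set $K\subset\mathbb{C}$ and $n\ge 1$, let $T_n$ be the unique monic polynomial of degree $n$ with minimal supremum norm $\|T_n\|_{K,\infty}=\sup_{z\in K}|T_n(z)|$ on $K$. The dual Chebyshev polynomial is $\mathcal{T}_n=T_n/\|T_n\|_{K,\infty}$. For a polynomial $P$ of degree $\ge 2$ the filled Julia set is $K_P=\mathbb{C}\setminus\{z\in\mathbb{C}: P^k(z)\to\infty \text{ as } k\to\infty\}$, where $P^k$ is the $k$-th iterate, and the Julia set is $J_P=\partial K_P$. The unique measure of maximal entropy of $P$ is known (Brolin, Lyubich) to coincide with the common equilibrium measure of $K_P$ and $J_P$. Thus $\omega_n$ is the equilibrium measure of the filled Julia set of $\mathcal{T}_n$. *)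

(* Defs.v *)
From HB Require Import structures.
From mathcomp Require Import all_boot all_order all_algebra.
From mathcomp Require Import complex.
From mathcomp Require Import all_classical all_reals all_analysis.

Set Implicit Arguments.
Unset Strict Implicit.
Unset Printing Implicit Defensive.

Import Order.TTheory GRing.Theory Num.Theory.
Import numFieldNormedType.Exports.
Import Normc.

Local Open Scope classical_set_scope.
Local Open Scope ring_scope.
Local Open Scope complex_scope.

(* Usual topology on R[i], copied from the numClosedFieldType structure; the
   radii of balls and the values of `|_| are (real) elements of R[i], hence
   the use below of normc : R[i] -> R for the real-valued modulus. *)
HB.instance Definition _ (R : realType) := NormedModule.copy R[i] R[i]^o.

Notation borelC R := (g_sigma_algebraType (@open R[i])).

Section Defs.
Context {R : realType}.
Implicit Types (K : set R[i]) (nu : probability (borelC R) R)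
  (p q : {poly R[i]}).

(* For closed K, this says that the closed support of nu is included in K. *)
Definition supported_on K nu : Prop := nu (~` K) = 0%E.

(* lne is the extended logarithm, with lne 0 = -oo. *)
Definition log_energy nu : \bar R :=
  (\int[nu]_z \int[nu]_w lne (normc ((z : R[i]) - (w : R[i])))%:E)%E.

Definition non_polar K : Prop :=
  exists2 nu, supported_on K nu & (-oo < log_energy nu)%E.

(* For K compact and non-polar, the equilibrium measure of K is the unique
   measure satisfying this predicate. *)
Definition is_equilibrium_measure K nu : Prop :=
  supported_on K nu /\
  forall mu : probability (borelC R) R,
    supported_on K mu -> (log_energy mu <= log_energy nu)%E.

Definition sup_norm K p : R := sup [set normc p.[z] | z in K].

(* For K compact and infinite, and 0 < n, exactly one p satisfies this. *)
Definition is_chebyshev_poly K (n : nat) p : Prop :=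
  [/\ p \is monic, size p = n.+1 &
      forall q, q \is monic -> size q = n.+1 -> sup_norm K p <= sup_norm K q].

Definition dual_poly K p : {poly R[i]} := ((sup_norm K p)^-1)%:C *: p.

(* By the Brolin-Lyubich theorem, the unique measure of maximal entropy of a
   polynomial p of degree at least 2 is the equilibrium measure of
   filled_julia p; the measures of maximal entropy are taken in this form. *)
Definition filled_julia p : set R[i] :=
  ~` [set z | normc (iter k (horner p) z) @[k --> \oo] --> +oo].

(* The limit being a probability measure, testing against bounded continuous
   functions, continuous functions vanishing at infinity, or continuous
   functions with compact support gives the same notion. *)
Definition cvg_weak_star (mu : nat -> probability (borelC R) R) nu : Prop :=
  forall f : R[i] -> R, continuous f -> bounded_fun f ->
    \int[mu n]_z f z @[n --> \oo] --> \int[nu]_z f z.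

End Defs.

(* Main.v *)
(* Let gamma = I(omega_K), let K_n be the filled Julia set of the n-th dual
   Chebyshev polynomial and L_n = ln ||T_n||.  The set K_n satisfies
   I(omega_n) >= L_n / (n - 1): polynomial preimages (by a resultant computation)
   and decreasing limits preserve lower bounds for Chebyshev constants, and the
   Chebyshev constant bounds the capacity from below (weak limit of Leja points).
   On the other hand K and K_n lie in the lemniscate |T_n| <= R0 ||T_n|| for a
   fixed R0, so that the midpoint of omega_n and omega_K has energy at most
   (L_n + ln R0) / n.  As L_n / n tends to gamma, both energies and the energy of
   the midpoint have the same limit.  Under stereographic projection, -ln |z - w|
   is, up to a function of z plus a function of w, a sum of the kernels x^k / k,
   where x is a positive definite polynomial kernel; the parallelogram identity
   then forces all the moments of omega_n to converge to those of omega_K, and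
   by density of the polynomials, omega_n converges to omega_K. *)

Require Import Defs.
From HB Require Import structures.
From mathcomp Require Import all_boot all_order all_algebra.
From mathcomp Require Import complex.
From mathcomp Require Import all_classical all_reals all_analysis.
From mathcomp Require Import measurable_realfun ring lra.

Set Implicit Arguments.
Unset Strict Implicit.
Unset Printing Implicit Defensive.

Import Order.TTheory GRing.Theory Num.Theory.
Import numFieldNormedType.Exports.
Import Normc.

Local Open Scope classical_set_scope.
Local Open Scope ring_scope.
Local Open Scope complex_scope.

(** The usual obstacle is positivity: [- ln |z - w|] is in general positive definite only on signed
    measures of total mass zero, and differences of energies may be undefined. The kernel
    [- ln (1 - s)], with [s] the stereographic kernel [skern], removes both difficulties. It is
    nonnegative, so that sums and integrals exchange freely even when they are infinite; integrated
    against a measure it is a weighted sum of squares of moments, with no condition on the mass. The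
    exponents 1/(n - 1) and 1/n have different origins. A filled Julia set of degree n whose leading
    coefficient has modulus 1/||T_n|| has capacity ||T_n||^(1/(n-1)), while the lemniscate |T_n| <=
    R0 ||T_n|| has capacity (R0 ||T_n||)^(1/n). Neither of K and K_n need contain the other, hence
    the lemniscate around both. Maximality of an equilibrium measure gives a lower bound on its
    energy only through a competing measure. Such a measure is built as the law, under Lebesgue
    measure on the unit interval, of a map that follows binary codes of points according to their
    limiting frequencies. No subsequence of [omega] is extracted, since the moment estimate is
    explicit in n. *)

Section ComplexPlane.
Context {R : realType}.
Implicit Types (z w : R[i]) (S : set R[i]) (f : R[i] -> R).

(** * Modulus and topology of the complex plane *)

Lemma norm_normcE z : `|z| = (normc z)%:C.
Proof. by rewrite normc_def; case: z. Qed.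

Lemma normc_ge0 z : 0 <= normc z.
Proof. by case: z => a b; rewrite sqrtr_ge0. Qed.

Lemma normc_sqrE z : normc z ^+ 2 = complex.Re z ^+ 2 + complex.Im z ^+ 2.
Proof. by case: z => a b /=; rewrite sqr_sqrtr // addr_ge0 ?sqr_ge0. Qed.

Lemma normc_eq0 z : (normc z == 0) = (z == 0).
Proof. by apply/eqP/eqP => [/eq0_normc//|->]; rewrite normc0. Qed.

Lemma normc_gt0 z : (0 < normc z) = (z != 0).
Proof. by rewrite lt_def normc_eq0 normc_ge0 andbT. Qed.

Lemma normcBC z w : normc (z - w) = normc (w - z).
Proof. by rewrite -(normcN (z - w)) opprB. Qed.

Lemma normc_triD z w : normc (z + w) <= normc z + normc w.
Proof. exact: le_normcD. Qed.

Lemma normc_triBr z w : normc z - normc w <= normc (z - w).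
Proof. by rewrite lerBlDr (le_trans _ (normc_triD _ _)) // subrK. Qed.

Lemma normc_real (a : R) : normc a%:C = `|a|.
Proof. by rewrite /= expr0n /= addr0 sqrtr_sqr. Qed.

Lemma normcX z n : normc (z ^+ n) = normc z ^+ n.
Proof. by elim: n => [|n IH]; rewrite ?expr0 ?normc1 // !exprS normcM IH. Qed.

Lemma normc_prod (I : Type) (s : seq I) (F : I -> R[i]) :
  normc (\prod_(i <- s) F i) = \prod_(i <- s) normc (F i).
Proof. by elim/big_rec2: _ => [|i x y _ <-]; rewrite ?normc1 ?normcM. Qed.

Lemma normc_sum (I : Type) (s : seq I) (F : I -> R[i]) :
  normc (\sum_(i <- s) F i) <= \sum_(i <- s) normc (F i).
Proof.
elim/big_rec2: _ => [|i x y _ h]; first by rewrite normc0.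
by rewrite (le_trans (normc_triD _ _)) // lerD2l.
Qed.

Lemma Re_le_normc z : `|complex.Re z| <= normc z.
Proof.
case: z => a b /=; rewrite -sqrtr_sqr ler_sqrt ?addr_ge0 ?sqr_ge0 //.
by rewrite lerDl sqr_ge0.
Qed.

Lemma Im_le_normc z : `|complex.Im z| <= normc z.
Proof.
case: z => a b /=; rewrite -sqrtr_sqr ler_sqrt ?addr_ge0 ?sqr_ge0 //.
by rewrite lerDr sqr_ge0.
Qed.

Lemma normc_le_ReIm z : normc z <= `|complex.Re z| + `|complex.Im z|.
Proof.
rewrite -(ler_pXn2r (n := 2)) ?nnegrE ?addr_ge0 ?normc_ge0 //.
rewrite normc_sqrE sqrrD !real_normK ?num_real // addrAC lerDl.
by rewrite mulrn_wge0 // mulr_ge0.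
Qed.

Lemma cplx_posE (e : R[i]) : 0 < e -> exists2 d : R, 0 < d & e = d%:C.
Proof. by case: e => a b; rewrite ltcE /= => /andP[/eqP -> a0]; exists a. Qed.

(** Balls of [R[i]] have radii in [R[i]]; the positive ones are positive reals by [cplx_posE], which
    gives the usual criterion with real radii. *)
Lemma continuous_cplxP f : continuous f <->
  forall z e, 0 < e -> exists2 d, 0 < d &
    forall w, normc (z - w) < d -> `|f z - f w| < e.
Proof.
split=> [cf z e e0|h z].
  have /cvgrPdist_lt/(_ e e0) := cf z.
  rewrite -nbhs_ballE => -[_/posnumP[d']] /=.
  have [d d0 ->] := cplx_posE (gt0 d').
  rewrite -ball_normE => sub; exists d => // w zw.
  by apply: sub => /=; rewrite norm_normcE ltcR.
apply/(@cvgrPdist_lt _ _ _ _ (nbhs_filter z)) => e e0; have [d d0 hd] := h z e e0.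
rewrite -nbhs_ballE; exists d%:C; first by rewrite /= ltcR.
by move=> w; rewrite -ball_normE /= norm_normcE ltcR; exact: hd.
Qed.

Lemma continuous_normc : continuous (@normc R : R[i] -> R).
Proof.
apply/continuous_cplxP => z e e0; exists e => // w; apply: le_lt_trans.
rewrite ler_norml; have := normc_triBr z w; have := normc_triBr w z.
by rewrite normcBC; lra.
Qed.

Lemma continuous_normcB w : continuous (fun z => normc (z - w)).
Proof.
apply/continuous_cplxP => z e e0; exists e => // x; apply: le_lt_trans.
rewrite ler_norml; have := normc_triBr (z - w) (x - w).
have := normc_triBr (x - w) (z - w).
have -> : z - w - (x - w) = z - x by rewrite opprB addrA subrK.
have -> : x - w - (z - w) = x - z by rewrite opprB addrA subrK.
by rewrite (normcBC x z); lra.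
Qed.

Lemma continuous_Re : continuous (@complex.Re R : R[i] -> R).
Proof.
apply/continuous_cplxP => z e e0; exists e => // w; apply: le_lt_trans.
by have := Re_le_normc (z - w); case: z w => a b [].
Qed.

Lemma continuous_Im : continuous (@complex.Im R : R[i] -> R).
Proof.
apply/continuous_cplxP => z e e0; exists e => // w; apply: le_lt_trans.
by have := Im_le_normc (z - w); case: z w => a b [].
Qed.

Lemma poly_bounded (p : {poly R[i]}) (r : R) :
  exists2 M : R, 0 < M & forall z, normc z <= r -> normc p.[z] <= M.
Proof.
elim/poly_ind: p => [|p c [M M0 IH]].
  by exists 1 => // z _; rewrite horner0 normc0.
exists (M * (`|r| + 1) + normc c).
  by rewrite ltr_wpDr ?normc_ge0 // mulr_gt0 // ltr_wpDl.
move=> z zr; rewrite !hornerE (le_trans (normc_triD _ _)) // lerD2r normcM.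
rewrite ler_pM ?normc_ge0 ?IH //.
by rewrite (le_trans zr) // (le_trans (ler_norm r)) // lerDl.
Qed.

Lemma poly_sub_root (p : {poly R[i]}) z :
  exists q : {poly R[i]}, forall w, p.[w] - p.[z] = q.[w] * (w - z).
Proof.
have /factor_theorem [q pq] : root (p - p.[z]%:P) z.
  by rewrite rootE !hornerE subrr.
exists q => w; have := congr1 (fun s => s.[w]) pq.
by rewrite /= !hornerE.
Qed.

Lemma continuous_normc_poly (p : {poly R[i]}) :
  continuous (fun z : R[i] => normc p.[z]).
Proof.
apply/continuous_cplxP => z e e0.
have [q pq] := poly_sub_root p z.
have [M M0 qM] := poly_bounded q (normc z + 1).
exists (Num.min 1 (e / M)); first by rewrite lt_min ltr01 divr_gt0.
move=> w; rewrite lt_min => /andP[zw1 zwe].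
have h : normc (p.[w] - p.[z]) < e.
  have zM : M * normc (z - w) < e by rewrite mulrC -ltr_pdivlMr.
  rewrite pq normcM (normcBC w) (le_lt_trans _ zM) // ler_wpM2r ?normc_ge0 //.
  by apply: qM; have := normc_triBr w z; rewrite normcBC; lra.
apply: le_lt_trans h; rewrite ler_norml.
have := normc_triBr p.[w] p.[z]; have := normc_triBr p.[z] p.[w].
by rewrite (normcBC p.[z]); lra.
Qed.

Lemma continuous_measurable f : continuous f ->
  measurable_fun [set: borelC R] (f : borelC R -> R).
Proof.
move=> cf; apply: (measurability _ (RGenOpens.measurableE R)) => //.
move=> _ [_ [a [b ->] <-]]; rewrite setTI.
apply: sub_sigma_algebra; apply: open_comp => //.
Qed.

Lemma measurable_closed S : closed S -> measurable (S : set (borelC R)).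
Proof.
rewrite -openC => oS; rewrite -[S]setCK; apply: measurableC.
exact: sub_sigma_algebra.
Qed.

Lemma closed_sublevel f (a : R) : continuous f -> closed [set z | f z <= a].
Proof.
move=> cf; have -> : [set z | f z <= a] = f @^-1` [set t | t <= a] by [].
by apply: closed_comp => // z _; exact: cf.
Qed.

Lemma closed_superlevel f (a : R) : continuous f -> closed [set z | a <= f z].
Proof.
move=> cf; have -> : [set z | a <= f z] = f @^-1` [set t | a <= t] by [].
by apply: closed_comp => // z _; exact: cf.
Qed.

Lemma hausdorff_cplx : hausdorff_space R[i].
Proof. exact: norm_hausdorff. Qed.

Lemma compact_bounded_cplx S : compact S ->
  exists2 r : R, 1 <= r & forall z, S z -> normc z <= r.
Proof.
move=> cS; have [S0|/set0P [z0 Sz0]] := eqVneq S set0.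
  by exists 1 => // z; rewrite S0.
have [] := @compact_EVT_max _ _ (@normc R : R[i] -> R) S _ cS.
- by exists z0.
- exact: continuous_subspaceT continuous_normc.
move=> c _ h; exists (Num.max 1 (normc c)); first by rewrite le_max lexx.
by move=> z Sz; rewrite le_max h ?orbT // inE.
Qed.

Lemma continuous_cplx_of_pair :
  continuous (fun p : R * R => p.1 +i* p.2 : R[i]).
Proof.
move=> p; apply/cvgrPdist_lt => e /cplx_posE [d d0 ->].
have d20 : 0 < d / 2 by rewrite divr_gt0.
have /cvgrPdist_lt/(_ _ d20) h1 := @cvg_fst _ _ _ _ (nbhs_filter p.2) : fst @ p --> p.1.
have /cvgrPdist_lt/(_ _ d20) h2 := @cvg_snd _ _ _ _ (nbhs_filter p.1) : snd @ p --> p.2.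
near=> q; rewrite norm_normcE ltcR.
apply: le_lt_trans (normc_le_ReIm _) _ => /=.
rewrite (splitr d) ltrD //; [near: q; exact: h1|near: q; exact: h2].
Unshelve. all: by end_near. Qed.

Lemma compact_closed_bounded S (r : R) : closed S ->
  (forall z, S z -> normc z <= r) -> compact S.
Proof.
move=> clS bS.
pose Q : set R[i] := (fun p : R * R => p.1 +i* p.2) @` (`[- r, r] `*` `[- r, r]).
have cQ : compact Q.
  apply: continuous_compact; last by apply: compact_setX; exact: segment_compact.
  exact: continuous_subspaceT continuous_cplx_of_pair.
apply: subclosed_compact clS cQ _ => z Sz; exists (complex.Re z, complex.Im z); last by case: z {Sz}.
have := bS _ Sz; have := Re_le_normc z; have := Im_le_normc z.
by rewrite /= !in_itv /= !ler_norml => /andP[? ?] /andP[? ?] ?; split; apply/andP; split; lra.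
Qed.

End ComplexPlane.

(** * The logarithmic kernel as a power series *)

Section LogSeries.
Context {R : realType}.
Implicit Types (t x : R) (n : nat).

Definition log_psum n t : R := \sum_(k < n) t ^+ k.+1 / k.+1%:R.

Lemma is_derive_log_psum n t : is_derive t 1 (log_psum n) (\sum_(k < n) t ^+ k).
Proof.
have -> : log_psum n = \sum_(k < n) (fun x => x ^+ k.+1 / k.+1%:R).
  by apply/funext => x; rewrite fct_sumE.
apply: is_derive_sum => k.
have h := is_deriveM (is_deriveX k.+1 (is_derive_id t 1)) (is_derive_cst (k.+1%:R^-1 : R) t 1).
have -> : (fun x => x ^+ k.+1 / k.+1%:R) = (id ^+ k.+1) * cst (k.+1%:R^-1 : R).
  by apply/funext => x; rewrite mulrfctE exprfctE.
apply: (is_derive_eq h).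
rewrite /= scaler0 add0r /GRing.scale /= mulr1 mulrA mulVf ?mul1r //.
Qed.

(** The derivative of the difference is the geometric remainder [x ^+ n / (1 - x)], nonnegative and
    increasing on [0, 1); the mean value theorem gives both bounds. *)
Lemma log_psum_err n t : 0 <= t -> t < 1 ->
  0 <= - ln (1 - t) - log_psum n t <= t ^+ n * (t / (1 - t)).
Proof.
move=> t0 t1; have [->|tn0] := eqVneq t 0.
  rewrite subr0 ln1 oppr0 mul0r mulr0 /log_psum big1 ?subr0 ?lexx // => k _.
  by rewrite exprS mul0r mul0r.
have tp : 0 < t by rewrite lt_def tn0.
pose g x := - ln (1 - x) - log_psum n x.
have dg x : x < 1 -> is_derive x 1 g (x ^+ n / (1 - x)).
  move=> x1; have x10 : 0 < 1 - x by rewrite subr_gt0.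
  have d1 : is_derive x 1 (fun y => 1 - y) (- 1 : R).
    by apply: is_derive_eq; rewrite add0r mul1r.
  have d2 := is_deriveB (is_deriveN (@is_derive1_comp R (@ln R) (fun y => 1 - y) x _ _ (is_derive1_ln x10) d1))
    (is_derive_log_psum n x).
  apply: (is_derive_eq d2).
  have -> : x ^+ n = 1 - (1 - x) * (\sum_(i < n) x ^+ i).
    by rewrite -[x ^+ n](subrK 1) subrX1; ring.
  by field; rewrite gt_eqF.
have [||c c01 gc] := @MVT _ g (fun x => x ^+ n / (1 - x)) 0 t tp.
- by move=> x; rewrite in_itv /= => /andP[_ xt]; apply: dg; exact: lt_trans t1.
- apply: continuous_in_subspaceT => x; rewrite inE /= in_itv /= => /andP[_ xt].
  apply: differentiable_continuous; apply/derivable1_diffP.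
  by have [] := dg x (le_lt_trans xt t1).
have g0 : g 0 = 0.
  rewrite /g subr0 ln1 oppr0 /log_psum big1 ?subr0 // => k _.
  by rewrite exprS mul0r mul0r.
move: gc; rewrite g0 !subr0 -/(g t) => ->.
move: c01; rewrite in_itv /= => /andP[c0 ct].
have c1 : 0 < 1 - c by lra.
apply/andP; split; first by rewrite mulr_ge0 ?divr_ge0 ?exprn_ge0 // ltW.
have -> : t ^+ n * (t / (1 - t)) = t ^+ n / (1 - t) * t by ring.
rewrite ler_wpM2r //; apply: ler_pM.
- by rewrite exprn_ge0 // ltW.
- by rewrite invr_ge0 ltW.
- by rewrite lerXn2r ?nnegrE // ltW.
- by rewrite lef_pV2 ?posrE ?subr_gt0 //; lra.
Qed.

Lemma log_series t : 0 <= t -> t < 1 ->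
  (\sum_(0 <= k <oo) (t ^+ k.+1 / k.+1%:R)%:E = (- ln (1 - t))%:E)%E.
Proof.
move=> t0 t1; apply/cvg_lim => //.
have -> : (fun n => \sum_(0 <= k < n) (t ^+ k.+1 / k.+1%:R)%:E)%E
   = EFin \o (fun n => log_psum n t).
  by apply/funext => n /=; rewrite /log_psum sumEFin big_mkord.
apply: cvg_EFin; first by near=> n.
apply/cvgrPdist_le => e e0.
have /cvgrPdist_le/(_ e e0) h : geometric (t / (1 - t)) t @ \oo --> (0 : R).
  by apply: cvg_geometric; rewrite ger0_norm.
near=> n; have /andP[a b] := log_psum_err n t0 t1.
rewrite /= ger0_norm //; apply: le_trans b _.
have : `|0 - geometric (t / (1 - t)) t n| <= e by near: n.
rewrite sub0r normrN /geometric /= mulrC; exact/le_trans/ler_norm.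
Unshelve. all: by end_near. Qed.

Lemma log_series1 : (\sum_(0 <= k <oo) ((1 : R) ^+ k.+1 / k.+1%:R)%:E = +oo)%E.
Proof.
apply/eqyP => A A0.
(* Chosen so that [- ln (1 - t) = A]; the terms at 1 dominate those at [t]. *)
pose t : R := 1 - expR (- A).
have t0 : 0 <= t by rewrite subr_ge0 -expR0 ler_expR oppr_le0 ltW.
have t1 : t < 1 by rewrite ltrBlDr ltrDl expR_gt0.
have <- : (- ln (1 - t))%:E = A%:E by rewrite opprB addrC subrK expRK opprK.
rewrite -log_series //; apply: lee_nneseries => [k _ _|k _].
  by rewrite lee_fin divr_ge0 ?exprn_ge0.
by rewrite lee_fin ler_wpM2r // lerXn2r ?nnegrE // ltW.
Qed.

End LogSeries.

(** * The stereographic kernel and the logarithm *)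

Section Kernel.
Context {R : realType}.
Implicit Types (z w : R[i]).

Definition sden z : R := 1 + normc z ^+ 2.

Definition hlog z : R := ln (sden z).

(* Coordinates of the point of the unit sphere over [z] under stereographic
   projection, with multiplicities chosen so as to avoid square roots. *)
Definition sphere z (i : 'I_6) : R :=
  nth 0 [:: normc z ^+ 2; 1; complex.Re z; complex.Re z;
            complex.Im z; complex.Im z] i / sden z.

Definition skern z w : R := \sum_i sphere z i * sphere w i.

Lemma sden_gt0 z : 0 < sden z.
Proof. by rewrite ltr_pwDl // sqr_ge0. Qed.

Lemma sden_ge1 z : 1 <= sden z.
Proof. by rewrite lerDl sqr_ge0. Qed.

Lemma hlog_ge0 z : 0 <= hlog z.
Proof. by rewrite ln_ge0 // sden_ge1. Qed.

Lemma skernE z w : 1 - skern z w = normc (z - w) ^+ 2 / (sden z * sden w).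
Proof.
rewrite /skern !big_ord_recl big_ord0 /sphere /=.
have /lt0r_neq0 := sden_gt0 z; have /lt0r_neq0 := sden_gt0 w.
rewrite /sden !normc_sqrE; case: z w => a b [c d] /= h1 h2.
by field; rewrite h1 h2.
Qed.

(** The numerator is the squared modulus of 1 + z conj(w). Nonnegativity lets the logarithmic series
    be integrated term by term against any measure. *)
Lemma skern_ge0 z w : 0 <= skern z w.
Proof.
rewrite /skern !big_ord_recl big_ord0 /sphere /=.
have u0 : 0 <= (sden z)^-1 by rewrite invr_ge0 ltW ?sden_gt0.
have v0 : 0 <= (sden w)^-1 by rewrite invr_ge0 ltW ?sden_gt0.
move: (sden z)^-1 (sden w)^-1 u0 v0 => u v u0 v0.
rewrite !normc_sqrE; case: z w => a b [c d] /=.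
rewrite [leRHS](_ : _ = ((1 + a * c + b * d) ^+ 2 + (a * d - b * c) ^+ 2) * (u * v)); last by ring.
by rewrite mulr_ge0 ?addr_ge0 ?sqr_ge0 ?mulr_ge0.
Qed.

Lemma skern_lt1 z w : z != w -> skern z w < 1.
Proof.
move=> zw; rewrite -subr_gt0 skernE divr_gt0 ?(mulr_gt0 (sden_gt0 _) (sden_gt0 _)) //.
by rewrite exprn_gt0 // normc_gt0 subr_eq0.
Qed.

(* This is - ln (1 - skern z w), hence
   2 ln |z - w| = hlog z + hlog w - lkern z w. *)
Definition lkern z w : \bar R :=
  (\sum_(0 <= k <oo) (skern z w ^+ k.+1 / k.+1%:R)%:E)%E.

Lemma lkern_term_ge0 z w k : (0 <= (skern z w ^+ k.+1 / k.+1%:R)%:E)%E.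
Proof. by rewrite lee_fin divr_ge0 ?exprn_ge0 ?skern_ge0. Qed.

Lemma lkern_ge0 z w : (0 <= lkern z w)%E.
Proof. by apply: nneseries_ge0 => k _ _; exact: lkern_term_ge0. Qed.

Lemma lkern_neq z w : z != w ->
  lkern z w = (hlog z + hlog w - 2 * ln (normc (z - w)))%:E.
Proof.
move=> zw; rewrite /lkern log_series ?skern_ge0 ?skern_lt1 //.
have zw0 : 0 < normc (z - w) by rewrite normc_gt0 subr_eq0.
congr EFin; rewrite skernE ln_div ?posrE ?(mulr_gt0 (sden_gt0 _) (sden_gt0 _)) ?exprn_gt0 //.
by rewrite lnM ?posrE ?sden_gt0 // lnXn // mulr2n /hlog; ring.
Qed.

Lemma lkern_diag z : lkern z z = +oo%E.
Proof.
rewrite /lkern -(log_series1); congr (limn _); apply/funext => n.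
suff -> : skern z z = 1 by [].
apply/eqP; rewrite eq_sym -subr_eq0 skernE subrr normc0.
by rewrite expr0n mul0r.
Qed.

(** The identity includes the diagonal: there [lkern] is the divergent harmonic series and both
    sides are -oo. *)
Lemma lne_normcB z w : (lne (normc (z - w))%:E =
  ((hlog z + hlog w) / 2)%:E - (1/2)%:E * lkern z w)%E.
Proof.
have [<-|zw] := eqVneq z w.
  by rewrite lkern_diag subrr normc0 /= lexx gt0_muley ?lte_fin ?divr_gt0 ?addeNy.
rewrite lkern_neq // lne_EFin ?normc_gt0 ?subr_eq0 //.
by rewrite -EFinM -EFinB; congr EFin; lra.
Qed.

End Kernel.

(** * Integrals of bounded measurable functions *)

Section BoundedMeasurable.
Context d (T : measurableType d) (R : realType).
Implicit Types (f g : T -> R) (P : probability T R).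

Lemma measure_probT P : (P : {measure set T -> \bar R}) setT = 1%E.
Proof. exact: probability_setT. Qed.

(** A condition that does not mention the measure and ensures integrability for every probability
    measure. *)
Definition bmf f := measurable_fun setT f /\ exists M, forall x, `|f x| <= M.

Lemma bmf_integrable P f : bmf f -> P.-integrable setT (EFin \o f).
Proof.
move=> [mf [M fM]]; apply: measurable_bounded_integrable => //.
  by rewrite measure_probT ltry.
apply: filterS (nbhs_pinfty_ge (num_real M)) => N MN x _ /=.
exact: le_trans (fM x) _.
Qed.

Lemma bmf_cst (a : R) : bmf (cst a).
Proof. by split => //; exists `|a|. Qed.

Lemma bmfD f g : bmf f -> bmf g -> bmf (fun x => f x + g x).
Proof.
move=> [mf [M fM]] [mg [N gN]]; split; first exact: measurable_funD.
by exists (M + N) => x; rewrite (le_trans (ler_normD _ _)) // lerD.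
Qed.

Lemma bmfM f g : bmf f -> bmf g -> bmf (fun x => f x * g x).
Proof.
move=> [mf [M fM]] [mg [N gN]]; split; first exact: measurable_funM.
by exists (M * N) => x; rewrite normrM ler_pM.
Qed.

Lemma bmfZ (a : R) f : bmf f -> bmf (fun x => a * f x).
Proof. exact/bmfM/bmf_cst. Qed.

Lemma bmf_sum (I : Type) (s : seq I) (F : I -> T -> R) :
  (forall i, bmf (F i)) -> bmf (fun x => \sum_(i <- s) F i x).
Proof.
move=> h; elim: s => [|i s IH].
  by under eq_fun do rewrite big_nil; exact: bmf_cst.
by under eq_fun do rewrite big_cons; exact: bmfD.
Qed.

Lemma bmf_prod (I : Type) (s : seq I) (F : I -> T -> R) :
  (forall i, bmf (F i)) -> bmf (fun x => \prod_(i <- s) F i x).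
Proof.
move=> h; elim: s => [|i s IH].
  by under eq_fun do rewrite big_nil; exact: bmf_cst.
by under eq_fun do rewrite big_cons; exact: bmfM.
Qed.

Lemma EFin_RintT P f : bmf f ->
  (\int[P]_x (f x)%:E = (\int[P]_x f x)%:E)%E.
Proof.
by move=> bf; rewrite fineK //; exact/integrable_fin_num/bmf_integrable.
Qed.

Lemma RintD P f g : bmf f -> bmf g ->
  \int[P]_x (f x + g x) = \int[P]_x f x + \int[P]_x g x.
Proof. by move=> bf bg; rewrite RintegralD //; exact: bmf_integrable. Qed.

Lemma RintB P f g : bmf f -> bmf g ->
  \int[P]_x (f x - g x) = \int[P]_x f x - \int[P]_x g x.
Proof. by move=> bf bg; rewrite RintegralB //; exact: bmf_integrable. Qed.

Lemma RintZ P (a : R) f : bmf f -> \int[P]_x (a * f x) = a * \int[P]_x f x.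
Proof. by move=> bf; rewrite RintegralZl //; exact: bmf_integrable. Qed.

Lemma Rint_cst P (a : R) : \int[P]_x a = a.
Proof. by rewrite Rintegral_cst // measure_probT mulr1. Qed.

Lemma Rint_sum P (I : Type) (s : seq I) (F : I -> T -> R) :
  (forall i, bmf (F i)) ->
  \int[P]_x (\sum_(i <- s) F i x) = \sum_(i <- s) \int[P]_x F i x.
Proof.
move=> h; elim: s => [|i s IH].
  by under eq_Rintegral do rewrite big_nil; rewrite Rint_cst big_nil.
under eq_Rintegral do rewrite big_cons.
by rewrite big_cons RintD ?IH //; exact: bmf_sum.
Qed.

Lemma ae_full P (A : set T) (Q : T -> Prop) : measurable A -> P (~` A) = 0%E ->
  (forall x, A x -> Q x) -> {ae P, forall x, Q x}.
Proof.
move=> mA PA AQ; exists (~` A); split => //; first exact: measurableC.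
by move=> x /=; apply: contra_not; exact: AQ.
Qed.

Lemma Rint_le_ae P (A : set T) f g : bmf f -> bmf g -> measurable A ->
  P (~` A) = 0%E -> (forall x, A x -> f x <= g x) ->
  \int[P]_x f x <= \int[P]_x g x.
Proof.
move=> bf bg mA PA fg.
(* [h] agrees with [f] on [A], hence almost everywhere, and is below [g] everywhere. *)
pose h x := Num.min (f x) (g x).
have bh : bmf h.
  have [[mf [M fM]] [mg [N gN]]] := (bf, bg).
  split; first exact: measurable_minr.
  exists (M + N) => x; rewrite /h /Num.min.
  have := fM x; have := gN x; have := normr_ge0 (f x); have := normr_ge0 (g x).
  by case: ifP; lra.
have <- : \int[P]_x h x = \int[P]_x f x.
  rewrite /Rintegral; congr fine; apply: ae_eq_integral => //.
  - by apply/measurable_EFinP; case: bh.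
  - by apply/measurable_EFinP; case: bf.
  apply: ae_full mA PA _ => x Ax _; rewrite /= /h.
  by congr EFin; apply/min_idPl; exact: fg.
apply: le_Rintegral => //; [exact: bmf_integrable|exact: bmf_integrable|].
by move=> x _; rewrite /h ge_min lexx orbT.
Qed.

(* The integral of a function bounded above may be computed even when it is
   [-oo]. *)
Lemma integral_bmfB P f (g : T -> \bar R) (c : R) : bmf f -> 0 < c ->
  measurable_fun setT g -> (forall x, 0 <= g x)%E ->
  (\int[P]_x ((f x)%:E - c%:E * g x) = (\int[P]_x f x)%:E - c%:E * \int[P]_x g x)%E.
Proof.
move=> bf c0 mg g0.
have [mf [M fM]] := bf.
have M0 : 0 <= M by rewrite (le_trans _ (fM point)).
(* [u] is nonnegative, so its integral splits unconditionally, and the integrand is [M - u].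
   Positive and negative parts are needed only when the integral of [u] is infinite. *)
pose u x := ((M - f x)%:E + c%:E * g x)%E.
have bMf : bmf (fun x => M - f x).
  by apply: bmfD; [exact: bmf_cst|under eq_fun do rewrite -mulN1r; exact: bmfZ].
have Mf0 x : 0 <= M - f x by rewrite subr_ge0 (le_trans (ler_norm _)).
have mcg : measurable_fun setT (fun x => c%:E * g x)%E by exact: measurable_funeM.
have cg0 x : (0 <= c%:E * g x)%E by rewrite mule_ge0 // lee_fin ltW.
have mMf : measurable_fun setT (fun x => (M - f x)%:E).
  by apply/measurable_EFinP; case: bMf.
have u0 x : (0 <= u x)%E by rewrite adde_ge0 // lee_fin.
have mu_ : measurable_fun setT u by exact: emeasurable_funD.
have Iu : (\int[P]_x u x = (M - \int[P]_x f x)%:E + c%:E * \int[P]_x g x)%E.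
  rewrite ge0_integralD //; last by move=> x _; rewrite lee_fin.
  rewrite ge0_integralZl ?lee_fin ?ltW // EFin_RintT // RintB //; last exact: bmf_cst.
  by rewrite Rint_cst.
have -> : (fun x => (f x)%:E - c%:E * g x)%E = (fun x => M%:E - u x)%E.
  apply/funext => x; rewrite /u oppeD // addeA -EFinN -EFinD; congr (_ + _)%E.
  by congr EFin; lra.
have [uoo|uoo] := eqVneq (\int[P]_x u x)%E +oo%E.
  have -> : (c%:E * \int[P]_x g x = +oo)%E.
    by move: uoo; rewrite Iu; case: (c%:E * _)%E.
  rewrite [RHS]addeNy integralE.
  have h1 : (\int[P]_x ((fun x => M%:E - u x)^\+ x) <= M%:E)%E.
    rewrite -[leRHS]mule1 -(measure_probT P) -integral_cst //.
    apply: ge0_le_integral => //.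
      by apply: measurable_funepos; exact: emeasurable_funB.
    move=> x _; rewrite funeposE ge_max lee_fin M0 andbT.
    by rewrite -[leRHS]adde0 leeD // oppe_le0.
  have h2 : (\int[P]_x ((fun x => M%:E - u x)^\- x) = +oo)%E.
    apply/eqP; rewrite -leye_eq.
    have h : (\int[P]_x u x <= \int[P]_x ((fun x => M%:E - u x)^\- x + M%:E))%E.
      apply: ge0_le_integral => //.
      - by apply: emeasurable_funD => //; apply: measurable_funeneg; exact: emeasurable_funB.
      move=> x _; rewrite funenegE -leeBlDr // le_max; apply/orP; left.
      by rewrite oppeB // addeC.
    move: h; rewrite uoo ge0_integralD //; last first.
      by apply: measurable_funeneg; exact: emeasurable_funB.
    by rewrite integral_cst // measure_probT mule1; case: (integral _ _ _).
  rewrite h2; move: h1; case: (\int[P]_x _)%E => //.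
have iu : P.-integrable setT u.
  apply/integrableP; split => //; under eq_integral do rewrite gee0_abs //.
  by rewrite ltey.
rewrite integralB //; last by exact: (@bmf_integrable P (cst M) (bmf_cst M)).
rewrite integral_cst // measure_probT mule1 Iu.
have gfin : (c%:E * \int[P]_x g x)%E \is a fin_num.
  rewrite ge0_fin_numE ?mule_ge0 ?lee_fin ?(ltW c0) ?integral_ge0 // ltey.
  by move: uoo; rewrite Iu; apply: contra_neq => ->.
rewrite oppeD // addeA -EFinN -EFinD; congr (_ + _)%E; congr EFin; lra.
Qed.

End BoundedMeasurable.

(** * Energy as a series in the moments *)

Section Energy.
Context {R : realType}.
Implicit Types (z w : R[i]) (nu : probability (borelC R) R) (S : set R[i]).

Lemma continuous_sden : continuous (@sden R).
Proof.
move=> z; apply: (@continuousD _ R^o _ (cst 1) (@normc R \* @normc R)).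
  exact: cst_continuous.
by apply: continuousM; exact: continuous_normc.
Qed.

Lemma continuous_hlog : continuous (@hlog R).
Proof.
move=> z; apply: (continuous_comp (g := @ln R)); first exact: continuous_sden.
by apply: continuous_ln; exact: sden_gt0.
Qed.

Lemma continuous_sphere (i : 'I_6) : continuous (fun z : R[i] => sphere z i).
Proof.
have cn : continuous (fun z : R[i] => nth 0 [:: normc z ^+ 2; 1;
    complex.Re z; complex.Re z; complex.Im z; complex.Im z] i).
  case: i => [[|[|[|[|[|[|//]]]]]] _] /=.
  - by move=> z; apply: (@continuousM _ _ (@normc R) (@normc R)); exact: continuous_normc.
  - exact: cst_continuous.
  - exact: continuous_Re.
  - exact: continuous_Re.
  - exact: continuous_Im.
  - exact: continuous_Im.
move=> z; apply: (continuousM (cn z)).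
apply: continuousV; last exact: continuous_sden.
by rewrite gt_eqF // sden_gt0.
Qed.

Lemma sphere_le1 z (i : 'I_6) : `|sphere z i| <= 1.
Proof.
rewrite normrM normfV (gtr0_norm (sden_gt0 z)) ler_pdivrMr ?sden_gt0 // mul1r.
have hz := normc_ge0 z.
have hs (a : R) : `|a| <= normc z -> `|a| <= sden z.
  move=> az; apply: le_trans az _; rewrite /sden.
  by have := sqr_ge0 (normc z - 1); rewrite sqrrB1; nra.
case: i => [[|[|[|[|[|[|//]]]]]] _] /=.
- by rewrite ger0_norm ?sqr_ge0 // /sden lerDr.
- by rewrite normr1 sden_ge1.
- exact/hs/Re_le_normc.
- exact/hs/Re_le_normc.
- exact/hs/Im_le_normc.
- exact/hs/Im_le_normc.
Qed.

Definition wordf {k} (f : {ffun 'I_k -> 'I_6}) z : R := \prod_j sphere z (f j).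

(** Expanding over words separates the two variables; integrating both against the same measure then
    leaves the sum of squares [msq]. This is the positive definiteness of the powers of the
    kernel. *)
Lemma skernX z w k :
  skern z w ^+ k = \sum_(f : {ffun 'I_k -> 'I_6}) wordf f z * wordf f w.
Proof.
rewrite -[in LHS](card_ord k) -prodr_const bigA_distr_bigA.
by apply: eq_bigr => f _; rewrite /wordf big_split.
Qed.

Lemma bmf_sphere (i : 'I_6) : bmf (fun z : borelC R => sphere z i).
Proof.
split; first by apply: continuous_measurable; exact: continuous_sphere.
by exists 1 => z; exact: sphere_le1.
Qed.

Lemma bmf_wordf k (f : {ffun 'I_k -> 'I_6}) : bmf (wordf f : borelC R -> R).
Proof. by apply: bmf_prod => j; exact: bmf_sphere. Qed.

Definition moment nu {k} (f : {ffun 'I_k -> 'I_6}) : R := \int[nu]_z wordf f z.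

Definition msq nu k : R := \sum_(f : {ffun 'I_k -> 'I_6}) moment nu f ^+ 2.

Definition lpot nu z : \bar R := (\int[nu]_w lkern z w)%E.

Definition benergy nu : \bar R := (\int[nu]_z lpot nu z)%E.

Lemma measurable_skern_term z k :
  measurable_fun [set: borelC R] (fun w => (skern z w ^+ k.+1 / k.+1%:R)%:E).
Proof.
apply/measurable_EFinP; under eq_fun do rewrite mulrC skernX.
suff [] : bmf (fun w : borelC R => k.+1%:R^-1 *
  \sum_(f : {ffun 'I_k.+1 -> 'I_6}) wordf f z * wordf f w) by [].
by apply: bmfZ; apply: bmf_sum => f; apply: bmfZ; exact: bmf_wordf.
Qed.

Lemma measurable_lkern z : measurable_fun [set: borelC R] (lkern z).
Proof.
apply: ge0_emeasurable_sum => [k w _ _|k _]; first exact: lkern_term_ge0.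
exact: measurable_skern_term.
Qed.

Lemma int_skern_term nu z k :
  (\int[nu]_w (skern z w ^+ k.+1 / k.+1%:R)%:E =
   ((\sum_(f : {ffun 'I_k.+1 -> 'I_6}) wordf f z * moment nu f) / k.+1%:R)%:E)%E.
Proof.
under eq_integral do rewrite mulrC skernX.
have b f : bmf (fun w : borelC R => wordf f z * wordf (k := k.+1) f w).
  by apply: bmfZ; exact: bmf_wordf.
rewrite EFin_RintT; last by apply: bmfZ; exact: bmf_sum.
rewrite RintZ ?Rint_sum //; last exact: bmf_sum.
rewrite mulrC; congr (_ * _)%:E; apply: eq_bigr => f _.
by rewrite RintZ //; exact: bmf_wordf.
Qed.

Lemma lpotE nu z : lpot nu z = (\sum_(0 <= k <oo)
   ((\sum_(f : {ffun 'I_k.+1 -> 'I_6}) wordf f z * moment nu f) / k.+1%:R)%:E)%E.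
Proof.
rewrite /lpot /lkern integral_nneseries //.
- by apply: eq_eseriesr => k _; rewrite int_skern_term.
- by move=> k; exact: measurable_skern_term.
- by move=> k w _; exact: lkern_term_ge0.
Qed.

Lemma lpot_term_ge0 nu z k : (0 <=
  ((\sum_(f : {ffun 'I_k.+1 -> 'I_6}) wordf f z * moment nu f) / k.+1%:R)%:E)%E.
Proof.
by rewrite -int_skern_term; apply: integral_ge0 => w _; exact: lkern_term_ge0.
Qed.

Lemma bmf_lpot_term nu k : bmf (fun z : borelC R =>
  (\sum_(f : {ffun 'I_k.+1 -> 'I_6}) wordf f z * moment nu f) / k.+1%:R).
Proof.
apply: bmfM; last exact: bmf_cst.
by apply: bmf_sum => f; apply: bmfM; [exact: bmf_wordf|exact: bmf_cst].
Qed.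

Lemma measurable_lpot nu : measurable_fun [set: borelC R] (lpot nu).
Proof.
rewrite (funext (lpotE nu)).
apply: ge0_emeasurable_sum => [k w _ _|k _]; first exact: lpot_term_ge0.
by apply/measurable_EFinP; case: (bmf_lpot_term nu k).
Qed.

Lemma lpot_ge0 nu z : (0 <= lpot nu z)%E.
Proof. by apply: integral_ge0 => w _; exact: lkern_ge0. Qed.

(** The spherical energy is thus a weighted squared norm of the family of moments, to which a
    parallelogram identity applies. *)
Lemma benergyE nu :
  benergy nu = (\sum_(0 <= k <oo) (msq nu k.+1 / k.+1%:R)%:E)%E.
Proof.
rewrite /benergy; under eq_integral do rewrite lpotE.
rewrite integral_nneseries //.
- apply: eq_eseriesr => k _; rewrite EFin_RintT; last exact: bmf_lpot_term.
  under eq_Rintegral do rewrite mulrC.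
  have b f : bmf (fun w : borelC R => wordf (k := k.+1) f w * moment nu f).
    by apply: bmfM; [exact: bmf_wordf|exact: bmf_cst].
  rewrite RintZ; last exact: bmf_sum.
  rewrite Rint_sum // mulrC; congr (_ * _)%:E; apply: eq_bigr => f _.
  under eq_Rintegral do rewrite mulrC.
  by rewrite RintZ //; exact: bmf_wordf.
- by move=> k; apply/measurable_EFinP; case: (bmf_lpot_term nu k).
- by move=> k w _; exact: lpot_term_ge0.
Qed.

Lemma msq_ge0 nu k : 0 <= msq nu k.
Proof. by apply: sumr_ge0 => f _; exact: sqr_ge0. Qed.

Lemma benergy_ge0 nu : (0 <= benergy nu)%E.
Proof. by apply: integral_ge0 => z _; exact: lpot_ge0. Qed.

(** [hlog] is unbounded on the plane; the truncation belongs to [bmf] and changes nothing on a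
    support where [hlog] is at most [B]. *)
Definition hcut (B : R) z : R := Num.min (hlog z) B.

Lemma bmf_hcut (B : R) : bmf (hcut B : borelC R -> R).
Proof.
split.
  apply: measurable_minr; last exact: measurable_cst.
  by apply: continuous_measurable; exact: continuous_hlog.
exists `|B| => z; rewrite /hcut /Num.min; case: ifP => // hB.
by rewrite ger0_norm ?hlog_ge0 // ltW // (lt_le_trans hB) // ler_norm.
Qed.

(** The two halves [hlog z / 2] and [hlog w / 2] of [lne_normcB] integrate to a single term, which
    is linear in the measure. [benergy] may be infinite, so that energy -oo is covered. *)
Lemma log_energyE nu S (B : R) : measurable (S : set (borelC R)) ->
  supported_on S nu -> (forall z, S z -> hlog z <= B) ->
  log_energy nu = ((\int[nu]_z hcut B z)%:E - (1/2)%:E * benergy nu)%E.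
Proof.
move=> mS nS SB.
have hS z : S z -> hcut B z = hlog z by move=> Sz; apply/min_idPl; exact: SB.
pose c := \int[nu]_z hcut B z.
have half0 : (0 : R) < 1 / 2 by rewrite divr_gt0.
have bin (a : R) : bmf (fun w : borelC R => (a + hcut B w) / 2).
  apply: bmfM; last exact: bmf_cst.
  by apply: bmfD; [exact: bmf_cst|exact: bmf_hcut].
have minner z : measurable_fun [set: borelC R]
    (fun w => ((hlog z + hcut B w) / 2)%:E - (1/2)%:E * lkern z w)%E.
  apply: emeasurable_funB; last by apply: measurable_funeM; exact: measurable_lkern.
  by apply/measurable_EFinP; case: (bin (hlog z)).
have inner z : (\int[nu]_w lne (normc (z - (w : R[i])))%:E =
    ((hlog z + c) / 2)%:E - (1/2)%:E * lpot nu z)%E.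
  rewrite (ae_eq_integral (fun w : borelC R => ((hlog z + hcut B w) / 2)%:E - (1/2)%:E * lkern z w)%E) //.
  - rewrite integral_bmfB //; [|exact: measurable_lkern|exact: lkern_ge0].
    congr (_%:E - _)%E; under eq_Rintegral do rewrite mulrC.
    rewrite RintZ; last by apply: bmfD; [exact: bmf_cst|exact: bmf_hcut].
    rewrite RintD; [|exact: bmf_cst|exact: bmf_hcut].
    by rewrite Rint_cst mulrC.
  - under eq_fun do rewrite lne_normcB.
    apply: emeasurable_funB; last by apply: measurable_funeM; exact: measurable_lkern.
    apply/measurable_EFinP; apply: measurable_funM => //.
    apply: measurable_funD => //.
    by apply: continuous_measurable; exact: continuous_hlog.
  - by apply: ae_full mS nS _ => w Sw _; rewrite hS // lne_normcB.
rewrite /log_energy; under eq_integral do rewrite inner.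
rewrite (ae_eq_integral (fun z : borelC R => ((c + hcut B z) / 2)%:E - (1/2)%:E * lpot nu z)%E) //.
- rewrite integral_bmfB //; [|exact: measurable_lpot|exact: lpot_ge0].
  congr (_%:E - _)%E; under eq_Rintegral do rewrite mulrC.
  rewrite RintZ; last by apply: bmfD; [exact: bmf_cst|exact: bmf_hcut].
  rewrite RintD; [|exact: bmf_cst|exact: bmf_hcut].
  by rewrite Rint_cst -/c; lra.
- apply: emeasurable_funB; last by apply: measurable_funeM; exact: measurable_lpot.
  apply/measurable_EFinP; apply: measurable_funM => //.
  apply: measurable_funD => //.
    by apply: continuous_measurable; exact: continuous_hlog.
- apply: emeasurable_funB; last by apply: measurable_funeM; exact: measurable_lpot.
  by apply/measurable_EFinP; case: (bin c).
- by apply: ae_full mS nS _ => w Sw _; rewrite hS // (addrC c).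
Qed.

End Energy.

(** * Energy of midpoints *)

Section Midpoint.
Context d (T : measurableType d) (R : realType).
Implicit Types (a b : probability T R).

Definition midm a b := mscale (2^-1 : R)%:nng (measure_add a b).

HB.instance Definition _ a b := Measure.on (midm a b).

Lemma midmE a b A : (midm a b A = (2^-1 : R)%:E * (a A + b A))%E.
Proof. by rewrite /midm /mscale; congr (_ * _)%E; exact: measure_addE. Qed.

Lemma midm_setT a b : midm a b setT = 1%E.
Proof.
rewrite midmE !measure_probT -EFinD -EFinM /=.
by congr EFin; rewrite -[1 + 1]/(2 : R) mulVf.
Qed.

HB.instance Definition _ a b :=
  Measure_isProbability.Build _ _ _ (midm a b) (midm_setT a b).

Lemma midm_null a b (A : set T) : a A = 0%E -> b A = 0%E -> midm a b A = 0%E.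
Proof.
move=> a0 b0; rewrite midmE.
by rewrite [X in (X + _)%E]a0 [X in (_ + X)%E]b0 adde0 mule0.
Qed.

Lemma Rint_midm a b (f : T -> R) : bmf f ->
  \int[midm a b]_z f z = (\int[a]_z f z + \int[b]_z f z) / 2.
Proof.
move=> bf.
have ge0_case g : bmf g -> (forall x, 0 <= g x) ->
    \int[midm a b]_z g z = (\int[a]_z g z + \int[b]_z g z) / 2.
  move=> bg g0; rewrite /Rintegral ge0_integral_mscale //=; last first.
  - by move=> x _; rewrite lee_fin.
  - by apply/measurable_EFinP; case: bg.
  rewrite ge0_integral_measure_add //; last first.
  - by apply/measurable_EFinP; case: bg.
  - by move=> x _; rewrite lee_fin.
  rewrite !EFin_RintT // -EFinD -EFinM /= mulrC.
  by congr ((_ + _) / _).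
have [mf [M fM]] := bf.
have bfM : bmf (fun x => f x + M) by apply: bmfD => //; exact: bmf_cst.
have fM0 x : 0 <= f x + M by have := fM x; rewrite ler_norml; lra.
have bM : bmf (fun _ : T => M) by exact: bmf_cst.
have := ge0_case _ bfM fM0; rewrite !RintD //.
by rewrite !Rint_cst => h; apply: (@addIr _ M); rewrite h; field.
Qed.

End Midpoint.

Section EnergyComparison.
Context {R : realType}.
Implicit Types a b nu : probability (borelC R) R.

Lemma benergy_partial nu k : (benergy nu < +oo)%E ->
  \sum_(j < k) msq nu j.+1 / j.+1%:R <= fine (benergy nu).
Proof.
move=> fin; rewrite -lee_fin fineK; last first.
  by rewrite ge0_fin_numE // benergy_ge0.
rewrite benergyE -sumEFin -(big_mkord xpredT (fun j => (msq nu j.+1 / j.+1%:R)%:E)).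
by apply: nneseries_lim_ge => j _ _; rewrite lee_fin divr_ge0 // msq_ge0.
Qed.

Lemma benergy_le nu (c : R) :
  (forall k, \sum_(j < k) msq nu j.+1 / j.+1%:R <= c) -> (benergy nu <= c%:E)%E.
Proof.
move=> h; rewrite benergyE; apply: lime_le.
  by apply: is_cvg_nneseries => j _ _; rewrite lee_fin divr_ge0 // msq_ge0.
by apply: nearW => k; rewrite sumEFin big_mkord lee_fin.
Qed.

Lemma msq_midm a b k : msq a k + msq b k - 2 * msq (midm a b) k =
  2^-1 * \sum_(f : {ffun 'I_k -> 'I_6}) (moment a f - moment b f) ^+ 2.
Proof.
rewrite /msq mulr_sumr mulr_sumr -big_split -sumrB.
apply: eq_bigr => f _; rewrite {3}/moment Rint_midm; last exact: bmf_wordf.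
by rewrite -/(moment a f) -/(moment b f) /=; field.
Qed.

(* The parallelogram identity for the positive definite kernel [lkern]. *)
Lemma benergy_midm_le a b k (f : {ffun 'I_k.+1 -> 'I_6}) :
  (benergy a < +oo)%E -> (benergy b < +oo)%E ->
  (benergy (midm a b) <= (2^-1 * (fine (benergy a) + fine (benergy b)) -
    (moment a f - moment b f) ^+ 2 / (4 * k.+1%:R))%:E)%E.
Proof.
move=> fa fb.
pose q j := msq a j.+1 + msq b j.+1 - 2 * msq (midm a b) j.+1.
have q0 j : 0 <= q j.
  rewrite /q msq_midm mulr_ge0 ?invr_ge0 //.
  by apply: sumr_ge0 => g _; exact: sqr_ge0.
have qk : (moment a f - moment b f) ^+ 2 <= 2 * q k.
  rewrite /q msq_midm mulrA divff // mul1r (bigD1 f) //= lerDl.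
  by apply: sumr_ge0 => g _; exact: sqr_ge0.
have ea := benergy_partial _ fa; have eb := benergy_partial _ fb.
have psum n : \sum_(j < n) msq (midm a b) j.+1 / j.+1%:R =
    2^-1 * (\sum_(j < n) msq a j.+1 / j.+1%:R + \sum_(j < n) msq b j.+1 / j.+1%:R
     - \sum_(j < n) q j / j.+1%:R).
  rewrite -big_split -sumrB mulr_sumr; apply: eq_bigr => j _ /=.
  by rewrite /q; field.
have pq n : (k < n)%N -> q k / k.+1%:R <= \sum_(j < n) q j / j.+1%:R.
  move=> kn; rewrite (bigD1 (Ordinal kn)) //= lerDl.
  by apply: sumr_ge0 => j _; rewrite divr_ge0.
have le_q : (moment a f - moment b f) ^+ 2 / (4 * k.+1%:R) <=
    2^-1 * (q k / k.+1%:R).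
  rewrite invfM mulrA mulrA ler_wpM2r ?invr_ge0 //.
  by move: qk; move: (q k) (_ ^+ 2) => u v; lra.
apply: benergy_le => n.
(* The partial sum is extended past the index [k], so that it contains the term with the moments of
   [f]. *)
apply: (@le_trans _ _ (\sum_(j < (n + k).+1) msq (midm a b) j.+1 / j.+1%:R)).
  rewrite -addnS big_split_ord /= lerDl.
  by apply: sumr_ge0 => j _; rewrite divr_ge0 // msq_ge0.
rewrite psum mulrBr lerB //.
  by rewrite ler_pM2l ?invr_gt0 // lerD.
apply: le_trans le_q _; rewrite ler_pM2l ?invr_gt0 //.
by apply: pq; rewrite ltnS leq_addl.
Qed.

End EnergyComparison.

(** * Energy of measures on lemniscates *)

Lemma ln_prod (R : realType) (T : eqType) (s : seq T) (F : T -> R) :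
  (forall b, b \in s -> 0 < F b) ->
  ln (\prod_(b <- s) F b) = \sum_(b <- s) ln (F b).
Proof.
elim: s => [|b s IH] pos; first by rewrite !big_nil ln1.
have pos' c : c \in s -> 0 < F c by move=> cs; rewrite pos // inE cs orbT.
rewrite !big_cons lnM ?IH ?posrE ?pos ?mem_head //.
by rewrite big_seq prodr_gt0.
Qed.

(** * Lagrange interpolation and products of differences *)

Section Interpolation.
Context {R : realType}.
Implicit Types (s : seq R[i]) (q : {poly R[i]}).

(** A polynomial of degree below the number of nodes is its own interpolation polynomial; the
    identity compares leading coefficients. *)
Lemma lagrange_lead s q : uniq s -> (0 < size s)%N -> q \is monic ->
  size q = size s ->
  \sum_(a <- s) q.[a] / \prod_(b <- rem a s) (a - b) = 1.
Proof.
move=> us s0 mq sq.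
pose pi a := \prod_(b <- rem a s) (a - b).
pose l a : {poly R[i]} := \prod_(b <- rem a s) ('X - b%:P).
have sl a : a \in s -> size (l a) = size s.
  by move=> sa; rewrite /l size_prod_XsubC size_rem // prednK.
have la a : (l a).[a] = pi a.
  by rewrite /l horner_prod; apply: eq_bigr => b _; rewrite !hornerE.
have pi0 a : pi a != 0.
  rewrite /pi prodf_seq_neq0; apply/allP => b.
  by rewrite mem_rem_uniq // inE => /andP[ba _]; rewrite subr_eq0 eq_sym.
have lb a b : a \in s -> b \in s -> a != b -> (l a).[b] = 0.
  move=> sa sb ab; rewrite /l horner_prod.
  rewrite (big_rem b) /=; last by rewrite mem_rem_uniq // inE eq_sym ab.
  by rewrite !hornerE subrr mul0r.
pose Q := \sum_(a <- s) (q.[a] / pi a) *: l a.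
have sQ : (size Q <= size s)%N.
  rewrite /Q big_seq; apply: (leq_trans (size_sum _ _ _)).
  apply/bigmax_leqP_seq => a sa _.
  by rewrite (leq_trans (size_scale_leq _ _)) // sl.
have Qq a : a \in s -> Q.[a] = q.[a].
  move=> sa; rewrite /Q horner_sum (big_rem a) //= big_seq big1 ?addr0.
    by rewrite hornerZ la mulfVK.
  move=> b; rewrite mem_rem_uniq // inE => /andP[ba sb].
  by rewrite hornerZ lb ?mulr0.
have qQ : q = Q.
  apply/eqP; rewrite -subr_eq0; apply/negPn/negP => h.
  have rt : all (root (q - Q)) s.
    by apply/allP => a sa; rewrite rootE hornerD hornerN Qq // subrr.
  have := max_poly_roots h rt us; rewrite ltnNge.
  by rewrite (leq_trans (size_polyD _ _)) // size_polyN geq_max sq leqnn.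
have Q1 : Q`_(size s).-1 = 1.
  by rewrite -qQ -sq; move: mq; rewrite monicE => /eqP.
rewrite -[RHS]Q1 /Q coef_sum.
rewrite big_seq [RHS]big_seq; apply: eq_bigr => a sa.
rewrite coefZ -(sl a sa).
have : l a \is monic by apply: monic_prod => b _; exact: monicXsubC.
rewrite monicE => /eqP.
by rewrite /lead_coef => ->; rewrite mulr1.
Qed.

(** Otherwise each term of [lagrange_lead] would have modulus below [1 / size s], and the sum could
    not be 1. *)
Lemma exists_small_diff s q (M : R) : uniq s -> (0 < size s)%N -> q \is monic ->
  size q = size s -> (forall a, a \in s -> normc q.[a] <= M) ->
  exists2 a, a \in s &
    \prod_(b <- rem a s) normc (a - b) <= (size s)%:R * M.
Proof.
move=> us s0 mq sq qM; apply: contrapT => nex.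
have h a : a \in s -> (size s)%:R * M < \prod_(b <- rem a s) normc (a - b).
  by move=> sa; rewrite ltNge; apply/negP => ?; apply: nex; exists a.
have N0 : (0 : R) < (size s)%:R by rewrite ltr0n.
suff : normc (1 : R[i]) < 1 by rewrite normc1 ltxx.
rewrite -(lagrange_lead us s0 mq sq); apply: le_lt_trans (normc_sum _ _) _.
have -> : (1 : R) = \sum_(a <- s) (size s)%:R^-1.
  by rewrite big_const_seq count_predT iter_addr_0 -[RHS]mulr_natr mulVf ?gt_eqF.
have step a : a \in s ->
    normc (q.[a] / \prod_(b <- rem a s) (a - b)) < (size s)%:R^-1.
  move=> sa; rewrite normcM normcV normc_prod.
  have M0 : 0 <= M by rewrite (le_trans (normc_ge0 _) (qM a sa)).
  have P0 : 0 < \prod_(b <- rem a s) normc (a - b).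
    by rewrite (le_lt_trans _ (h a sa)) // mulr_ge0 // ltW.
  rewrite ltr_pdivrMr // mulrC ltr_pdivlMr // mulrC.
  by apply: le_lt_trans (h a sa); rewrite ler_pM2l // qM.
case: s s0 step {us sq qM nex h N0} => // a s _ step.
rewrite !big_cons ltr_leD ?step ?mem_head //.
rewrite big_seq [leRHS]big_seq; apply: ler_sum => b sb.
by rewrite ltW // step // inE sb orbT.
Qed.

(* Since [ln 0 = 0], the diagonal terms vanish. *)
Definition lnpairs s : R := \sum_(a <- s) \sum_(b <- s) ln (normc (a - b)).

Lemma lnpairs_cons a s :
  lnpairs (a :: s) = lnpairs s + 2 * \sum_(b <- s) ln (normc (a - b)).
Proof.
rewrite /lnpairs big_cons big_cons subrr normc0 ln0 // add0r.
under [X in _ + X = _]eq_bigr do rewrite big_cons.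
rewrite big_split /=; under [X in _ + (X + _)]eq_bigr do rewrite normcBC.
by rewrite mulrDl mul1r; ring.
Qed.

Lemma lnpairs_perm s t : perm_eq s t -> lnpairs s = lnpairs t.
Proof.
by move=> st; rewrite /lnpairs (perm_big _ st) /=; apply: eq_bigr => a _;
  rewrite (perm_big _ st).
Qed.

(** With [m + 1] points left, [exists_small_diff] and the polynomial of degree [m] yield a point to
    remove, whose distances to the others have product at most [m.+1%:R * r m]. The factor 2 counts
    ordered pairs. *)
Lemma lnpairs_le (S : set R[i]) (r : nat -> R) s :
  (forall m, 0 < r m) ->
  (forall m, exists q, [/\ q \is monic, size q = m.+1 &
     forall z, S z -> normc q.[z] <= r m]) ->
  uniq s -> (forall a, a \in s -> S a) ->
  lnpairs s <= 2 * \sum_(m < size s) (ln m.+1%:R + ln (r m)).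
Proof.
move=> r0 hq; move sn : (size s) => n.
elim: n s sn => [|n IH] s sn us sS.
  by move/size0nil: sn => ->; rewrite /lnpairs big_nil big_ord0 mulr0.
have [q [mq sq qr]] := hq n.
have [|||a sa ha] := @exists_small_diff s q (r n) us _ mq.
- by rewrite sn.
- by rewrite sn.
- by move=> b sb; exact/qr/sS.
have sr : size (rem a s) = n by rewrite size_rem // sn.
have := IH (rem a s) sr (rem_uniq a us) (fun b sb => sS b (mem_rem sb)).
rewrite (lnpairs_perm (perm_to_rem sa)) lnpairs_cons big_ord_recr /= => h.
rewrite mulrDr lerD // ler_pM2l //.
have pos b : b \in rem a s -> 0 < normc (a - b).
  by rewrite mem_rem_uniq // inE => /andP[ba _]; rewrite normc_gt0 subr_eq0 eq_sym.
rewrite -(ln_prod pos).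
rewrite -lnM ?posrE // ler_ln ?posrE ?mulr_gt0 //; first by rewrite -sn.
by rewrite big_seq prodr_gt0.
Qed.

End Interpolation.

(** * Choosing points of small mutual energy *)

Lemma mule_natmul (R : realType) (x : \bar R) n : (n%:R%:E * x)%E = (x *+ n)%R.
Proof.
rewrite mule_natl; elim: n => [|n IH]; first by rewrite mulr0n.
by rewrite mulrS -IH muleS.
Qed.

(** Each unordered pair is counted once. The newest point is the second argument of [ker], the one
    in which measurability is assumed below. *)
Fixpoint kpairs (R : realType) (T : Type) (ker : T -> T -> \bar R)
    (s : seq T) : \bar R :=
  if s is a :: s' then (kpairs ker s' + \sum_(b <- s') ker b a)%E else 0%E.

Section Selection.
Context d (T : measurableType d) (R : realType) (P : probability T R).
Context (S : set T).
Hypotheses (mS : measurable S) (PS : P (~` S) = 0%E).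

(** The slack 1 avoids discussing equality almost everywhere. Over [N] choices it costs [N], which
    is negligible against the number of pairs. *)
Lemma exists_le_mean (g : T -> \bar R) : measurable_fun setT g ->
  (forall x, 0 <= g x)%E -> exists2 x, S x & (g x <= \int[P]_y g y + 1)%E.
Proof.
move=> mg g0; apply: contrapT => nex.
have h x : S x -> (\int[P]_y g y + 1 < g x)%E.
  by move=> Sx; rewrite ltNge; apply/negP => ?; apply: nex; exists x.
have [x Sx] : S !=set0.
  apply/set0P/negP => /eqP S0; have := measure_probT P.
  by rewrite -setC0 -S0 [X in X = _]PS => /eqP; rewrite eq_sym onee_eq0.
have I0 : (0 <= \int[P]_y g y)%E by exact: integral_ge0.
have Ifin : (\int[P]_y g y)%E \is a fin_num.
  rewrite ge0_fin_numE // ltey; apply/eqP => Ioo.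
  by have := h _ Sx; rewrite Ioo addye // ltNge leey.
have : (\int[P]_y (cst (\int[P]_y g y + 1)%E y) <= \int[P]_y g y)%E.
  apply: ae_ge0_le_integral => //.
  - by move=> y _; rewrite adde_ge0.
  by apply: ae_full mS PS _ => y Sy _; rewrite ltW // h.
rewrite integral_cst // measure_probT mule1.
by rewrite -[X in (_ <= X)%E]adde0 leeD2lE // lee_fin ler10.
Qed.

Variable ker : T -> T -> \bar R.
Hypotheses (ker0 : forall x y, (0 <= ker x y)%E)
  (mker : forall x, measurable_fun setT (ker x)).

Definition pot x : \bar R := (\int[P]_y ker x y)%E.

Hypothesis mpot : measurable_fun setT pot.

Lemma pot_ge0 x : (0 <= pot x)%E.
Proof. by apply: integral_ge0 => y _; exact: ker0. Qed.

(* Method of conditional expectations: the points are chosen one by one, at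
   each step without increasing (by more than 1) the expected value of the
   total when the remaining points are drawn independently from [P]. *)
Lemma exists_kpairs (N : nat) : exists s, [/\ size s = N,
  (forall i, (i < size s)%N -> S (nth point s i)) &
  (kpairs ker s <= ((\int[P]_x pot x)%E *+ 'C(N, 2))%R + N%:R%:E)%E].
Proof.
set J := (\int[P]_x pot x)%E.
(* With [j] points chosen and [n] still to be drawn, the three terms count the pairs of chosen
   points, the mixed pairs, and the pairs of points to be drawn. *)
suff h j n : (j + n = N)%N -> exists s, [/\ size s = j,
    (forall i, (i < size s)%N -> S (nth point s i)) &
    (kpairs ker s + ((\sum_(b <- s) pot b)%E *+ n)%R + (J *+ 'C(n, 2))%R <=
      (J *+ 'C(N, 2))%R + j%:R%:E)%E].
  have [s [sN sS ks]] := h N 0 (addn0 N); exists s; split => //.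
  by move: ks; rewrite bin0n !mulr0n !addr0.
elim: j n => [n|j IH n] jn.
  exists [::]; split => //=; rewrite big_nil mul0rn add0r add0r.
  by rewrite -jn add0n adde0.
have [|s [sj sS ks]] := IH n.+1; first by rewrite addnS -addSn.
(* The part of the expected total that depends on the next point: its pairs with the chosen points
   and with the [n] points drawn after it. *)
pose g x := (\sum_(b <- s) ker b x + (pot x *+ n)%R)%E.
have mg : measurable_fun setT g.
  apply: emeasurable_funD; first exact: emeasurable_sum.
  under eq_fun do rewrite -mule_natmul; exact: measurable_funeM.
have [|z Sz gz] := exists_le_mean mg.
  move=> x; rewrite adde_ge0 ?sume_ge0 //.
  by rewrite -mule_natmul mule_ge0 // ?pot_ge0 // lee_fin.
move: gz.
have -> : (\int[P]_x g x = \sum_(b <- s) pot b + (J *+ n)%R)%E.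
  rewrite ge0_integralD //.
  - rewrite ge0_integral_sum //; congr (_ + _)%E.
    under eq_integral do rewrite -mule_natmul.
    by rewrite ge0_integralZl // ?mule_natmul // => x _; exact: pot_ge0.
  - by move=> x _; exact: sume_ge0.
  - exact: emeasurable_sum.
  - by move=> x _; rewrite -mule_natmul mule_ge0 // ?pot_ge0 // lee_fin.
  - under eq_fun do rewrite -mule_natmul; exact: measurable_funeM.
move=> gz; exists (z :: s); split.
- by rewrite /= sj.
- by case=> [|i] //=; rewrite ltnS; exact: sS.
rewrite /= big_cons.
rewrite -natr1 EFinD addeA; apply: le_trans (leeD2r 1%E ks).
rewrite [in leRHS]binS bin1 mulrnDr mulrnDl mulrS.
move: gz; rewrite /g; move: (kpairs ker s) (\sum_(b <- s) ker b z)%E (\sum_(b <- s) pot b)%E.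
move: (pot z *+ n)%R (J *+ n)%R (J *+ 'C(n, 2))%R => u Jn C k A X gz.
move: (X *+ n)%R => Y; rewrite (addeC k A) addeACA -(addeA (A + u)).
apply: le_trans (leeD2r _ gz) _; rewrite [leLHS]addeAC leeD2r //.
by rewrite (addeC X Y) (addeA k) [leRHS]addeACA [leRHS]addeC.
Qed.

End Selection.

(** * Upper bound for the energy on a lemniscate *)

Section Lemniscate.
Context {R : realType}.
Implicit Types (nu : probability (borelC R) R) (S : set R[i]).

(** Where [hlog] is at most [H] and [z != w], this is [2 * H - 2 * ln (normc (z - w))]. The
    truncation keeps it nonnegative on the whole plane, as the selection of points requires. *)
Definition pkern (H : R) (z w : R[i]) : \bar R :=
  (lkern z w + ((H - hcut H z) + (H - hcut H w))%:E)%E.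

Lemma hcut_le (H : R) z : hcut H z <= H.
Proof. by rewrite /hcut ge_min lexx orbT. Qed.

Lemma pkern_ge0 (H : R) z w : (0 <= pkern H z w)%E.
Proof.
rewrite adde_ge0 ?lkern_ge0 // lee_fin addr_ge0 // subr_ge0; exact: hcut_le.
Qed.

Lemma bmf_pkern_aux (H c : R) :
  bmf (fun w : borelC R => c + (H - hcut H w)).
Proof.
apply: bmfD; first exact: bmf_cst.
apply: bmfD; first exact: bmf_cst.
by under eq_fun do rewrite -mulN1r; apply: bmfZ; exact: bmf_hcut.
Qed.

Lemma Rint_pkern_aux nu (H c : R) :
  \int[nu]_w (c + (H - hcut H w)) = c + (H - \int[nu]_w hcut H w).
Proof.
rewrite RintD; [|exact: bmf_cst|].
  by rewrite RintB; [rewrite !Rint_cst|exact: bmf_cst|exact: bmf_hcut].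
apply: bmfD; first exact: bmf_cst.
by under eq_fun do rewrite -mulN1r; apply: bmfZ; exact: bmf_hcut.
Qed.

Lemma measurable_pkern (H : R) z : measurable_fun [set: borelC R] (pkern H z).
Proof.
apply: emeasurable_funD; first exact: measurable_lkern.
by apply/measurable_EFinP; case: (bmf_pkern_aux H (H - hcut H z)).
Qed.

Lemma pot_pkern nu (H : R) z : pot nu (pkern H) z =
  (lpot nu z + (H - \int[nu]_w hcut H w + (H - hcut H z))%:E)%E.
Proof.
rewrite /pot ge0_integralD //.
- rewrite EFin_RintT; last exact: bmf_pkern_aux.
  by rewrite Rint_pkern_aux (addrC (H - hcut H z)).
- by move=> w _; exact: lkern_ge0.
- exact: measurable_lkern.
- by move=> w _; rewrite lee_fin addr_ge0 // subr_ge0; exact: hcut_le.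
- by apply/measurable_EFinP; case: (bmf_pkern_aux H (H - hcut H z)).
Qed.

Lemma measurable_pot_pkern nu (H : R) :
  measurable_fun [set: borelC R] (pot nu (pkern H)).
Proof.
rewrite (funext (pot_pkern nu H)).
apply: emeasurable_funD; first exact: measurable_lpot.
by apply/measurable_EFinP; case: (bmf_pkern_aux H (H - \int[nu]_w hcut H w)).
Qed.

Lemma int_pot_pkern nu (H : R) : (\int[nu]_z pot nu (pkern H) z =
  benergy nu + (2 * (H - \int[nu]_w hcut H w))%:E)%E.
Proof.
have cH : 0 <= H - \int[nu]_w hcut H w.
  rewrite subr_ge0 -[leRHS](Rint_cst nu); apply: (@Rint_le_ae _ _ _ _ setT) => //.
  - exact: bmf_hcut.
  - exact: bmf_cst.
  - by rewrite setCT measure0.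
  - by move=> x _; exact: hcut_le.
under eq_integral do rewrite pot_pkern.
rewrite ge0_integralD //.
- rewrite EFin_RintT ?Rint_pkern_aux; last exact: bmf_pkern_aux.
  by congr (_ + _%:E)%E; ring.
- by move=> w _; exact: lpot_ge0.
- exact: measurable_lpot.
- by move=> w _; rewrite lee_fin addr_ge0 // subr_ge0; exact: hcut_le.
- by apply/measurable_EFinP; case: (bmf_pkern_aux H (H - \int[nu]_w hcut H w)).
Qed.

(** The kernel is +oo on the diagonal, so finiteness forces distinct points. [lnpairs] runs over
    ordered pairs, which absorbs the factor 2 of the kernel. *)
Lemma kpairs_pkern S (H : R) (s : seq R[i]) : (forall z, S z -> hlog z <= H) ->
  (forall a, a \in s -> S a) -> (kpairs (pkern H) s < +oo)%E ->
  uniq s /\ kpairs (pkern H) s =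
    (H * ((size s)%:R * ((size s)%:R - 1)) - lnpairs s)%:E.
Proof.
move=> SH; have hS z : S z -> hcut H z = hlog z.
  by move=> Sz; apply/min_idPl; exact: SH.
elim: s => [|a s IH] sS.
  by move=> _; split=> //=; rewrite /lnpairs big_nil mul0r mulr0 subr0.
have sS' b : b \in s -> S b by move=> bs; apply: sS; rewrite inE bs orbT.
have Sa : S a by apply: sS; rewrite mem_head.
have k0 : (0 <= kpairs (pkern H) s)%E.
  elim: s {IH sS sS'} => //= b s IH.
  by rewrite adde_ge0 // sume_ge0 // => c _; exact: pkern_ge0.
have s0 : (0 <= \sum_(b <- s) pkern H b a)%E.
  by rewrite sume_ge0 // => c _; exact: pkern_ge0.
rewrite /= => kfin.
have [us ks] : uniq s /\ kpairs (pkern H) s =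
    (H * ((size s)%:R * ((size s)%:R - 1)) - lnpairs s)%:E.
  apply: IH => //; apply: le_lt_trans kfin; exact: leeDl.
have as_ : a \notin s.
  have pa : pkern H a a = +oo%E by rewrite /pkern lkern_diag.
  apply/negP => sa; move: kfin; rewrite (big_rem a) //= pa addye ?addey ?ltxx //.
    by rewrite -ltNye (lt_le_trans _ k0).
  by rewrite -ltNye (@lt_le_trans _ _ 0%E) // sume_ge0 // => c _; exact: pkern_ge0.
split; first by rewrite as_.
rewrite ks lnpairs_cons.
have -> : (\sum_(b <- s) pkern H b a =
    (\sum_(b <- s) (2 * H - 2 * ln (normc (a - b))))%:E)%E.
  rewrite -sumEFin big_seq [RHS]big_seq; apply: eq_bigr => b sb.
  have ba : b != a by apply: contraNneq as_ => <-.
  rewrite /pkern lkern_neq // (hS _ (sS' _ sb)) (hS _ Sa) -EFinD normcBC.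
  by congr EFin; ring.
rewrite -EFinD sumrB -[X in _ + (_ - X)]mulr_sumr big_const_seq count_predT iter_addr_0.
by congr EFin; rewrite -mulr_natr -natr1; ring.
Qed.

(* The polynomials [p ^ (m / d) * X ^ (m mod d)], of every degree [m]. *)
Lemma exists_power_polys S (p : {poly R[i]}) (r B : R) :
  (forall z, S z -> normc z <= B) ->
  p \is monic -> (1 < size p)%N -> 0 < r ->
  (forall z, S z -> normc p.[z] <= r) ->
  exists rq D, [/\ 0 <= D, forall m, 0 < rq m,
    forall m, ln (rq m) <= m%:R * (ln r / (size p).-1%:R) + D &
    forall m, exists q, [/\ q \is monic, size q = m.+1 &
      forall z, S z -> normc q.[z] <= rq m]].
Proof.
move=> SB mp sp r0 pr.
set d := (size p).-1.
have d0 : (0 < d)%N by rewrite -ltnS prednK // ltnW.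
have dR : (0 : R) < d%:R by rewrite ltr0n.
pose C0 := ln r / d%:R.
pose B1 := Num.max 1 B.
have B11 : 1 <= B1 by rewrite le_max lexx.
(* As [m %% d] is at most [d], this pays for the factor [B1 ^+ (m %% d)] and for replacing
   [d * (m %/ d)] by [m] in the exponent, whatever the sign of [C0]. *)
pose D := d%:R * (ln B1 + `|C0|).
have D0 : 0 <= D by rewrite mulr_ge0 ?addr_ge0 ?ln_ge0 // ltW.
pose q m := p ^+ (m %/ d) * 'X^(m %% d).
pose rq m := r ^+ (m %/ d) * B1 ^+ (m %% d).
have rq0 m : 0 < rq m by rewrite mulr_gt0 // exprn_gt0 // (lt_le_trans _ B11).
have lnrq m : ln (rq m) <= m%:R * C0 + D.
  rewrite /rq lnM ?posrE ?exprn_gt0 ?(lt_le_trans _ B11) //.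
  rewrite !lnXn ?(lt_le_trans _ B11) //.
  have -> : ln r = d%:R * C0 by rewrite /C0 mulrC divfK // gt_eqF.
  rewrite -(mulr_natl (d%:R * C0)) -(mulr_natl (ln B1)) mulrA -natrM [in leRHS](divn_eq m d) natrD mulrDl -addrA lerD2l.
  rewrite -lerBlDl /D.
  have md : (m %% d)%:R <= d%:R :> R by rewrite ler_nat ltnW // ltn_mod.
  have l0 : 0 <= ln B1 by rewrite ln_ge0.
  have := ler_wpM2r l0 md; have := ler_wpM2r (normr_ge0 C0) md.
  have := ler_norm (- ((m %% d)%:R * C0)); rewrite normrN normrM normr_nat.
  by lra.
have hq m : exists q, [/\ q \is monic, size q = m.+1 &
     forall z, S z -> normc q.[z] <= rq m].
  exists (q m); split.
  - by rewrite monicMl ?monicXn // monic_exp.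
  - rewrite size_monicM ?monic_exp ?monic_neq0 ?monicXn // size_polyXn addnS /=.
    have -> : size (p ^+ (m %/ d)) = (d * (m %/ d)).+1.
      by rewrite -size_exp prednK // size_poly_gt0 monic_neq0 ?monic_exp.
    by rewrite addSn mulnC -divn_eq.
  - move=> z Sz; rewrite hornerM horner_exp hornerXn normcM !normcX.
    rewrite ler_pM ?exprn_ge0 ?normc_ge0 // lerXn2r ?nnegrE ?normc_ge0 ?pr ?(ltW r0) //.
      by rewrite (le_trans ler01).
    by rewrite (le_trans (SB _ Sz)) // le_max lexx orbT.
by exists rq, D.
Qed.

(* For N + 1 points of S with small mutual energy, [exists_small_diff], applied
   repeatedly to the polynomials of [exists_power_polys], bounds the product of
   all the differences; then N tends to infinity. *)
Lemma lemniscate_energy nu S (p : {poly R[i]}) (r B : R) :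
  measurable (S : set (borelC R)) -> supported_on S nu ->
  (forall z, S z -> normc z <= B) ->
  p \is monic -> (1 < size p)%N -> 0 < r ->
  (forall z, S z -> normc p.[z] <= r) ->
  (log_energy nu <= (ln r / (size p).-1%:R)%:E)%E.
Proof.
move=> mS nS SB mp sp r0 pr.
pose H : R := ln (1 + B ^+ 2).
have SH z : S z -> hlog z <= H.
  move=> Sz; rewrite ler_ln ?posrE ?sden_gt0 ?ltr_pwDl ?sqr_ge0 //.
  by rewrite lerD2l lerXn2r ?nnegrE ?normc_ge0 ?SB // (le_trans (normc_ge0 z)) ?SB.
rewrite (log_energyE mS nS SH); set c := \int[nu]_z hcut H z.
have [->|Efin] := eqVneq (benergy nu) +oo%E.
  by rewrite gt0_muley ?lte_fin ?divr_gt0 // addeNy leNye.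
have Ef : benergy nu \is a fin_num by rewrite ge0_fin_numE ?benergy_ge0 // ltey.
rewrite -(fineK Ef) -EFinM -EFinB lee_fin.
set E := fine (benergy nu); set d := (size p).-1; pose C0 := ln r / d%:R.
have [rq [D [D0 rq0 lnrq hq]]] := exists_power_polys SB mp sp r0 pr.
rewrite -/d -/C0 in lnrq.
(* [c - 1 / 2 * E] is the energy. The left side is linear in [N] and the right side logarithmic, so
   the energy cannot exceed [C0]. *)
have key (N : nat) : (0 < N)%N ->
    (c - 1 / 2 * E - C0) * (N%:R - 1) <= 2 * ln N%:R + 2 * D + 1.
  move=> N0.
  have [s [sN sS ks]] := exists_kpairs mS nS (pkern_ge0 H) (measurable_pkern H)
    (measurable_pot_pkern nu H) N.
  have sS' a : a \in s -> S a.
    by move=> sa; rewrite -(nth_index point sa); apply: sS; rewrite index_mem.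
  move: ks; rewrite int_pot_pkern -/c -(fineK Ef) -/E -EFinD -mule_natmul -EFinM -EFinD => ks.
  have [|us ks'] := kpairs_pkern SH sS'; first by rewrite (le_lt_trans ks) // ltry.
  move: ks; rewrite ks' lee_fin sN => ks.
  have := lnpairs_le rq0 hq us sS'; rewrite sN => hl.
  have NR : (0 : R) < N%:R by rewrite ltr0n.
  have sum_le : \sum_(m < N) (ln m.+1%:R + ln (rq m)) <=
      N%:R * ln N%:R + 'C(N, 2)%:R * C0 + N%:R * D.
    apply: (@le_trans _ _ (\sum_(m < N) (ln N%:R + m%:R * C0 + D))).
      apply: ler_sum => m _; rewrite -addrA lerD //.
      by rewrite ler_ln ?posrE ?ltr0n // ler_nat.
    rewrite !big_split /= !sumr_const card_ord -mulr_suml -natr_sum.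
    by rewrite -(big_mkord xpredT id) bin2_sum !mulr_natl.
  have bin2R : 2 * 'C(N, 2)%:R = N%:R * (N%:R - 1) :> R.
    have := bin_ffact N 2; rewrite ffactnS ffactn1 mulnC.
    case: N N0 {sN ks' hl sum_le ks NR} => // N _ /= h.
    by rewrite -natrM h natrM -natr1 addrK.
  rewrite -(ler_pM2l NR).
  have Ceq : 'C(N, 2)%:R = 2^-1 * (N%:R * (N%:R - 1)) :> R by lra.
  rewrite Ceq in ks sum_le.
  move: hl sum_le ks; move: (lnpairs s) (ln N%:R) => lp lN.
  move: (\sum_(m < N) _) (N%:R : R) => sg n; clear -E.
  by move=> hl sum_le ks; lra.
rewrite leNgt; apply/negP => lt; rewrite -subr_gt0 -/C0 in lt.
set del := c - 1 / 2 * E - C0 in lt key.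
(* The tangent bound [ln N <= N * e - 1 - ln e] makes [2 * ln N] at most [N * del / 2] plus a
   constant; half of the linear growth remains, and [A] is the constant that it has to beat. *)
pose e := del / 4.
have e0 : 0 < e by rewrite divr_gt0.
pose A := del + 2 * D + 1 - 2 * ln e.
have A0 : 0 <= `|A| / (del / 2) by rewrite divr_ge0 // ltW // divr_gt0.
have := archi_boundP A0; set N := Num.bound _ => AN.
have N0 : (0 < N)%N by rewrite -(@ltr0n R) (le_lt_trans A0).
have NR : (0 : R) < N%:R by rewrite ltr0n.
have := key N N0.
have lnN : ln N%:R <= N%:R * e - 1 - ln e.
  have : ln (N%:R * e) <= N%:R * e - 1.
    have := @le_ln1Dx R (N%:R * e - 1); rewrite (addrC 1) subrK; apply.
    by rewrite ltrBrDl subrr mulr_gt0.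
  by rewrite lnM ?posrE //; lra.
move: AN; rewrite ltr_pdivrMr ?divr_gt0 // => AN.
have := ler_norm A; rewrite /A in AN *; rewrite /e in lnN *.
move: (ln N%:R) (ln (del / 4)) lnN AN => u v lnN AN; lra.
Qed.

End Lemniscate.

(** * Weak limits of averages along an ultrafilter *)

Lemma ultra_fmap (T V : Type) (f : T -> V) (U : set_system T) :
  UltraFilter U -> UltraFilter (f @ U).
Proof.
move=> UU; have PU : ProperFilter U by exact: ultra_proper.
split; first exact: fmap_proper_filter.
move=> G PG sub; apply/seteqP; split=> [A GA|]; last exact: sub.
have [//|UnA] := in_ultra_setVsetC (f @^-1` A) UU.
have GnA : G (~` A) by apply: sub.
have : G (A `&` ~` A) by exact: filterI.
by rewrite setICr => /filter_not_empty.
Qed.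

Section UniformContinuity.
Context {R : realType}.

Lemma compact_uniform_continuity (S : set R[i]) (f : R[i] -> R) (e : R) :
  compact S -> continuous f -> 0 < e -> exists2 del : R, 0 < del &
    forall z w, S z -> normc (z - w) < del -> `|f z - f w| < e.
Proof.
move=> /compact_near_coveringP cS /continuous_cplxP cf e0.
pose Q (del : R) z := forall w, normc (z - w) < del -> `|f z - f w| < e.
suff : \forall del \near at_right (0 : R), S `<=` Q del.
  move=> h; near (at_right (0 : R)) => del; exists del => [|z w Sz].
    by near: del; exact: nbhs_right_gt.
  by have : S `<=` Q del by [near: del]; move=> /(_ z Sz); exact.
apply: cS => z Sz; have e20 : 0 < e / 2 by rewrite divr_gt0.
have [d d0 hd] := cf z _ e20; have d20 : 0 < d / 2 by rewrite divr_gt0.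
have nb (t : R) : 0 < t -> nbhs z [set x | normc (z - x) < t].
  move=> t0; rewrite -nbhs_ballE; exists t%:C; first by rewrite /= ltcR.
  by move=> w; rewrite -ball_normE /= norm_normcE ltcR.
exists ([set x | normc (z - x) < d / 2], [set del | del < d / 2]).
  by split=> /=; [exact: nb|exact: nbhs_right_lt].
move=> [x del] /= [zx del1] w xw.
have zw : normc (z - w) < d.
  rewrite -(subrKA x z (- w)); apply: le_lt_trans (normc_triD _ _) _.
  by rewrite (splitr d) ltrD // (lt_trans xw).
have h1 := hd _ zw; have h2 : `|f z - f x| < e / 2.
  by apply: hd; rewrite (lt_trans zx) // ltr_pdivrMr // ltr_pMr // ltr1n.
rewrite -(subrKA (f z) (f x) (- f w)) (splitr e).
by apply: le_lt_trans (ler_normD _ _) _; rewrite ltrD // distrC.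
Unshelve. all: by end_near. Qed.

End UniformContinuity.

(** * Limiting frequencies of binary words *)

Section Weights.
Context {R : realType} (bit : nat -> nat -> bool) (U : set_system nat).
Hypothesis UU : UltraFilter U.

Let PU : ProperFilter U. Proof. exact: ultra_proper. Qed.
#[local] Existing Instance PU.

Definition word j i : seq bool := mkseq (bit^~ i) j.

Definition freq (s : seq bool) (N : nat) : R :=
  (\sum_(i < N.+1) (word (size s) i == s)%:R) / N.+1%:R.

Lemma wordS j i : word j.+1 i = rcons (word j i) (bit j i).
Proof. by rewrite /word mkseqS. Qed.

Lemma freq_ge0 s N : 0 <= freq s N.
Proof. by rewrite divr_ge0 // sumr_ge0. Qed.

Lemma freq_le1 s N : freq s N <= 1.
Proof.
rewrite ler_pdivrMr // mul1r.
apply: (@le_trans _ _ (\sum_(i < N.+1) (1 : R))).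
  by apply: ler_sum => i _; case: (_ == _).
by rewrite sumr_const card_ord.
Qed.

Lemma freq_split s N : freq s N = freq (rcons s false) N + freq (rcons s true) N.
Proof.
rewrite /freq -mulrDl -big_split; congr (_ / _); apply: eq_bigr => i _.
rewrite !size_rcons wordS !eqseq_rcons /=.
by case: (_ == s) => //=; case: (bit _ _) => /=; rewrite ?addr0 ?add0r.
Qed.

(** Along an ultrafilter all the frequencies converge at once, by compactness of [0, 1], with no
    diagonal extraction; their additivity passes to the limit. *)
Definition wt s : R := lim (freq s @ U).

Lemma cvg_freq s : freq s @ U --> wt s.
Proof.
have := @segment_compact R 0 1; rewrite compact_ultra.
move=> /(_ (freq s @ U) (ultra_fmap _ UU)) h.
have [|p [_ cp]] := h; last exact: cvgP cp.
by apply: nearW => N /=; rewrite in_itv /= freq_ge0 freq_le1.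
Qed.

Lemma wt_ge0 s : 0 <= wt s.
Proof.
apply: limr_ge; first exact: cvg_freq.
by apply: nearW => N; exact: freq_ge0.
Qed.

Lemma wt_split s : wt s = wt (rcons s false) + wt (rcons s true).
Proof.
apply/cvg_lim => //.
have -> : freq s = freq (rcons s false) \+ freq (rcons s true).
  by apply/funext => N; exact: freq_split.
by apply: cvgD; exact: cvg_freq.
Qed.

Lemma wt_nil : wt [::] = 1.
Proof.
apply/cvg_lim => //.
rewrite (_ : freq [::] = cst 1); first exact: cvg_cst.
apply/funext => N; rewrite /freq (eq_bigr (fun=> 1)) //.
by rewrite sumr_const card_ord divff.
Qed.

Lemma wt_gt0_ex s : 0 < wt s -> exists i, word (size s) i = s.
Proof.
move=> w0; apply: contrapT => nex.
have : wt s = 0.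
  apply/cvg_lim => //.
  rewrite (_ : freq s = cst 0); first exact: cvg_cst.
  apply/funext => N; rewrite /freq big1 ?mul0r // => i _.
  by case: eqP => // e; case: nex; exists i.
by move=> w00; rewrite w00 ltxx in w0.
Qed.

(* The unit interval is cut into intervals of length [wt s], in the
   lexicographic order of the words [s] of any given length. *)
Definition lft (s : seq bool) : R :=
  \sum_(k < size s) if nth false s k then wt (rcons (take k s) false) else 0.

Lemma lft_rcons s b :
  lft (rcons s b) = lft s + if b then wt (rcons s false) else 0.
Proof.
rewrite /lft size_rcons big_ord_recr /= nth_rcons ltnn eqxx.
congr (_ + _); last first.
  by rewrite -[rcons s b]cats1 take_size_cat.
by apply: eq_bigr => k _; rewrite nth_rcons ltn_ord -[rcons s b]cats1 takel_cat // ltnW.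
Qed.

(** For [u] in [0, 1), the word of length [j] whose interval contains [u]: the interval of [s] is
    cut at [lft s + wt (rcons s false)]. Words of weight 0 have empty intervals and are never
    visited. *)
Fixpoint walk (u : R) j : seq bool :=
  if j is j'.+1 then
    let s := walk u j' in rcons s (lft s + wt (rcons s false) <= u)
  else [::].

Lemma size_walk u j : size (walk u j) = j.
Proof. by elim: j => //= j IH; rewrite size_rcons IH. Qed.

Lemma walk_take u j k : (j <= k)%N -> walk u j = take j (walk u k).
Proof.
elim: k => [|k IH]; first by rewrite leqn0 => /eqP ->.
rewrite leq_eqVlt => /predU1P[->|]; first by rewrite take_oversize // size_walk.
rewrite ltnS => jk; rewrite IH //= -cats1 takel_cat // size_walk //.
Qed.

Lemma walk_itv u j : 0 <= u < 1 ->
  lft (walk u j) <= u < lft (walk u j) + wt (walk u j).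
Proof.
move=> u01; elim: j => [|j] /=.
  by rewrite wt_nil /lft big_ord0 add0r.
rewrite (wt_split (walk u j)) lft_rcons => /andP[a b].
have [c|c] := leP (lft (walk u j) + wt (rcons (walk u j) false)) u; apply/andP; split; lra.
Qed.

Lemma walkP u s : lft s <= u < lft s + wt s -> walk u (size s) = s.
Proof.
elim/last_ind: s => // s b IH; rewrite lft_rcons size_rcons /= => h.
have w0 := wt_ge0 (rcons s false); have w1 := wt_ge0 (rcons s true).
have -> : walk u (size s) = s.
  by apply: IH; rewrite wt_split; case: b h => /andP[h1 h2]; apply/andP; split; lra.
congr rcons; case: b h => /andP[h1 h2]; first by apply/idP; lra.
by apply/negbTE; rewrite -ltNge; lra.
Qed.

Lemma itv_unit u s : lft s <= u < lft s + wt s -> 0 <= u < 1.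
Proof.
elim/last_ind: s => [|s b IH]; first by rewrite wt_nil /lft big_ord0 add0r.
have w0 := wt_ge0 (rcons s false); have w1 := wt_ge0 (rcons s true).
rewrite lft_rcons => h; apply: IH; rewrite wt_split.
by case: b h => /andP[h1 h2]; apply/andP; split; lra.
Qed.

Lemma walk_preimage s :
  [set u | walk u (size s) = s] `&` `[0, 1[%classic =
  `[lft s, lft s + wt s[%classic.
Proof.
apply/seteqP; split=> u /=; rewrite !in_itv /=.
  by move=> [us /(walk_itv (size s))]; rewrite us.
by move=> h; split; [exact: walkP|exact: itv_unit h].
Qed.

(** Words are countable: once the previous word is fixed, the next letter depends on [u] only
    through a half-line. *)
Lemma measurable_walk j (A : set (seq bool)) : measurable [set u | A (walk u j)].
Proof.
elim: j A => [|j IH] A /=.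
  have [A0|A0] := pselect (A [::]).
    by rewrite (_ : [set u | _] = setT) //; apply/seteqP; split.
  by rewrite (_ : [set u | _] = set0) //; apply/seteqP; split.
have -> : [set u | A (rcons (walk u j)
      (lft (walk u j) + wt (rcons (walk u j) false) <= u))] =
    \bigcup_s ([set u | walk u j = s] `&`
      [set u | A (rcons s (lft s + wt (rcons s false) <= u))]).
  apply/seteqP; split=> [u Au|u [s _ [/= <-]]] //=.
  by exists (walk u j).
apply: countable_bigcupT_measurable => [|s]; first exact: countableP.
apply: measurableI.
  exact: (IH [set s]).
rewrite (_ : [set u | _] = (`[lft s + wt (rcons s false), +oo[ `&`
     [set _ | A (rcons s true)]) `|`
   (`]-oo, lft s + wt (rcons s false)[ `&` [set _ | A (rcons s false)])).
  have mc (P : Prop) : measurable [set _ : R | P].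
    have [p|np] := pselect P.
      by rewrite (_ : [set _ | _] = setT) //; apply/seteqP; split.
    by rewrite (_ : [set _ | _] = set0) //; apply/seteqP; split.
  by apply: measurableU; apply: measurableI.
apply/seteqP; split=> u /=; rewrite !in_itv /= andbT.
  by case: leP => h; [left|right].
by case: leP => h [[]|[]].
Qed.

End Weights.

Lemma cvg_fsum (R : realType) (T I : Type) (F : set_system T) (r : seq I)
    (f : I -> T -> R) (a : I -> R) : Filter F ->
  (forall i, f i x @[x --> F] --> a i) ->
  \sum_(i <- r) f i x @[x --> F] --> \sum_(i <- r) a i.
Proof.
move=> FF fa; elim: r => [|i r IH].
  by rewrite big_nil; under eq_fun do rewrite big_nil; exact: cvg_cst.
by rewrite big_cons; under eq_fun do rewrite big_cons; exact: cvgD.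
Qed.

Lemma exists_law (R : realType) d d' (T : measurableType d)
    (V : measurableType d') (P : probability T R) (X : T -> V) :
  measurable_fun setT X ->
  exists nu : probability V R, (forall A, nu A = P (X @^-1` A)) /\
    forall f : V -> R, bmf f -> \int[nu]_y f y = \int[P]_x f (X x).
Proof.
move=> mX.
pose Xm : {mfun T >-> V} := HB.pack X (isMeasurableFun.Build _ _ _ _ X mX).
exists (distribution P Xm); split=> // f bf.
rewrite /Rintegral integral_pushforward //.
- by apply/measurable_EFinP; case: bf.
- apply: bmf_integrable; case: bf => mf [M fM]; split; first exact: measurableT_comp.
  by exists M => x; exact: fM.
Qed.

(** * Lebesgue measure on the unit interval *)

Section UnitInterval.
Context {R : realType}.

Definition leb01 := mrestr (@lebesgue_measure R) (measurable_itv `[0, 1[).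

HB.instance Definition _ := Measure.on leb01.

Lemma leb01_setT : leb01 setT = 1%E.
Proof.
by rewrite /leb01 /mrestr setTI lebesgue_measure_itv /= lte_fin ltr01 oppr0 adde0.
Qed.

HB.instance Definition _ := Measure_isProbability.Build _ _ _ leb01 leb01_setT.

End UnitInterval.

(** * The weak limit as the law of a map on the unit interval *)

Section WeakLimit.
Context {R : realType} (S : set R[i]) (z : nat -> R[i])
  (bit : nat -> nat -> bool) (dd : nat -> R) (U : set_system nat).
Hypotheses (UU : UltraFilter U) (cS : compact S) (zS : forall i, S (z i)).
Hypothesis ddP : forall j i i', word bit j i = word bit j i' ->
  normc (z i - z i') <= dd j.
Hypothesis dd0 : forall e, 0 < e -> exists j, dd j < e.

Implicit Types (u : R).

Let PU : ProperFilter U. Proof. exact: ultra_proper. Qed.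
#[local] Existing Instance PU.

(* [rep s] is meaningful only when [s] is the code of some [z i]. *)
Definition rep (s : seq bool) : R[i] :=
  z (xget 0%N [set i | word bit (size s) i = s]).

Lemma rep_word s : (exists i, word bit (size s) i = s) ->
  exists2 i, rep s = z i & word bit (size s) i = s.
Proof. by move=> h; exists (xget 0%N [set i | word bit (size s) i = s]) => //; case: h => i0 hi0; exact: (xgetI (P := [set i | word bit (size s) i = s]) 0%N hi0). Qed.

Lemma word_take j k i : (j <= k)%N -> word bit j i = take j (word bit k i).
Proof.
move=> jk; apply: (@eq_from_nth _ false); first by rewrite size_takel !size_mkseq.
by move=> l; rewrite size_mkseq => lj; rewrite nth_take // !nth_mkseq // (leq_trans lj).
Qed.

(** The interval of the word contains [u], so its weight is positive and the word is the code of
    some [z i]. *)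
Lemma rep_walk u j : 0 <= u < 1 ->
  exists2 i, rep (walk bit U u j) = z i & word bit j i = walk bit U u j.
Proof.
move=> u01; have /andP[a b] := walk_itv bit UU j u01.
have [|i ri wi] := @rep_word (walk bit U u j).
  by apply: (@wt_gt0_ex R _ _ UU); move: (le_lt_trans a b); rewrite ltrDl.
by exists i => //; rewrite -{1}(size_walk bit U u j).
Qed.

(** From rank [j] on, the representatives have codes with the same first [j] letters, so they stay
    within [dd j] of the [j]-th one; a cluster point inherits all these bounds. *)
Lemma exists_walk_limit u : 0 <= u < 1 ->
  exists x, S x /\ forall j, normc (x - rep (walk bit U u j)) <= dd j.
Proof.
move=> u01; pose y k := rep (walk bit U u k).
have yS k : S (y k) by rewrite /y; have [i -> _] := rep_walk k u01.
have yF : (y @ \oo) S by exists 0%N => // k _; exact: yS.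
have [x [Sx clx]] := cS (fmap_proper_filter y eventually_filter) yF.
exists x; split=> // j.
have clF : closed [set w : R[i] | normc (w - y j) <= dd j].
  exact: (closed_sublevel (@continuous_normcB R (y j))).
apply: clF; move: clx; rewrite clusterE; apply.
exists j => // k /= jk; rewrite /y.
have [i -> wi] := rep_walk k u01; have [i' -> wi'] := rep_walk j u01.
by apply: ddP; rewrite (word_take _ jk) wi wi' -walk_take.
Qed.

Definition walk_limit (u : R) : R[i] :=
  if 0 <= u < 1 then
    xget (z 0) [set x | S x /\ forall j, normc (x - rep (walk bit U u j)) <= dd j]
  else z 0.

Lemma walk_limitP u : 0 <= u < 1 -> S (walk_limit u) /\
  forall j, normc (walk_limit u - rep (walk bit U u j)) <= dd j.
Proof.
move=> u01; rewrite /walk_limit u01.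
exact: xgetPex (exists_walk_limit u01).
Qed.

Lemma walk_limit_in u : S (walk_limit u).
Proof.
have [u01|u01] := boolP (0 <= u < 1); first by case: (walk_limitP u01).
by rewrite /walk_limit (negbTE u01).
Qed.

Lemma measurable_walk_limit :
  measurable_fun [set: R] (walk_limit : R -> borelC R).
Proof.
refine (measurability (rT := borelC R) (@open R[i]) erefl _).
move=> _ [A oA <-]; rewrite setTI.
(* For [u] in [0, 1), the limit is in the open set [A] exactly when, for some [j], the closed ball
   of radius [dd j] around the [j]-th representative is in [A]. This is a countable union of events
   on words. *)
have -> : walk_limit @^-1` A =
   (`[0, 1[%classic `&` \bigcup_j [set u | [set s | forall w : R[i],
       normc (w - rep s) <= dd j -> A w] (walk bit U u j)]) `|`
   (~` `[0, 1[%classic `&` [set _ | A (z 0)]).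
  apply/seteqP; split=> u /=; rewrite in_itv /=.
    move=> Au; have [u01|/negP u01] := boolP (0 <= u < 1); last first.
      by right; split => //; move: Au; rewrite /walk_limit; case: ifP => // /u01.
    left; split => //; have [_ hX] := walk_limitP u01.
    move: oA; rewrite openE => /(_ _ Au).
    rewrite /interior /= -nbhs_ballE => -[_/posnumP[e]] sub.
    have [d d0 de] := cplx_posE (gt0 e); rewrite de in sub.
    have [j jd] := dd0 (divr_gt0 d0 (ltr0n _ 2)).
    exists j => // w wr; apply: sub; rewrite -ball_normE /= norm_normcE ltcR.
    rewrite -(subrKA (rep (walk bit U u j)) (walk_limit u) (- w)).
    apply: le_lt_trans (normc_triD _ _) _; rewrite (splitr d) ltrD //.
      by rewrite (le_lt_trans (hX j)).
    by rewrite normcBC (le_lt_trans wr).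
  move=> [[u01 [j _ /= h]]|[u01 Oz]].
    by apply: h; case: (walk_limitP u01).
  by rewrite /walk_limit; case: ifP => // /u01.
apply: measurableU; apply: measurableI => //.
- by apply: bigcupT_measurable => j; exact: measurable_walk.
- by apply: measurableC.
have [p|np] := pselect (A (z 0)).
  by rewrite (_ : [set _ | _] = setT) //; apply/seteqP; split.
by rewrite (_ : [set _ | _] = set0) //; apply/seteqP; split.
Qed.

Definition avg (f : R[i] -> R) (N : nat) : R :=
  (\sum_(i < N.+1) f (z i)) / N.+1%:R.

Lemma leb01_out : (@leb01 R) (~` `[0, 1[%classic) = 0%E.
Proof. by rewrite /leb01 /mrestr setICl measure0. Qed.

Lemma leb01_walk s : (@leb01 R) [set u | walk bit U u (size s) = s] = (wt bit U s)%:E.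
Proof.
rewrite /leb01 /mrestr walk_preimage // lebesgue_measure_itv /= lte_fin ltrDl.
case: ltP => [_|w0]; first by rewrite -EFinD addrAC subrr add0r.
by congr EFin; apply/eqP; rewrite eq_le w0 wt_ge0.
Qed.

Lemma sum_word (j : nat) (w : seq bool) (F : seq bool -> R) : size w = j ->
  \sum_(s : j.-tuple bool) (w == s)%:R * F s = F w.
Proof.
move=> /eqP wj; rewrite (bigD1 (Tuple wj)) //= eqxx mul1r big1 ?addr0 // => s.
rewrite eq_sym => ws; rewrite (_ : (w == s) = false) ?mul0r //.
by apply: contraNF ws => /eqP ws; apply/eqP/val_inj.
Qed.

Lemma size_word j i : size (word bit j i) = j.
Proof. by rewrite size_mkseq. Qed.

Lemma avg_rep f j e N : (forall x w, S x -> normc (x - w) <= dd j -> `|f x - f w| <= e) ->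
  `|avg f N - \sum_(s : j.-tuple bool) freq bit s N * f (rep s)| <= e.
Proof.
move=> hf.
have -> : \sum_(s : j.-tuple bool) freq bit s N * f (rep s) =
    (\sum_(i < N.+1) f (rep (word bit j i))) / N.+1%:R.
  under eq_bigr do rewrite /freq size_tuple mulrAC.
  rewrite -mulr_suml; congr (_ / _).
  under eq_bigr do rewrite mulr_suml.
  rewrite exchange_big /=; apply: eq_bigr => i _.
  exact: (sum_word (fun s => f (rep s)) (size_word j i)).
rewrite /avg -mulrBl -sumrB normrM normfV normr_nat ler_pdivrMr //.
apply: le_trans (ler_norm_sum _ _ _) _.
apply: (@le_trans _ _ (\sum_(i < N.+1) e)); last by rewrite sumr_const card_ord mulr_natr.
apply: ler_sum => i _; apply: hf => //.
have [|i' -> wi'] := @rep_word (word bit j i).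
  by exists i; rewrite size_word.
by apply: ddP; rewrite size_word in wi'; rewrite wi'.
Qed.

Lemma walk_eq_indic j (s : seq bool) :
  (fun u : R => (walk bit U u j == s)%:R : R) = \1_[set u | walk bit U u j = s].
Proof.
apply/funext => u; rewrite indicE; congr ((nat_of_bool _)%:R).
by apply/idP/idP => [/eqP h|/set_mem /eqP //]; exact/mem_set.
Qed.

Lemma bmf_walk_eq j (s : seq bool) :
  bmf (fun u : R => (walk bit U u j == s)%:R : R).
Proof.
split; last by exists 1 => u; case: (_ == _); rewrite ?normr1 ?normr0.
rewrite walk_eq_indic; apply/measurable_indicP.
exact: (@measurable_walk R bit U j [set s]).
Qed.

Lemma Rint_walk_eq j (s : j.-tuple bool) :
  \int[@leb01 R]_u ((walk bit U u j == s)%:R : R) = wt bit U s.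
Proof.
rewrite walk_eq_indic /Rintegral integral_indic //; last first.
  exact: (@measurable_walk R bit U j [set tval s]).
rewrite setIT; have := leb01_walk s; rewrite size_tuple => h.
exact: (congr1 fine h).
Qed.

Lemma int_rep (f : R[i] -> R) j e : bmf (f : borelC R -> R) ->
  (forall x w, S x -> normc (x - w) <= dd j -> `|f x - f w| <= e) ->
  `|\int[@leb01 R]_u f (walk_limit u) -
    \sum_(s : j.-tuple bool) wt bit U s * f (rep s)| <= e.
Proof.
move=> bf hf; pose g u := \sum_(s : j.-tuple bool) (walk bit U u j == s)%:R * f (rep s).
have bs (s : j.-tuple bool) : bmf (fun u : R => (walk bit U u j == s)%:R * f (rep s)).
  by apply: bmfM; [exact: bmf_walk_eq|exact: bmf_cst].
have bg : bmf (g : R -> R) by exact: bmf_sum.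
have bX : bmf (fun u : R => f (walk_limit u)).
  have [mf [M fM]] := bf; split; last by exists M => u; exact: fM.
  exact: measurableT_comp mf measurable_walk_limit.
have -> : \sum_(s : j.-tuple bool) wt bit U s * f (rep s) = \int[@leb01 R]_u g u.
  rewrite Rint_sum //; apply: eq_bigr => s _.
  under eq_Rintegral do rewrite mulrC.
  by rewrite RintZ ?Rint_walk_eq 1?mulrC //; exact: bmf_walk_eq.
have gX u : 0 <= u < 1 -> `|f (walk_limit u) - g u| <= e.
  move=> u01; rewrite /g (sum_word (fun s => f (rep s)) (size_walk bit U u j)).
  by apply: hf; case: (walk_limitP u01).
have m01 : measurable (`[0, 1[%classic : set R) by exact: measurable_itv.
have be : bmf (fun _ : R => e) by exact: bmf_cst.
have le1 : \int[@leb01 R]_u g u <= \int[@leb01 R]_u (f (walk_limit u) + e).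
  apply: (@Rint_le_ae _ _ R (@leb01 R) _ _ _ bg (bmfD bX be) m01 leb01_out) => u /=; rewrite in_itv /=.
  by move=> /gX; rewrite ler_norml => /andP[]; lra.
have le2 : \int[@leb01 R]_u f (walk_limit u) <= \int[@leb01 R]_u (g u + e).
  apply: (@Rint_le_ae _ _ R (@leb01 R) _ _ _ bX (bmfD bg be) m01 leb01_out) => u /=; rewrite in_itv /=.
  by move=> /gX; rewrite ler_norml => /andP[]; lra.
move: le1 le2; rewrite !RintD // Rint_cst => le1 le2.
by rewrite ler_distl lerBlDr le1 le2.
Qed.

(** By uniform continuity, replacing points by representatives of their words of length [j] changes
    averages ([avg_rep]) and integral ([int_rep]) by little. Only finitely many frequencies remain,
    and they converge to the weights. *)
Lemma exists_weak_limit : exists nu : probability (borelC R) R,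
  supported_on S nu /\ forall f : R[i] -> R, continuous f -> bmf (f : borelC R -> R) ->
    avg f @ U --> \int[nu]_x f x.
Proof.
have [nu [nuE nuI]] := exists_law (@leb01 R) measurable_walk_limit.
exists nu; split.
  rewrite /supported_on nuE (_ : _ @^-1` _ = set0) ?measure0 //.
  by apply/seteqP; split=> // u /=; apply; exact: walk_limit_in.
move=> f cf bf; rewrite nuI //.
apply/cvgrPdist_lt => e e0; have e40 : 0 < e / 4 by rewrite divr_gt0.
have [del del0 hdel] := compact_uniform_continuity cS cf e40.
have [j jdel] := dd0 del0.
have hf x w : S x -> normc (x - w) <= dd j -> `|f x - f w| <= e / 4.
  by move=> Sx xw; apply/ltW/hdel => //; exact: le_lt_trans jdel.
have h1 := int_rep bf hf.
have cA : \sum_(s : j.-tuple bool) freq bit s N * f (rep s) @[N --> U] -->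
    \sum_(s : j.-tuple bool) wt bit U s * f (rep s).
  by apply: cvg_fsum => s; apply: cvgMr_tmp; exact: cvg_freq.
have /cvgrPdist_lt/(_ _ e40) h2 := cA.
near=> N; have h3 := avg_rep N hf.
have h4 : `|\sum_(s : j.-tuple bool) wt bit U s * f (rep s) -
  \sum_(s : j.-tuple bool) freq bit s N * f (rep s)| < e / 4 by near: N.
move: h1 h3 h4; rewrite !ler_norml !ltr_norml.
by move=> /andP[? ?] /andP[? ?] /andP[? ?]; apply/andP; split; lra.
Unshelve. all: by end_near. Qed.

End WeakLimit.

(** * Binary codes of the points of a bounded set *)

Section BinaryCode.
Context {R : realType}.

Lemma truncn_double (t : R) : 0 <= t ->
  Num.truncn (2 * t) = (odd (Num.truncn (2 * t)) + (Num.truncn t).*2)%N.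
Proof.
move=> t0; have /truncn_itv/andP[a b] : 0 <= 2 * t by rewrite mulr_ge0.
rewrite -[LHS]odd_double_half; congr (_ + _.*2)%N; apply/esym/eqP.
rewrite truncn_eq //; set m := Num.truncn _ in a b *.
have hm : m%:R = (odd m)%:R + 2 * (m./2)%:R :> R.
  by rewrite -{1}(odd_double_half m) natrD -mul2n natrM.
have o0 : 0 <= (odd m)%:R :> R by [].
have o1 : (odd m)%:R <= 1 :> R by case: (odd m).
by rewrite -natr1 in b *; apply/andP; split; lra.
Qed.

(** By [truncn_double] equal digits rebuild equal integer parts at scale [2 ^+ n], so both numbers
    lie in the same dyadic interval. *)
Lemma truncn_bits (t u : R) n : 0 <= t < 1 -> 0 <= u < 1 ->
  (forall k, (k < n)%N ->
     odd (Num.truncn (2 ^+ k.+1 * t)) = odd (Num.truncn (2 ^+ k.+1 * u))) ->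
  `|t - u| <= 2 ^- n.
Proof.
move=> /andP[t0 t1] /andP[u0 u1] h.
have : Num.truncn (2 ^+ n * t) = Num.truncn (2 ^+ n * u).
  elim: n h => [|n IH] h.
    rewrite expr0 !mul1r; have -> : Num.truncn t = 0%N.
      by apply/eqP; rewrite truncn_eq // t0 t1.
    by apply/esym/eqP; rewrite truncn_eq // u0 u1.
  rewrite exprS -!mulrA [LHS]truncn_double ?mulr_ge0 ?exprn_ge0 //.
  rewrite [RHS]truncn_double ?mulr_ge0 ?exprn_ge0 //.
  by rewrite !mulrA -exprS h // IH // => k kn; apply: h; exact: ltnW.
have p0 : (0 : R) < 2 ^+ n by rewrite exprn_gt0.
have /truncn_itv/andP[a b] : 0 <= 2 ^+ n * t by rewrite mulr_ge0 // ltW.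
have /truncn_itv/andP[c d] : 0 <= 2 ^+ n * u by rewrite mulr_ge0 // ltW.
move=> e; rewrite -e -natr1 in c d; rewrite -natr1 in b.
rewrite -(ler_pM2l p0) mulfV ?gt_eqF // -[X in X * _](gtr0_norm p0) -normrM.
by rewrite mulrBr ler_norml; apply/andP; split; lra.
Qed.

(* Dyadic digits of the rescaled real and imaginary parts, interleaved. *)
Lemma exists_bits (S : set R[i]) (z : nat -> R[i]) : compact S ->
  (forall i, S (z i)) -> exists (bit : nat -> nat -> bool) (dd : nat -> R),
  (forall j i i', word bit j i = word bit j i' -> normc (z i - z i') <= dd j) /\
  (forall e, 0 < e -> exists j, dd j < e).
Proof.
move=> cS zS; have [r r1 hr] := compact_bounded_cplx cS.
have r0 : 0 < r by exact: lt_le_trans r1.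
(* Dividing by [4 * r] rather than [2 * r] keeps the image of [r] strictly below 1. *)
pose co (a : R) := (a + r) / (4 * r).
have co01 a : `|a| <= r -> 0 <= co a < 1.
  rewrite ler_norml => /andP[ra ar]; apply/andP; split.
    by rewrite divr_ge0 ?mulr_ge0 ?(ltW r0) //; lra.
  by rewrite ltr_pdivrMr ?mulr_gt0 // mul1r; lra.
pose x i := co (complex.Re (z i)); pose y i := co (complex.Im (z i)).
have x01 i : 0 <= x i < 1 by apply: co01; exact: le_trans (Re_le_normc _) (hr _ (zS i)).
have y01 i : 0 <= y i < 1 by apply: co01; exact: le_trans (Im_le_normc _) (hr _ (zS i)).
pose bit j i := odd (Num.truncn (2 ^+ (j./2).+1 * (if odd j then y i else x i))).
(* A word of length [j] contains at least [j./2] digits of each coordinate; undoing the scaling,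
   each coordinate contributes [4 * r * 2 ^- (j./2)]. *)
exists bit, (fun j => 8 * r * 2 ^- (j./2)); split=> [j i i' e|e e0].
  have eb k : (k < j)%N -> bit k i = bit k i'.
    by move=> kj; have := congr1 (fun s => nth false s k) e; rewrite !nth_mkseq.
  have hx : `|x i - x i'| <= 2 ^- (j./2).
    apply: truncn_bits => // k kj; have := eb k.*2.
    rewrite /bit doubleK odd_double; apply.
    by rewrite -(odd_double_half j) ltn_addl // ltn_double.
  have hy : `|y i - y i'| <= 2 ^- (j./2).
    apply: truncn_bits => // k kj; have := eb k.*2.+1.
    rewrite /bit /= uphalf_double odd_double; apply.
    rewrite -(odd_double_half j); apply: (@leq_trans (j./2).*2); last exact: leq_addl.
    by rewrite -doubleS leq_double.
  have r40 : 0 < 4 * r by rewrite mulr_gt0.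
  apply: le_trans (normc_le_ReIm _) _.
  have -> : 8 * r * 2 ^- (j./2) = 4 * r * 2 ^- (j./2) + 4 * r * 2 ^- (j./2) by ring.
  apply: lerD; rewrite -ler_pdivrMl // -[X in X * _](gtr0_norm (x := (4 * r)^-1)) ?invr_gt0 //.
    rewrite -normrM; apply: le_trans hx; rewrite le_eqVlt; apply/orP; left; apply/eqP.
    congr `|_|; rewrite /x /co; case: (z i) (z i') => a b [c d] /=.
    by field; rewrite gt_eqF.
  rewrite -normrM; apply: le_trans hy; rewrite le_eqVlt; apply/orP; left; apply/eqP.
  congr `|_|; rewrite /y /co; case: (z i) (z i') => a b [c d] /=.
  by field; rewrite gt_eqF.
have [n hn] : exists n : nat, 8 * r * 2 ^- n < e.
  have /cvgrPdist_lt/(_ e e0) : geometric (8 * r) (2^-1) @ \oo --> (0 : R).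
    by apply: cvg_geometric; rewrite ger0_norm ?invr_ge0 // invf_lt1 // ltr1n.
  move=> [n _ h]; exists n; have := h n (leqnn n).
  rewrite sub0r normrN /geometric /= exprVn ger0_norm //.
  by rewrite mulr_ge0 ?invr_ge0 ?exprn_ge0 // mulr_ge0 // ltW.
by exists n.*2; rewrite doubleK.
Qed.

End BinaryCode.

(** * Chebyshev constants and capacity *)

Section Leja.
Context {R : realType}.
Implicit Types (S : set R[i]) (c : R) (q : {poly R[i]}).

(* The Chebyshev constant of [S] is at least [expR c], with norms attained. *)
Definition cheb_ge c S := forall q, q \is monic ->
  exists2 w, S w & expR (c * (size q).-1%:R) <= normc q.[w].

Definition iter_cons (g : seq R[i] -> R[i]) N := iter N (fun s => g s :: s) [::].

Lemma size_iter_cons g N : size (iter_cons g N) = N.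
Proof. by elim: N => //= N ->. Qed.

Lemma big_iter_cons g N (F : R[i] -> R) :
  \sum_(b <- iter_cons g N) F b = \sum_(i < N) F (g (iter_cons g i)).
Proof.
elim: N => [|N IH]; first by rewrite big_nil big_ord0.
by rewrite /= big_cons big_ord_recr /= IH addrC.
Qed.

(** Each point is one where the monic polynomial vanishing at the previous points reaches the bound
    of [cheb_ge]. The value is positive, so the points are distinct, and the exponents add up to [c]
    times the number of ordered pairs. *)
Lemma exists_leja c S : cheb_ge c S -> exists z : nat -> R[i],
  [/\ forall i, S (z i), injective z &
    forall N, c * (N%:R * (N%:R - 1)) <=
      \sum_(i < N) \sum_(j < N) ln (normc (z i - z j))].
Proof.
move=> hS.
have /choice [g hg] : forall s : seq R[i], exists w, S w /\
    expR (c * (size s)%:R) <= \prod_(a <- s) normc (w - a).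
  move=> s; have [|w Sw hw] := hS (\prod_(a <- s) ('X - a%:P)).
    by apply: monic_prod => a _; exact: monicXsubC.
  exists w; split=> //; move: hw; rewrite size_prod_XsubC /= horner_prod normc_prod.
  by under eq_bigr do rewrite !hornerE.
pose z N := g (iter_cons g N).
have gs s a : a \in s -> g s != a.
  move=> sa; apply/negP => /eqP e; have [_] := hg s.
  by rewrite (big_rem a) //= e subrr normc0 mul0r leNgt expR_gt0.
have zi i j : (i < j)%N -> z j != z i.
  move=> ij; apply: gs; elim: j ij => // j IH; rewrite ltnS leq_eqVlt /= inE.
  by case/predU1P => [->|/IH ->]; rewrite ?eqxx ?orbT.
exists z; split=> [i|i j e|N].
- by case: (hg (iter_cons g i)).
- by case: (ltngtP i j) => // /zi; rewrite e eqxx.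
have -> : \sum_(i < N) \sum_(j < N) ln (normc (z i - z j)) = lnpairs (iter_cons g N).
  rewrite /lnpairs big_iter_cons; apply: eq_bigr => i _.
  by rewrite big_iter_cons.
elim: N => [|N IH]; first by rewrite /lnpairs big_nil mul0r mulr0.
rewrite /= lnpairs_cons -natr1.
have [_ hgN] := hg (iter_cons g N).
have : c * N%:R <= \sum_(b <- iter_cons g N) ln (normc (g (iter_cons g N) - b)).
  have pos b : b \in iter_cons g N -> 0 < normc (g (iter_cons g N) - b).
    by move=> h; rewrite normc_gt0 subr_eq0 gs.
  rewrite -(ln_prod pos) -[leLHS]expRK; rewrite size_iter_cons in hgN.
  by rewrite ler_ln ?posrE ?expR_gt0 // big_seq prodr_gt0.
by move: IH; lra.
Qed.

(** Cutting the logarithmic series after [k] terms gives a continuous kernel with the finite value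
    [Hk] on the diagonal. Among the [n ^ 2] pairs of Leja points the diagonal then weighs [Hk / n],
    which vanishes in the limit; [k] is arbitrary. *)
Lemma exists_energy_ge c S : compact S -> cheb_ge c S ->
  exists2 nu : probability (borelC R) R, supported_on S nu &
    (c%:E <= log_energy nu)%E.
Proof.
move=> cS hS; have [z [zS zinj zl]] := exists_leja hS.
have [bit [dd [ddP dd0]]] := exists_bits cS zS.
have [U [UU subU]] := ultraFilterLemma eventually_filter.
have PU : ProperFilter U by exact: ultra_proper.
have [nu [nS nuI]] := exists_weak_limit UU cS zS ddP dd0.
have [r r1 hr] := compact_bounded_cplx cS.
pose H : R := ln (1 + r ^+ 2).
have SH w : S w -> hlog w <= H.
  move=> Sw; rewrite ler_ln ?posrE ?sden_gt0 ?ltr_pwDl ?sqr_ge0 //.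
  by rewrite lerD2l lerXn2r ?nnegrE ?normc_ge0 ?hr // (le_trans ler01).
have hS' w : S w -> hcut H w = hlog w by move=> Sw; apply/min_idPl; exact: SH.
pose h := \int[nu]_w hcut H w.
have ch : continuous (hcut H : R[i] -> R).
  apply/continuous_cplxP => w e e0.
  have [d d0 hd] := (continuous_cplxP _).1 continuous_hlog w e e0.
  exists d => // x /hd; apply: le_lt_trans; rewrite /hcut.
  rewrite /Num.min; case: ltP => a; case: ltP => b //; rewrite !ler_norml.
  - have := ler_norm (hlog w - hlog x); have := ler_norm (- (hlog w - hlog x)).
    by rewrite normrN => ? ?; apply/andP; split; lra.
  - have := ler_norm (hlog w - hlog x); have := ler_norm (- (hlog w - hlog x)).
    by rewrite normrN => ? ?; apply/andP; split; lra.
  - by rewrite subrr oppr_le0 normr_ge0.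
have cw k (f : {ffun 'I_k -> 'I_6}) : continuous (wordf f : R[i] -> R).
  rewrite /wordf => w; elim: (index_enum _) => [|j s IH].
    under eq_fun do rewrite big_nil; exact: cst_continuous.
  under eq_fun do rewrite big_cons.
  by apply: (@continuousM _ _ (fun z => sphere z (f j))) IH; exact: continuous_sphere.
have mlim k (f : {ffun 'I_k -> 'I_6}) : avg z (wordf f) @ U --> moment nu f.
  by apply: nuI; [exact: cw|exact: bmf_wordf].
have hlim : avg z (hcut H) @ U --> h by apply: nuI => //; exact: bmf_hcut.
have partial k : \sum_(j < k) msq nu j.+1 / j.+1%:R <= 2 * h - 2 * c.
  pose Hk : R := \sum_(j < k) j.+1%:R^-1.
  pose lhs N := \sum_(j < k)
    (\sum_(f : {ffun 'I_j.+1 -> 'I_6}) avg z (wordf f) N ^+ 2) / j.+1%:R.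
  pose rhs N := Hk * N.+1%:R^-1 + 2 * avg z (hcut H) N - 2 * c * (1 - N.+1%:R^-1).
  have clhs : lhs @ U --> \sum_(j < k) msq nu j.+1 / j.+1%:R.
    apply: cvg_fsum => j; apply: cvgMr_tmp; apply: cvg_fsum => f.
    exact: (cvgM (mlim _ f) (mlim _ f)).
  have cinv : N.+1%:R^-1 @[N --> U] --> (0 : R).
    by apply: (cvg_trans _ (@cvg_harmonic R)); apply: cvg_app.
  have crhs : rhs @ U --> Hk * 0 + 2 * h - 2 * c * (1 - 0).
    apply: cvgB; last by apply: cvgMl_tmp; apply: cvgB => //; exact: cvg_cst.
    by apply: cvgD; apply: cvgMl_tmp.
  rewrite mulr0 add0r subr0 mulr1 in crhs.
  apply: (ler_cvg_to clhs crhs); apply: nearW => N.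
  set n : nat := N.+1.
  have n0 : (0 : R) < n%:R by rewrite ltr0n.
  pose Lk (a b : R[i]) : R := \sum_(j < k) skern a b ^+ j.+1 / j.+1%:R.
  have lhsE : lhs N = (\sum_(i < n) \sum_(j < n) Lk (z i) (z j)) / n%:R ^+ 2.
    have hj (m : nat) : \sum_(f : {ffun 'I_m -> 'I_6}) avg z (wordf f) N ^+ 2 =
        (\sum_(i < n) \sum_(j < n) skern (z i) (z j) ^+ m) / n%:R ^+ 2.
      under [in RHS]eq_bigr do under eq_bigr do rewrite skernX.
      under [in RHS]eq_bigr do rewrite exchange_big /=.
      rewrite [in RHS]exchange_big /= mulr_suml; apply: eq_bigr => f _.
      under [in RHS]eq_bigr do rewrite -mulr_sumr.
      by rewrite -mulr_suml /avg -/n expr_div_n expr2.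
    rewrite /lhs; under eq_bigr do rewrite hj.
    rewrite /Lk; under [in RHS]eq_bigr do rewrite exchange_big /=.
    rewrite [in RHS]exchange_big /= mulr_suml; apply: eq_bigr => j _.
    under [in RHS]eq_bigr do rewrite -mulr_suml.
    by rewrite -mulr_suml mulrAC.
  (* For [i = j] the logarithm is [ln 0 = 0] and the bound is [Hk] plus nonnegative terms; otherwise
     a partial sum is below the full series. *)
  have Lkb (i j : 'I_n) : Lk (z i) (z j) <=
      Hk * (i == j)%:R + hlog (z i) + hlog (z j) - 2 * ln (normc (z i - z j)).
    have [<-|ij] := eqVneq i j.
      rewrite subrr normc0 ln0 // mulr0 subr0 mulr1.
      have -> : Lk (z i) (z i) = Hk.
        apply: eq_bigr => l _; rewrite (_ : skern _ _ = 1) ?expr1n ?mul1r //.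
        apply/eqP; rewrite eq_sym -subr_eq0 skernE subrr normc0.
        by rewrite expr0n mul0r.
      by rewrite -addrA lerDl addr_ge0 ?hlog_ge0.
    have zij : z i != z j by apply: contra_neq ij => /zinj ij; exact: val_inj.
    rewrite mulr0 add0r -lee_fin -lkern_neq // /Lk -sumEFin.
    rewrite -(big_mkord xpredT (fun l => (skern (z i) (z j) ^+ l.+1 / l.+1%:R)%:E)).
    by apply: nneseries_lim_ge => l _ _; exact: lkern_term_ge0.
  have sumb : \sum_(i < n) \sum_(j < n) Lk (z i) (z j) <=
      Hk * n%:R + 2 * (n%:R * \sum_(i < n) hlog (z i)) - 2 * (c * (n%:R * (n%:R - 1))).
    apply: le_trans (ler_sum _ (fun i _ => ler_sum _ (fun j _ => Lkb i j))) _.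
    pose sg := \sum_(i < n) hlog (z i).
    pose l (i : 'I_n) := \sum_(j < n) ln (normc (z i - z j)).
    rewrite (eq_bigr (fun i : 'I_n => Hk + n%:R * hlog (z i) + sg - 2 * l i)); last first.
      move=> i _; rewrite sumrB 2!big_split /= -!mulr_sumr -/(l i) -/sg.
      rewrite sumr_const card_ord; congr (_ + _ + _ - _); last by rewrite mulr_natl.
      rewrite (bigD1 i) //= eqxx big1 ?addr0 ?mulr1 // => j ji.
      by rewrite eq_sym (negbTE ji).
    rewrite sumrB 2!big_split /= -!mulr_sumr -/sg !sumr_const card_ord.
    rewrite -(mulr_natr Hk) -(mulr_natl sg).
    by have := zl n; rewrite -/l; move: (\sum_(i < n) l i) => ll; lra.
  rewrite lhsE ler_pdivrMr ?exprn_gt0 //; apply: le_trans sumb _.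
  rewrite /rhs /avg -/n.
  have -> : \sum_(i < n) hcut H (z i) = \sum_(i < n) hlog (z i).
    by apply: eq_bigr => i _; rewrite hS'.
  rewrite le_eqVlt; apply/orP; left; apply/eqP.
  by field; rewrite gt_eqF.
have hE := benergy_le partial.
have Ef : benergy nu \is a fin_num.
  by rewrite ge0_fin_numE ?benergy_ge0 // (le_lt_trans hE) // ltry.
exists nu => //; have mS := measurable_closed (compact_closed hausdorff_cplx cS).
rewrite (log_energyE mS nS SH) -/h; move: hE.
by rewrite -(fineK Ef) lee_fin -EFinM -EFinB lee_fin; lra.
Qed.

End Leja.

(** * Filled Julia sets *)

Section Julia.
Context {R : realType}.
Implicit Types (S K : set R[i]) (c : R) (p q : {poly R[i]}).

Lemma prod_const_seq (T : Type) (s : seq T) (x : R) :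
  \prod_(a <- s) x = x ^+ size s.
Proof. by elim: s => [|a s IH]; rewrite ?big_nil // big_cons IH -exprS. Qed.

Lemma poly_split p : exists s : seq R[i],
  p = lead_coef p *: \prod_(a <- s) ('X - a%:P).
Proof. by have [s ps] := closed_field_poly_normal p; exists s. Qed.

Lemma monic_split p : p \is monic -> exists2 s : seq R[i],
  p = \prod_(a <- s) ('X - a%:P) & size s = (size p).-1.
Proof.
move=> /monicP mp; have [s] := poly_split p; rewrite mp scale1r => ps.
by exists s => //; rewrite ps size_prod_XsubC.
Qed.

Lemma normc_horner_prod (s : seq R[i]) z :
  normc (\prod_(a <- s) ('X - a%:P)).[z] = \prod_(a <- s) normc (z - a).
Proof.
by rewrite horner_prod normc_prod; apply: eq_bigr => a _; rewrite !hornerE.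
Qed.

(* For b in S, the product of the p(a) - b over the roots a of q is, up to sign
   and a power of the leading coefficient of p, the product of the values of q
   on the fibre of p over b. *)
Lemma cheb_ge_preimage c S p : (1 < size p)%N ->
  normc (lead_coef p) = expR (- (c * (size p).-2%:R)) ->
  cheb_ge c S -> cheb_ge c [set w | S p.[w]].
Proof.
move=> sp lp hS q mq; set m := (size q).-1.
have [t qt st] := monic_split mq.
have [|b Sb hb] := hS (\prod_(a <- t) ('X - p.[a]%:P)).
  by apply: monic_prod => a _; exact: monicXsubC.
have sh : size (\prod_(a <- t) ('X - (p.[a])%:P)) = m.+1.
  by rewrite -(big_map (fun a => p.[a]) xpredT (fun x => 'X - x%:P)) size_prod_XsubC size_map st.
rewrite sh /= in hb.
have hbE : normc (\prod_(a <- t) ('X - (p.[a])%:P)).[b] = \prod_(a <- t) normc (p.[a] - b).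
  rewrite horner_prod normc_prod; apply: eq_bigr => a _.
  by rewrite !hornerE normcBC.
have sp1 : size (p - b%:P) = size p.
  by rewrite size_polyDl // size_polyN (leq_ltn_trans (size_polyC_leq1 b)).
have lp1 : lead_coef (p - b%:P) = lead_coef p.
  by rewrite lead_coefDl // size_polyN (leq_ltn_trans (size_polyC_leq1 b)).
have [s ps] := poly_split (p - b%:P).
have lp0 : lead_coef p != 0 by rewrite -normc_gt0 lp expR_gt0.
have ss : size s = (size p).-1.
  by rewrite -sp1 ps lp1 size_scale // size_prod_XsubC.
have pa a : normc (p.[a] - b) = normc (lead_coef p) * \prod_(w <- s) normc (a - w).
  have -> : p.[a] - b = (p - b%:P).[a] by rewrite !hornerE.
  by rewrite ps lp1 hornerZ normcM normc_horner_prod.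
have prod_eq : \prod_(w <- s) normc q.[w] * expR (- (c * (size p).-2%:R)) ^+ m =
    \prod_(a <- t) normc (p.[a] - b).
  under [RHS]eq_bigr do rewrite pa.
  rewrite big_split /= lp prod_const_seq st -/m mulrC; congr (_ * _).
  rewrite exchange_big /=; apply: eq_bigr => w _; rewrite qt normc_horner_prod.
  by apply: eq_bigr => a _; rewrite normcBC.
rewrite hbE -prod_eq in hb.
(* The size of the leading coefficient is the one that preserves [c]. With d = deg p, if |q| < exp(c
   m) on the whole fibre, the product is below exp(c m d) exp(- c (d - 1) m) = exp(c m), against
   [hb]. *)
apply: contrapT => nex.
have lt w : w \in s -> normc q.[w] < expR (c * m%:R).
  move=> ws; rewrite ltNge; apply/negP => ge; apply: nex; exists w => //=.
  suff -> : p.[w] = b by [].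
  apply/eqP; rewrite -subr_eq0; apply/eqP.
  have -> : p.[w] - b = (p - b%:P).[w] by rewrite !hornerE.
  rewrite ps hornerZ horner_prod (big_rem w) //=.
  by rewrite hornerXsubC subrr mul0r mulr0.
have : \prod_(w <- s) normc q.[w] < \prod_(w <- s) expR (c * m%:R).
  have : s != [::] by rewrite -size_eq0 ss; case: (size p) sp => [|[]].
  elim: s lt {ps ss pa prod_eq hb nex} => // w s IH lt _.
  rewrite !big_cons; have [->|s0] := eqVneq s [::].
    by rewrite !big_nil !mulr1 lt // mem_head.
  rewrite ltr_pM ?normc_ge0 ?lt ?mem_head //.
    by rewrite prodr_ge0 // => i _; exact: normc_ge0.
  by apply: IH => // x xs; apply: lt; rewrite inE xs orbT.
rewrite prod_const_seq ss => {}lt.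
have e0 : 0 < expR (- (c * (size p).-2%:R)) ^+ m by rewrite exprn_gt0 // expR_gt0.
have := le_lt_trans hb; rewrite -(ltr_pM2r e0) in lt; move=> /(_ _ lt).
rewrite -!expRM_natl -expRD ltr_expR.
have -> : (size p).-1 = (size p).-2.+1 by case: (size p) sp => [|[]].
by rewrite -natr1 => h; suff : False by []; move: h; lra.
Qed.

Variables (p : {poly R[i]}) (rho : R).
Hypotheses (rho0 : 0 < rho)
  (growth : forall z, rho < normc z -> 2 * normc z <= normc p.[z]).

Lemma escape z k : rho < normc z -> 2 ^+ k * normc z <= normc (iter k (horner p) z).
Proof.
move=> h; have z0 : 0 < normc z by exact: lt_trans h.
elim: k => [|k IH] /=; first by rewrite expr0 mul1r.
have rk : rho < normc (iter k (horner p) z).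
  by apply: lt_le_trans h (le_trans _ IH); rewrite ler_peMl ?(ltW z0) // exprn_ege1 // ler1n.
by apply: le_trans (growth rk); rewrite exprS -mulrA ler_pM2l.
Qed.

(** An orbit that leaves the disc of radius [rho] at least doubles in modulus at each later step,
    hence tends to infinity. *)
Lemma filled_julia_bounded z k : filled_julia p z -> normc (iter k (horner p) z) <= rho.
Proof.
move=> Kz; rewrite leNgt; apply/negP => h; apply: Kz => /=.
apply/cvgryPge => A.
have [n hn] : exists n : nat, A <= 2 ^+ n * rho.
  exists (Num.truncn (A / rho)).+1; rewrite -ler_pdivrMr //.
  apply: le_trans (ltW (truncnS_gt _)) _; rewrite -natrX ler_nat.
  exact/ltnW/ltn_expl.
exists (n + k)%N => // m /= nm.
rewrite -(subnK (leq_trans (leq_addl _ _) nm)) iterD.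
apply: le_trans hn _; apply: le_trans (escape _ h).
apply: ler_pM; rewrite ?(ltW rho0) ?(ltW h) ?exprn_ge0 //.
by rewrite ler_weXn2l ?ler1n // leq_subRL ?(leq_trans (leq_addl _ _) nm) // addnC.
Qed.

Lemma filled_julia_of_bounded (r : R) z :
  (forall k, normc (iter k (horner p) z) <= r) -> filled_julia p z.
Proof.
move=> h /= /cvgryPgt/(_ r) [n _ hn].
by have := hn n (leqnn n); rewrite /= ltNge h.
Qed.

Fixpoint iter_poly k : {poly R[i]} :=
  if k is k'.+1 then p \Po iter_poly k' else 'X.

Lemma iter_polyE k z : (iter_poly k).[z] = iter k (horner p) z.
Proof. by elim: k => [|k IH] /=; rewrite ?hornerX // horner_comp IH. Qed.

Lemma continuous_iter k : continuous (fun z : R[i] => normc (iter k (horner p) z)).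
Proof.
rewrite (_ : (fun z => _) = (fun z => normc (iter_poly k).[z])).
  exact: continuous_normc_poly.
by apply/funext => z; rewrite iter_polyE.
Qed.

Lemma filled_juliaE :
  filled_julia p = \bigcap_k [set z | normc (iter k (horner p) z) <= rho].
Proof.
apply/seteqP; split=> z; first by move=> Kz k _; exact: filled_julia_bounded.
by move=> h; apply: (@filled_julia_of_bounded rho) => k; exact: h.
Qed.

Lemma compact_filled_julia : compact (filled_julia p).
Proof.
apply: (@compact_closed_bounded R _ rho).
  rewrite filled_juliaE; apply: closed_bigI => k _.
  exact: closed_sublevel (@continuous_iter k).
by move=> z /(filled_julia_bounded 0).
Qed.

(** The iterated preimages [E k] of a disc are closed and, as [rho <= r], nested. Each inherits the
    bound, and a cluster point of the points [w k] where |q| is large lies in all of them, hence in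
    the filled Julia set. *)
Lemma cheb_ge_filled_julia c (r : R) : rho <= r -> (1 < size p)%N ->
  normc (lead_coef p) = expR (- (c * (size p).-2%:R)) ->
  cheb_ge c [set z | normc z <= r] -> cheb_ge c (filled_julia p).
Proof.
move=> rr sp lp h0 q mq.
pose E k := [set z | normc (iter k (horner p) z) <= r].
have hE k : cheb_ge c (E k).
  elim: k => [|k IH]; first exact: h0.
  rewrite (_ : E k.+1 = [set w | E k p.[w]]); last first.
    by apply/seteqP; split=> z; rewrite /E /= -iterS iterSr.
  exact: cheb_ge_preimage.
have subE k l : (k <= l)%N -> E l `<=` E k.
  move=> kl z; rewrite /E /= => hl; rewrite leNgt; apply/negP => hk.
  move: hl; rewrite -(subnK kl) iterD leNgt => /negP; apply.
  apply: lt_le_trans hk (le_trans _ (escape (l - k) (le_lt_trans rr hk))).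
  by rewrite ler_peMl ?normc_ge0 // exprn_ege1 // ler1n.
have cE k : closed (E k) by exact: closed_sublevel (@continuous_iter k).
have /choice [w hw] : forall k, exists x, E k x /\ expR (c * (size q).-1%:R) <= normc q.[x].
  by move=> k; have [x ? ?] := hE k q mq; exists x.
have cE0 : compact (E 0%N).
  by apply: (@compact_closed_bounded R _ r) => //; exact: cE.
have wF : (w @ \oo) (E 0%N).
  by exists 0%N => // k _; apply: (subE 0%N k) => //; case: (hw k).
have [x [_ clx]] := cE0 _ (fmap_proper_filter w eventually_filter) wF.
have xin F : closed F -> (w @ \oo) F -> F x.
  by move=> clF wF'; apply: clF; move: clx; rewrite clusterE; apply.
exists x.
  apply: (@filled_julia_of_bounded r) => k; apply: (xin _ (cE k)).
  by exists k => // l /= kl; apply: (subE k l) => //; case: (hw l).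
apply: (xin [set y | expR (c * (size q).-1%:R) <= normc q.[y]]).
  exact: closed_superlevel (@continuous_normc_poly R q).
by exists 0%N => // l _; case: (hw l).
Qed.

End Julia.

(** * Chebyshev polynomials of K and their dual polynomials *)

Section Chebyshev.
Context {R : realType}.
Implicit Types (S K : set R[i]) (p q : {poly R[i]}) (nu : probability (borelC R) R).

Lemma log_energy_lty nu S (B : R) : measurable (S : set (borelC R)) ->
  supported_on S nu -> (forall z, S z -> normc z <= B) -> (log_energy nu < +oo)%E.
Proof.
move=> mS nS SB; have SH z : S z -> hlog z <= ln (1 + B ^+ 2).
  move=> Sz; rewrite ler_ln ?posrE ?sden_gt0 ?ltr_pwDl ?sqr_ge0 //.
  by rewrite lerD2l lerXn2r ?nnegrE ?normc_ge0 ?SB // (le_trans (normc_ge0 z)) ?SB.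
rewrite (log_energyE mS nS SH); apply: le_lt_trans (ltry (\int[nu]_z hcut (ln (1 + B ^+ 2)) z)).
rewrite -[leRHS]adde0 leeD2l // oppe_le0 mule_ge0 ?benergy_ge0 //.
Qed.

Variables (K : set R[i]) (omegaK : probability (borelC R) R).
Hypotheses (cK : compact K) (npK : non_polar K)
  (eqK : is_equilibrium_measure K omegaK).

Let mK : measurable (K : set (borelC R)).
Proof. exact: measurable_closed (compact_closed hausdorff_cplx cK). Qed.

Lemma energy_fin : log_energy omegaK \is a fin_num.
Proof.
have [oK maxK] := eqK; have [nu nK nuE] := npK.
have [r _ hr] := compact_bounded_cplx cK.
rewrite fin_numE -ltNye -ltey (lt_le_trans nuE) ?maxK //=.
exact: log_energy_lty mK oK hr.
Qed.

(** The logarithm of the capacity of [K]. *)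
Definition gam : R := fine (log_energy omegaK).

Lemma gamE : log_energy omegaK = gam%:E.
Proof. by rewrite /gam fineK // energy_fin. Qed.

Lemma K_nonempty : K !=set0.
Proof.
apply/set0P/negP => /eqP K0; have [] := eqK; rewrite /supported_on K0 setC0.
by rewrite probability_setT => /eqP; rewrite onee_eq0.
Qed.

Lemma le_sup_norm p z : K z -> normc p.[z] <= sup_norm K p.
Proof.
have [r _ hr] := compact_bounded_cplx cK.
have [M _ hM] := poly_bounded p r.
move=> Kz; apply: sup_upper_bound; last by exists z.
split; first by exists (normc p.[z]), z.
by exists M => _ [w Kw <-]; apply: hM; exact: hr.
Qed.

Lemma sup_norm_le p (M : R) : (forall z, K z -> normc p.[z] <= M) ->
  sup_norm K p <= M.
Proof.
have [z Kz] := K_nonempty; move=> h; apply: ge_sup; first by exists (normc p.[z]), z.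
by move=> _ [w Kw <-]; exact: h.
Qed.

Lemma sup_norm_attained p : exists2 w, K w & normc p.[w] = sup_norm K p.
Proof.
have [|||w Kw hw] := @compact_EVT_max _ _ (fun z : R[i] => normc p.[z]) K.
- exact: K_nonempty.
- exact: cK.
- exact: continuous_subspaceT (@continuous_normc_poly R p).
rewrite inE in Kw; exists w => //.
apply/eqP; rewrite eq_le le_sup_norm ?sup_norm_le // => z Kz.
by apply: hw; rewrite inE.
Qed.

(** [K] lies in the lemniscate of [q] at the level of its supremum norm, where [lemniscate_energy]
    bounds the energy of [omegaK]. *)
Lemma cheb_ge_K : cheb_ge gam K.
Proof.
move=> q mq; have [w Kw qw] := sup_norm_attained q; exists w => //.
have [oK _] := eqK; have [r _ hr] := compact_bounded_cplx cK.
have [sq|sq] := leqP (size q) 1.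
  have -> : q = 1.
    rewrite (size1_polyC sq); congr (_%:P); move/monicP: mq.
    by rewrite {1}(size1_polyC sq) lead_coefC.
  by rewrite hornerE size_poly1 mulr0 expR0 normc1.
rewrite qw leNgt; apply/negP => lt.
have d0 : (0 : R) < (size q).-1%:R by rewrite ltr0n -ltnS prednK // ltnW.
set s := sup_norm K q in lt qw.
have s0 : 0 <= s by rewrite -qw normc_ge0.
(* An intermediate level, because [lemniscate_energy] asks for a positive one and [s] could still be
   0. *)
pose t := (s + expR (gam * (size q).-1%:R)) / 2.
have t0 : 0 < t by rewrite /t; have := expR_gt0 (gam * (size q).-1%:R); lra.
have st : s <= t by rewrite /t; lra.
have := lemniscate_energy mK oK hr mq sq t0 (fun z Kz => le_trans (le_sup_norm q Kz) st).
rewrite gamE lee_fin ler_pdivlMr // leNgt => /negP; apply.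
rewrite -ltr_expR lnK ?posrE //; rewrite /t; lra.
Qed.

Variable T : nat -> {poly R[i]}.
Hypothesis chebT : forall n, (1 <= n)%N -> is_chebyshev_poly K n (T n).

Definition lnT n : R := ln (sup_norm K (T n)).

Lemma sup_norm_T_ge n : (1 <= n)%N -> expR (gam * n%:R) <= sup_norm K (T n).
Proof.
move=> n1; have [mT sT _] := chebT n1; have [w Kw hw] := cheb_ge_K mT.
by rewrite sT in hw; apply: le_trans hw (le_sup_norm _ Kw).
Qed.

Lemma sup_norm_T_gt0 n : (1 <= n)%N -> 0 < sup_norm K (T n).
Proof. by move=> n1; apply: lt_le_trans (sup_norm_T_ge n1); exact: expR_gt0. Qed.

Lemma lnT_ge n : (1 <= n)%N -> gam * n%:R <= lnT n.
Proof.
move=> n1; rewrite -ler_expR lnK ?posrE ?sup_norm_T_gt0 //; exact: sup_norm_T_ge.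
Qed.

(** If [lnT m] were at least [m%:R * (gam + e)] for every [m], then [exists_energy_ge] would give a
    measure on [K] of energy above the maximum [gam]. For one [m] that fails this, powers of [T m]
    bound all the [lnT n]. *)
Lemma lnT_le (e : R) : 0 < e ->
  exists C D : R, C < gam + e /\ forall n, (1 <= n)%N -> lnT n <= n%:R * C + D.
Proof.
move=> e0; have [m m1 hm] : exists2 m, (1 <= m)%N & lnT m < m%:R * (gam + e).
  apply: contrapT => nex.
  have h m : (1 <= m)%N -> m%:R * (gam + e) <= lnT m.
    by move=> m1; rewrite leNgt; apply/negP => ?; apply: nex; exists m.
  have hc : cheb_ge (gam + e) K.
    move=> q mq; have [w Kw qw] := sup_norm_attained q; exists w => //.
    have [sq|sq] := leqP (size q) 1.
      have [w' Kw' hw'] := cheb_ge_K mq.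
      have s0 : (size q).-1 = 0%N by case: (size q) sq => [|[]].
      by rewrite qw s0 mulr0 -(mulr0 gam); rewrite s0 in hw'; apply: le_trans hw' (le_sup_norm _ Kw').
    have m1 : (1 <= (size q).-1)%N by rewrite -ltnS prednK // ltnW.
    have [_ _ minT] := chebT m1.
    have := h _ m1; rewrite mulrC -ler_expR lnK ?posrE ?sup_norm_T_gt0 // qw => h'.
    by apply: le_trans h' (minT _ mq _); rewrite prednK // ltnW.
  have [nu nK hnu] := exists_energy_ge cK hc.
  have [_ maxK] := eqK; have := le_trans hnu (maxK _ nK).
  by rewrite gamE lee_fin; lra.
have [mT sT _] := chebT m1; have [r _ hr] := compact_bounded_cplx cK.
have sT1 : (1 < size (T m))%N by rewrite sT.
have [rq [D [D0 rq0 lnrq hq]]] := exists_power_polys hr mT sT1 (sup_norm_T_gt0 m1)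
   (fun z => @le_sup_norm (T m) z).
exists (lnT m / m%:R), D; split.
  by rewrite ltr_pdivrMr ?ltr0n // mulrC.
move=> n n1; have [_ _ minT] := chebT n1; have [q [mq sq qr]] := hq n.
have := lnrq n; rewrite sT /=; apply: le_trans.
rewrite ler_ln ?posrE ?sup_norm_T_gt0 //.
by apply: le_trans (minT q mq sq) (sup_norm_le qr).
Qed.

Variable r : R.
Hypotheses (r1 : 1 <= r) (hr : forall z, K z -> normc z <= r).

(** Replacing a root [a] of modulus above [2 * r] by 0 multiplies |T_n| on [K] by at most r / (|a| -
    r) < 1, against minimality. *)
Lemma roots_T n (s : seq R[i]) : (1 <= n)%N -> T n = \prod_(a <- s) ('X - a%:P) ->
  forall a, a \in s -> normc a <= 2 * r.
Proof.
move=> n1 Ts a sa; rewrite leNgt; apply/negP => ra.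
have [mT sT minT] := chebT n1; have N0 := sup_norm_T_gt0 n1.
pose q : {poly R[i]} := \prod_(b <- rem a s) ('X - b%:P).
have TE : T n = ('X - a%:P) * q by rewrite Ts (big_rem a).
have mq : q \is monic by apply: monic_prod => b _; exact: monicXsubC.
have mXq : 'X * q \is monic by rewrite monicMl ?monicX.
have sXq : size ('X * q) = n.+1.
  rewrite -sT TE !size_monicM ?monicX ?monicXsubC ?monic_neq0 //.
  by rewrite size_polyX size_XsubC.
have := minT _ mXq sXq; rewrite leNgt => /negP; apply.
pose k := r / (normc a - r).
have d0 : 0 < normc a - r by move: r1; lra.
have k1 : k < 1 by rewrite ltr_pdivrMr // mul1r; move: r1; lra.
apply: (@le_lt_trans _ _ (k * sup_norm K (T n))); last by rewrite gtr_pMl.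
apply: sup_norm_le => z Kz; have zr := hr Kz.
have h : (normc a - r) * normc q.[z] <= sup_norm K (T n).
  apply: le_trans (le_sup_norm _ Kz); rewrite TE hornerM normcM !hornerE.
  rewrite ler_wpM2r ?normc_ge0 // normcBC.
  by have := normc_triBr a z; lra.
rewrite hornerM normcM hornerX; apply: (@le_trans _ _ (r * normc q.[z])).
  by rewrite ler_wpM2r ?normc_ge0.
rewrite /k mulrAC ler_pdivlMr // -mulrA (mulrC (normc q.[z])).
by rewrite ler_wpM2l //; move: r1; lra.
Qed.

(** An escape radius common to all n >= 2: the roots of T_n have modulus at most [2 * r], and the
    margin [4 * r ^+ 2] gives (|z| - 2 r)^n >= 2 |z| r^n beyond it. *)
Definition R0 : R := 2 * r + 4 * r ^+ 2.

Lemma R0_ge1 : 1 <= R0.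
Proof. by rewrite /R0; have := sqr_ge0 r; move: r1; lra. Qed.

Lemma T_ge n z : (1 <= n)%N -> 2 * r <= normc z ->
  (normc z - 2 * r) ^+ n <= normc (T n).[z].
Proof.
move=> n1 rz; have [mT sT _] := chebT n1.
have [s Ts ss] := monic_split mT.
rewrite Ts normc_horner_prod -[n in leLHS]/(n.+1.-1) -sT -ss -prod_const_seq.
rewrite big_seq [leRHS]big_seq; apply: ler_prod => a sa.
have := roots_T n1 Ts sa; have := normc_triBr z a.
by rewrite subr_ge0 rz /=; lra.
Qed.

Lemma sup_norm_T_le n : (1 <= n)%N -> sup_norm K (T n) <= r ^+ n.
Proof.
move=> n1; have [_ _ minT] := chebT n1.
apply: le_trans (minT 'X^n (monicXn _ n) (size_polyXn _ n)) _.
apply: sup_norm_le => z Kz; rewrite hornerXn normcX lerXn2r ?nnegrE ?normc_ge0 ?hr //.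
by move: r1; lra.
Qed.

Lemma dual_hornerE n z : (1 <= n)%N ->
  normc (dual_poly K (T n)).[z] = normc (T n).[z] / sup_norm K (T n).
Proof.
move=> n1; rewrite /dual_poly hornerZ normcM normc_real mulrC.
by rewrite ger0_norm // invr_ge0 ltW // sup_norm_T_gt0.
Qed.

Lemma dual_growth n z : (2 <= n)%N -> R0 < normc z ->
  2 * normc z <= normc (dual_poly K (T n)).[z].
Proof.
move=> n2 zR; have n1 : (1 <= n)%N by exact: ltnW.
have r0 : 0 < r by move: r1; lra.
set t := normc z in zR *; have rr : 0 <= r ^+ 2 by exact: sqr_ge0.
have tr : 2 * r <= t by move: zR; rewrite /R0; lra.
rewrite dual_hornerE // ler_pdivlMr ?sup_norm_T_gt0 //.
apply: le_trans (T_ge n1 tr).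
apply: (@le_trans _ _ (2 * t * r ^+ n)).
  by rewrite ler_wpM2l ?sup_norm_T_le // mulr_ge0 // normc_ge0.
have rt : r <= t - 2 * r by move: zR r1; rewrite /R0; nra.
(* Of the [n] factors, [n - 2] are compared with [r]; the two others absorb [2 * t]. *)
rewrite -(subnK n2) !exprD mulrCA ler_pM ?exprn_ge0 ?mulr_ge0 ?(ltW r0) ?normc_ge0 //.
  by rewrite lerXn2r // nnegrE ?(ltW r0) ?(le_trans (ltW r0) rt).
move: zR; rewrite /R0; set u := t - 2 * r => zR.
have -> : t = 2 * r + u by rewrite /u; lra.
have u4 : 4 * r ^+ 2 <= u by rewrite /u; lra.
have h1 : 4 * r ^+ 2 * u <= u ^+ 2 by rewrite [leRHS]expr2 ler_wpM2r //; lra.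
have h2 : r ^+ 2 * (4 * r ^+ 2) <= r ^+ 2 * u by rewrite ler_wpM2l.
have h3 : r ^+ 3 <= r ^+ 4 by rewrite ler_weXn2l.
have h4 : 0 <= r ^+ 3 by rewrite exprn_ge0 // ltW.
by move: h1 h2 h3 h4; rewrite !exprS !expr0; lra.
Qed.

Lemma size_dual n : (1 <= n)%N -> size (dual_poly K (T n)) = n.+1.
Proof.
move=> n1; have [_ sT _] := chebT n1; rewrite /dual_poly size_scale ?sT //.
by rewrite -normc_gt0 normc_real normr_gt0 invr_eq0 gt_eqF // sup_norm_T_gt0.
Qed.

Lemma lead_coef_dual n : (1 <= n)%N ->
  normc (lead_coef (dual_poly K (T n))) = expR (- lnT n).
Proof.
move=> n1; have [mT _ _] := chebT n1.
rewrite /dual_poly lead_coefZ (monicP mT) mulr1 normc_real expRN lnK ?posrE ?sup_norm_T_gt0 //.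
by rewrite ger0_norm // invr_ge0 ltW // sup_norm_T_gt0.
Qed.

(** The disc contains the dilation of [K] by [expR (c - gam)], which shifts the level [gam] of
    [cheb_ge_K] to [c]. The maximum with [R0] keeps it large enough for escape. *)
Lemma cheb_ge_disc c : exists2 rho, R0 <= rho & cheb_ge c [set z | normc z <= rho].
Proof.
pose s := expR (c - gam); have s0 : 0 < s by exact: expR_gt0.
have sC0 : s%:C != 0 by rewrite -normc_gt0 normc_real normr_gt0 gt_eqF.
exists (Num.max R0 (s * r)); first by rewrite le_max lexx.
move=> q mq; have [t qt st] := monic_split mq.
pose h : {poly R[i]} := \prod_(a <- t) ('X - (a / s%:C)%:P).
have mh : h \is monic by apply: monic_prod => b _; exact: monicXsubC.
have sh : size h = (size t).+1.
  by rewrite /h -(big_map (fun a => a / s%:C) xpredT (fun x => 'X - x%:P)) size_prod_XsubC size_map.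
have [w Kw hw] := cheb_ge_K mh; exists (s%:C * w).
  rewrite /= normcM normc_real gtr0_norm // le_max; apply/orP; right.
  by rewrite ler_pM2l // hr.
have -> : normc q.[s%:C * w] = s ^+ size t * normc h.[w].
  rewrite qt normc_horner_prod /h horner_prod normc_prod -prod_const_seq -big_split.
  apply: eq_bigr => a _; rewrite !hornerE /=.
  have -> : s%:C * w - a = s%:C * (w - a / s%:C).
    by rewrite mulrBr mulrCA divff // mulr1.
  by rewrite normcM normc_real gtr0_norm.
apply: le_trans (ler_wpM2l _ hw); last by rewrite exprn_ge0 // ltW.
by rewrite sh -st /= /s -expRM_natl -expRD ler_expR mulr_natl -mulr_natr; lra.
Qed.

Section Dual.
Variable n : nat.
Hypothesis n2 : (2 <= n)%N.
Let n1 : (1 <= n)%N. Proof. exact: ltnW. Qed.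
Let R00 : 0 < R0. Proof. exact: lt_le_trans R0_ge1. Qed.

Let KnF := filled_julia (dual_poly K (T n)).

Lemma compact_KnF : compact KnF.
Proof. exact: (compact_filled_julia R00 (fun z => @dual_growth n z n2)). Qed.

Lemma KnF_le z : KnF z -> normc z <= R0.
Proof.
exact: (filled_julia_bounded R00 (fun z => @dual_growth n z n2) 0).
Qed.

(** The first iterate of a point of the filled Julia set stays in the disc of radius [R0] as
    well. *)
Lemma KnF_T_le z : KnF z -> normc (T n).[z] <= R0 * sup_norm K (T n).
Proof.
move=> h; have := filled_julia_bounded R00 (fun z => @dual_growth n z n2) 1 h.
by rewrite /= dual_hornerE // ler_pdivrMr // sup_norm_T_gt0.
Qed.

(** The level is forced by the leading coefficient, of modulus [expR (- lnT n)]: it solves c (n - 1)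
    = L_n, as [cheb_ge_preimage] requires. *)
Lemma energy_KnF_ge (nu : probability (borelC R) R) : is_equilibrium_measure KnF nu ->
  ((lnT n / n.-1%:R)%:E <= log_energy nu)%E.
Proof.
move=> [_ maxn]; have [rho Rrho hc] := cheb_ge_disc (lnT n / n.-1%:R).
have m0 : (0 : R) < n.-1%:R by rewrite ltr0n -ltnS prednK.
have [||nu' nK hnu] := @exists_energy_ge R (lnT n / n.-1%:R) KnF.
- exact: compact_KnF.
- apply: (cheb_ge_filled_julia R00 (fun z => @dual_growth n z n2) Rrho _ _ hc).
    by rewrite size_dual // ltnS.
  rewrite size_dual //= lead_coef_dual //; congr (expR (- _)).
  by rewrite divfK // gt_eqF.
by apply: le_trans hnu (maxn _ nK).
Qed.

End Dual.

End Chebyshev.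

(** * Distance of moments in terms of logarithmic energies *)

Section Moments.
Context {R : realType}.
Implicit Types (S : set R[i]) (a b : probability (borelC R) R).

Lemma log_energy_fin a S (B : R) : measurable (S : set (borelC R)) ->
  supported_on S a -> (forall z, S z -> hlog z <= B) ->
  log_energy a \is a fin_num -> (benergy a < +oo)%E /\
  fine (benergy a) = 2 * (\int[a]_z hcut B z - fine (log_energy a)).
Proof.
move=> mS aS SB; rewrite (log_energyE mS aS SB) => fin.
have Ef : (benergy a < +oo)%E.
  rewrite ltey; apply/eqP => e; move: fin; rewrite e gt0_muley ?lte_fin ?divr_gt0 //.
split=> //; have {}Ef : benergy a \is a fin_num by rewrite ge0_fin_numE ?benergy_ge0.
by rewrite -(fineK Ef) -EFinM -EFinB /=; lra.
Qed.

(** The integrals of [hcut] are linear in the measure, so they cancel between the midpoint and the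
    mean of [a] and [b]; only logarithmic energies remain. *)
Lemma moment_dist_energy a b S (B c : R) k (f : {ffun 'I_k.+1 -> 'I_6}) :
  measurable (S : set (borelC R)) -> supported_on S a -> supported_on S b ->
  (forall z, S z -> hlog z <= B) ->
  log_energy a \is a fin_num -> log_energy b \is a fin_num ->
  (log_energy (midm a b) <= c%:E)%E ->
  (moment a f - moment b f) ^+ 2 <=
    8 * k.+1%:R * (c - 2^-1 * (fine (log_energy a) + fine (log_energy b))).
Proof.
move=> mS aS bS SB fa fb.
have [ea Ea] := log_energy_fin mS aS SB fa.
have [eb Eb] := log_energy_fin mS bS SB fb.
have mS' : supported_on S (midm a b) by exact: midm_null.
rewrite (log_energyE mS mS' SB) Rint_midm; last exact: bmf_hcut.
have := benergy_midm_le f ea eb.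
have := benergy_ge0 (midm a b); rewrite Ea Eb.
case: (benergy (midm a b)) => [e| |] // _.
rewrite -EFinM -EFinB !lee_fin => h1 h2.
set D := _ ^+ 2 in h1 *.
have k0 : (0 : R) < 4 * k.+1%:R by rewrite mulr_gt0.
set t := D / (4 * k.+1%:R) in h1.
have -> : D = 4 * k.+1%:R * t by rewrite /t mulrC divfK // gt_eqF.
set X := c - _; have tX : t <= 2 * X by rewrite /X; lra.
by have := ler_wpM2l (ltW k0) tX; move: k0; move: (k.+1%:R : R) => n; lra.
Qed.

End Moments.

(** * Convergence of the moments *)

Section MomentConvergence.
Context {R : realType} (K : set R[i]) (T : nat -> {poly R[i]})
  (omega : nat -> probability (borelC R) R) (omegaK : probability (borelC R) R).
Hypotheses (cK : compact K) (npK : non_polar K)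
  (chebT : forall n, (1 <= n)%N -> is_chebyshev_poly K n (T n))
  (eqT : forall n, (2 <= n)%N ->
    is_equilibrium_measure (filled_julia (dual_poly K (T n))) (omega n))
  (eqK : is_equilibrium_measure K omegaK).

Lemma supported_sub S S' (a : probability (borelC R) R) :
  closed S -> closed S' -> S `<=` S' -> supported_on S a -> supported_on S' a.
Proof.
move=> /measurable_closed mS /measurable_closed mS' SS aS.
have := @subset_measure0 _ _ _ a (~` S') (~` S); apply => //.
- exact: measurableC.
- exact: measurableC.
- exact: subsetC.
Qed.

Variable r : R.
Hypotheses (r1 : 1 <= r) (hr : forall z, K z -> normc z <= r).

Let disc := [set z : R[i] | normc z <= R0 r].

Let closed_disc : closed disc.
Proof. exact: closed_sublevel (@continuous_normc R). Qed.

Let closedK : closed K.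
Proof. exact: compact_closed hausdorff_cplx cK. Qed.

Let r_le_R0 : r <= R0 r.
Proof. by rewrite /R0; have := sqr_ge0 r; move: r1; lra. Qed.

Lemma supported_disc_omega n : (2 <= n)%N -> supported_on disc (omega n).
Proof.
move=> n2; have [on _] := eqT n2.
apply: (supported_sub _ closed_disc) on.
  exact: compact_closed hausdorff_cplx (compact_KnF cK npK eqK chebT r1 hr n2).
by move=> z; exact: (KnF_le cK npK eqK chebT r1 hr n2).
Qed.

Lemma supported_disc_omegaK : supported_on disc omegaK.
Proof.
have [oK _] := eqK; apply: (supported_sub closedK closed_disc) oK => z Kz.
exact: le_trans (hr Kz) r_le_R0.
Qed.

Lemma moment_dist_le n k (f : {ffun 'I_k.+1 -> 'I_6}) : (2 <= n)%N ->
  (moment (omega n) f - moment omegaK f) ^+ 2 <=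
  8 * k.+1%:R * ((lnT K T n + ln (R0 r)) / n%:R -
    2^-1 * (lnT K T n / n.-1%:R + gam omegaK)).
Proof.
move=> n2; have n1 : (1 <= n)%N by exact: ltnW.
have [mT sT _] := chebT n1.
have N0 := sup_norm_T_gt0 cK npK eqK chebT n1.
have R01 := R0_ge1 r1; have R00 : 0 < R0 r by exact: lt_le_trans R01.
(* The lemniscate carries both measures because [R0 r] is at least 1; the disc bounds [hlog]. *)
pose S := disc `&` [set z | normc (T n).[z] <= R0 r * sup_norm K (T n)].
have cS : closed S.
  apply: closedI => //; exact: closed_sublevel (@continuous_normc_poly R (T n)).
have [on maxn] := eqT n2; have [oK _] := eqK.
have cKn := compact_closed hausdorff_cplx (compact_KnF cK npK eqK chebT r1 hr n2).
have onS : supported_on S (omega n).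
  apply: supported_sub on => // z Knz; split.
    exact: (KnF_le cK npK eqK chebT r1 hr n2).
  exact: (KnF_T_le cK npK eqK chebT r1 hr n2).
have oKS : supported_on S omegaK.
  apply: supported_sub oK => // z Kz; split; first exact: le_trans (hr Kz) r_le_R0.
  apply: le_trans (le_sup_norm cK _ Kz) _.
  by rewrite ler_peMl // ltW.
have mS := measurable_closed cS.
have SH z : S z -> hlog z <= ln (1 + R0 r ^+ 2).
  move=> [zR _]; rewrite ler_ln ?posrE ?sden_gt0 ?ltr_pwDl ?sqr_ge0 //.
  by rewrite lerD2l lerXn2r ?nnegrE ?normc_ge0 // ltW.
have eK := gamE cK npK eqK.
have fK : log_energy omegaK \is a fin_num by rewrite eK.
have In := energy_KnF_ge cK npK eqK chebT r1 hr n2 (eqT n2).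
have fn : log_energy (omega n) \is a fin_num.
  rewrite fin_numE -ltNye -ltey (lt_le_trans (ltNyr _) In) /=.
  by apply: (log_energy_lty mS onS (B := R0 r)) => z [].
have Imid : (log_energy (midm (omega n) omegaK) <=
    ((lnT K T n + ln (R0 r)) / n%:R)%:E)%E.
  have msS : supported_on S (midm (omega n) omegaK) by exact: midm_null.
  have := @lemniscate_energy R _ S (T n) (R0 r * sup_norm K (T n)) (R0 r) mS msS.
  rewrite sT /= lnM ?posrE // addrC; apply => //; first by move=> z [].
  - by rewrite mulr_gt0.
  - by move=> z [].
apply: le_trans (moment_dist_energy f mS onS oKS SH fn fK Imid) _.
rewrite ler_wpM2l ?mulr_ge0 // lerB // ler_wpM2l ?invr_ge0 // lerD //.
by rewrite -lee_fin fineK.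
Qed.

Lemma moment_bound_small (e : R) : 0 < e -> \forall n \near \oo,
  (lnT K T n + ln (R0 r)) / n%:R - 2^-1 * (lnT K T n / n.-1%:R + gam omegaK) < e.
Proof.
move=> e0; set g := gam omegaK.
have [C [D [Cg hCD]]] := lnT_le cK npK eqK chebT e0.
(* With lam = L_n / n, the left side is (lam - g) / 2 + ln R0 / n - lam / (2 (n - 1)). Since g <=
   lam <= C + |D| / (n - 1) and C < g + e, it is below e / 2 + A / (n - 1). *)
pose A := `|D| / 2 + ln (R0 r) + `|g| / 2.
have A0 : 0 <= A by rewrite !addr_ge0 ?divr_ge0 ?ln_ge0 ?R0_ge1.
have A2 : 0 <= 2 * A / e by rewrite divr_ge0 ?mulr_ge0 // ltW.
exists (Num.bound (2 * A / e)).+2 => // n /= nb.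
have n2 : (2 <= n)%N by exact: leq_trans nb.
have n1 : (1 <= n)%N by exact: ltnW.
have hA : A / n.-1%:R < e / 2.
  have m0 : (0 : R) < n.-1%:R by rewrite ltr0n -ltnS prednK.
  rewrite ltr_pdivrMr //.
  have : 2 * A / e < n.-1%:R.
    apply: lt_le_trans (archi_boundP A2) _; rewrite ler_nat.
    by rewrite -ltnS prednK // ltnW.
  by rewrite ltr_pdivrMr //; lra.
have lg := lnT_ge cK npK eqK chebT n1; have lC := hCD n n1; rewrite -/g in lg.
move: nb n1 n2 hA lg lC; case: n => [//|[//|n]] _ _ _ /=; set l := lnT K T _.
set m := (n.+1%:R : R) => hA lg lC.
have m0 : 0 < m by rewrite /m ltr0n.
have mE : n.+2%:R = m + 1 :> R by rewrite -natr1.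
rewrite mE in lg lC *.
have m10 : 0 < m + 1 by rewrite addr_gt0.
set lam := l / (m + 1).
have lE : l = lam * (m + 1) by rewrite /lam divfK // gt_eqF.
have lamg : g <= lam by rewrite /lam ler_pdivlMr.
have D1 : D / (m + 1) <= `|D| / m.
  apply: (@le_trans _ _ (`|D| / (m + 1))); first by rewrite ler_pM2r ?invr_gt0 ?ler_norm.
  by rewrite ler_wpM2l // lef_pV2 ?posrE // lerDl.
have lamC : lam <= C + `|D| / m.
  apply: le_trans (lerD (lexx C) D1).
  by rewrite /lam ler_pdivrMr // mulrDl divfK ?gt_eqF // mulrC.
have R1 : ln (R0 r) / (m + 1) <= ln (R0 r) / m.
  by rewrite ler_wpM2l ?ln_ge0 ?R0_ge1 // lef_pV2 ?posrE // lerDl.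
have g1 : - (`|g| / m) <= lam / m.
  rewrite -mulNr ler_pM2r ?invr_gt0 //; apply: le_trans lamg.
  by rewrite lerNl -normrN ler_norm.
have -> : l / m = lam + lam / m by rewrite lE; field; rewrite gt_eqF.
rewrite mulrDl -/lam.
have : A / m = `|D| / m / 2 + ln (R0 r) / m + `|g| / m / 2.
  by rewrite /A; field; rewrite gt_eqF.
move: hA Cg lamC R1 g1; rewrite -/g.
move: (A / m) (`|D| / m) (ln (R0 r) / m) (ln (R0 r) / (m + 1)) (`|g| / m) (lam / m) => a1 a2 a3 a4 a5 a6.
by move=> *; lra.
Qed.

Lemma moment_cvg k (f : {ffun 'I_k -> 'I_6}) :
  moment (omega n) f @[n --> \oo] --> moment omegaK f.
Proof.
case: k f => [|k] f.
  have m1 a : moment a f = 1.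
    rewrite /moment; under eq_Rintegral do rewrite /wordf big_ord0.
    exact: Rint_cst.
  rewrite m1; under eq_fun do rewrite m1; exact: cvg_cst.
apply/cvgrPdist_le => e e0.
have c0 : (0 : R) < 8 * k.+1%:R by rewrite mulr_gt0.
have d0 : 0 < e ^+ 2 / (8 * k.+1%:R) by rewrite divr_gt0 // exprn_gt0.
near=> n; have n2 : (2 <= n)%N by near: n; exists 2%N.
rewrite distrC -(ler_pXn2r (n := 2)) ?nnegrE ?(ltW e0) // real_normK ?num_real //.
apply: le_trans (moment_dist_le f n2) _.
rewrite mulrC -ler_pdivlMr //; apply: ltW; near: n.
exact: moment_bound_small.
Unshelve. all: by end_near. Qed.

End MomentConvergence.

(** * Density of polynomials *)

Section Density.
Context {R : realType}.
Implicit Types (f g p q : R[i] -> R) (B e t : R) (z : R[i]).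

(** Generated linearly from words, so that convergence of integrals follows from that of moments by
    induction; stability under products is proved separately. *)
Inductive sphere_poly : (R[i] -> R) -> Prop :=
| sphere_poly_word k (w : {ffun 'I_k -> 'I_6}) : sphere_poly (wordf w)
| sphere_polyD p q : sphere_poly p -> sphere_poly q -> sphere_poly (fun z => p z + q z)
| sphere_polyZ (a : R) p : sphere_poly p -> sphere_poly (fun z => a * p z).

Lemma wordf_cat k l (v : {ffun 'I_k -> 'I_6}) (w : {ffun 'I_l -> 'I_6}) z :
  wordf v z * wordf w z =
  wordf [ffun j : 'I_(k + l) => match fintype.split j with inl i => v i | inr i => w i end] z.
Proof.
rewrite /wordf big_split_ord /=; congr (_ * _); apply: eq_bigr => i _; rewrite ffunE.
  by have /= -> := fintype.unsplitK (inl i : 'I_k + 'I_l).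
by have /= -> := fintype.unsplitK (inr i : 'I_k + 'I_l).
Qed.

Lemma sphere_polyM p q : sphere_poly p -> sphere_poly q ->
  sphere_poly (fun z => p z * q z).
Proof.
elim=> [k v|p1 p2 _ h1 _ h2|a p1 _ h1] qq; last 2 first.
- by under eq_fun do rewrite mulrDl; exact: sphere_polyD (h1 qq) (h2 qq).
- by under eq_fun do rewrite -mulrA; exact: sphere_polyZ (h1 qq).
elim: qq => [l w|q1 q2 _ h1 _ h2|a q1 _ h1].
- by under eq_fun do rewrite wordf_cat; exact: sphere_poly_word.
- by under eq_fun do rewrite mulrDr; exact: sphere_polyD.
- by under eq_fun do rewrite mulrCA; exact: sphere_polyZ.
Qed.

Lemma bmf_sphere_poly p : sphere_poly p -> bmf (p : borelC R -> R).
Proof.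
elim=> [k w|p1 p2 _ h1 _ h2|a p1 _ h1]; [exact: bmf_wordf|exact: bmfD|exact: bmfZ].
Qed.

Lemma sphere_poly_cst (a : R) : sphere_poly (fun=> a).
Proof.
have -> : (fun=> a) = fun z => a * wordf [ffun _ : 'I_0 => ord0] z.
  by apply/funext => z; rewrite /wordf big_ord0 mulr1.
exact/sphere_polyZ/sphere_poly_word.
Qed.

Lemma sphere_poly_sphere (i : 'I_6) : sphere_poly (fun z => sphere z i).
Proof.
have -> : (fun z : R[i] => sphere z i) = wordf [ffun _ : 'I_1 => i].
  by apply/funext => z; rewrite /wordf big_ord_recl big_ord0 mulr1 ffunE.
exact: sphere_poly_word.
Qed.

Definition approximable B f := forall e, 0 < e -> exists2 p, sphere_poly p &
  forall z, normc z <= B -> `|f z - p z| <= e.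

Lemma approximable_poly B p : sphere_poly p -> approximable B p.
Proof. by move=> h e e0; exists p => // z _; rewrite subrr normr0 ltW. Qed.

Lemma approximable_lim B f :
  (forall e, 0 < e -> exists2 g, approximable B g &
     forall z, normc z <= B -> `|f z - g z| <= e) -> approximable B f.
Proof.
move=> h e e0; have e20 : 0 < e / 2 by rewrite divr_gt0.
have [g ag fg] := h _ e20; have [p pp gp] := ag _ e20.
exists p => // z zB; rewrite [e]splitr.
have -> : f z - p z = (f z - g z) + (g z - p z) by rewrite addrA subrK.
by rewrite (le_trans (ler_normD _ _)) // lerD ?fg ?gp.
Qed.

Lemma approximable_eq B f g : (forall z, normc z <= B -> f z = g z) ->
  approximable B f -> approximable B g.
Proof.
move=> fg af; apply: approximable_lim => e e0; exists f => // z zB.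
by rewrite fg // subrr normr0 ltW.
Qed.

Lemma approximableD B f g : approximable B f -> approximable B g ->
  approximable B (fun z => f z + g z).
Proof.
move=> af ag e e0; have e20 : 0 < e / 2 by rewrite divr_gt0.
have [p pp fp] := af _ e20; have [q qq gq] := ag _ e20.
exists (fun z => p z + q z); first exact: sphere_polyD.
move=> z zB; rewrite [e]splitr opprD addrACA.
by rewrite (le_trans (ler_normD _ _)) // lerD ?fp ?gq.
Qed.

Lemma approximable_bounded B f : approximable B f ->
  exists2 M, 0 < M & forall z, normc z <= B -> `|f z| <= M.
Proof.
move=> af; have [p /bmf_sphere_poly [_ [M pM]] fp] := af _ ltr01.
have M0 : 0 <= M by apply: le_trans (pM 0).
exists (M + 1) => [|z zB]; first by rewrite ltr_wpDl.
have -> : f z = p z + (f z - p z) by rewrite addrC subrK.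
by rewrite (le_trans (ler_normD _ _)) // lerD ?fp ?pM.
Qed.

Lemma approximableM B f g : approximable B f -> approximable B g ->
  approximable B (fun z => f z * g z).
Proof.
move=> af ag e e0; have [M M0 fM] := approximable_bounded af.
have e1 : 0 < e / 2 / M by rewrite !divr_gt0.
have [q qq gq] := ag _ e1; have [_ [N qN]] := bmf_sphere_poly qq.
have N0 : 0 < N + 1 by rewrite ltr_wpDl // (le_trans _ (qN 0)).
have e2 : 0 < e / 2 / (N + 1) by rewrite !divr_gt0.
have [p pp fp] := af _ e2; exists (fun z => p z * q z); first exact: sphere_polyM.
move=> z zB.
have -> : f z * g z - p z * q z = f z * (g z - q z) + (f z - p z) * q z by ring.
rewrite [e]splitr (le_trans (ler_normD _ _)) // !normrM; apply: lerD.
  have -> : e / 2 = M * (e / 2 / M) by rewrite [RHS]mulrC divfK ?gt_eqF.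
  by rewrite ler_pM ?fM ?gq.
have -> : e / 2 = e / 2 / (N + 1) * (N + 1) by rewrite divfK ?gt_eqF.
by rewrite ler_pM ?fp // (le_trans (qN z)) // lerDl.
Qed.

Lemma approximable_cst B (a : R) : approximable B (fun=> a).
Proof. exact/approximable_poly/sphere_poly_cst. Qed.

(* Neumann series: 1/s = \sum_(k < N) (1 - s)^k + (1 - s)^N / s for s = 1/sden. *)
Lemma approximable_sden B : 0 <= B -> approximable B (@sden R).
Proof.
move=> B0; set D := 1 + B ^+ 2.
have D1 : 1 <= D by rewrite lerDl sqr_ge0.
have D0 : 0 < D by apply: lt_le_trans D1.
pose r z := 1 - (sden z)^-1.
have ar N : approximable B (fun z => \sum_(k < N) r z ^+ k).
  have a1 : approximable B r.
    have -> : r = fun z => 1 + -1 * sphere z (inord 1).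
      by apply/funext => z; rewrite /sphere inordK //= mul1r mulN1r.
    apply: approximable_poly; apply: sphere_polyD; first exact: sphere_poly_cst.
    exact/sphere_polyZ/sphere_poly_sphere.
  have aX k : approximable B (fun z => r z ^+ k).
    elim: k => [|k IH]; first exact: approximable_cst.
    by under eq_fun do rewrite exprS; exact: approximableM.
  elim: N => [|N IH].
    by under eq_fun do rewrite big_ord0; exact: approximable_cst.
  by under eq_fun do rewrite big_ord_recr; exact: approximableD.
apply: approximable_lim => e e0.
pose c := 1 - D^-1.
have c0 : 0 <= c by rewrite subr_ge0 invf_le1.
have c1 : `|c| < 1 by rewrite ger0_norm // gtrBl invr_gt0.
have : D * c ^+ N @[N --> \oo] --> D * 0 by apply: cvgMl_tmp; exact: cvg_expr.
rewrite mulr0 => /cvgr0Pnorm_le /(_ _ e0) [N _ /(_ N (leqnn N)) /= hN].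
exists (fun z => \sum_(k < N) r z ^+ k) => // z zB.
have s0 := sden_gt0 z; have s1 := sden_ge1 z.
have sD : sden z <= D by rewrite lerD2l ler_pXn2r ?nnegrE ?normc_ge0.
have -> : sden z - \sum_(k < N) r z ^+ k = sden z * r z ^+ N.
  have := subrX1 (r z) N.
  have -> : r z - 1 = - (sden z)^-1 by rewrite /r; ring.
  by move=> /(congr1 ( *%R (sden z))); rewrite mulrA mulrN divff ?gt_eqF //; lra.
apply: le_trans hN; rewrite normrM [leRHS]normrM !normrX.
rewrite (gtr0_norm s0) (gtr0_norm D0) (ger0_norm c0).
have r0 : 0 <= r z by rewrite subr_ge0 invf_le1.
rewrite (ger0_norm r0) ler_pM ?(ltW s0) ?exprn_ge0 // lerXn2r ?nnegrE //.
by rewrite /r /c lerB // lef_pV2.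
Qed.

Lemma approximable_sphereM B (i : 'I_6) : 0 <= B ->
  approximable B (fun z => sphere z i * sden z).
Proof.
move=> B0; apply: approximableM; last exact: approximable_sden.
exact/approximable_poly/sphere_poly_sphere.
Qed.

Lemma approximable_Re B : 0 <= B -> approximable B (@complex.Re R).
Proof.
move=> /(approximable_sphereM (inord 2)); apply: approximable_eq => z _.
by rewrite /sphere inordK //= divfK // gt_eqF // sden_gt0.
Qed.

Lemma approximable_Im B : 0 <= B -> approximable B (@complex.Im R).
Proof.
move=> /(approximable_sphereM (inord 4)); apply: approximable_eq => z _.
by rewrite /sphere inordK //= divfK // gt_eqF // sden_gt0.
Qed.

(* The mean of g (a + S), where S is a sum of N independent Bernoulli variables
   of parameter t. *)
Fixpoint bernstein t N (g : R -> R) (a : R) : R :=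
  if N is N'.+1 then
    t * bernstein t N' g (a + 1) + (1 - t) * bernstein t N' g a
  else g a.

Lemma bernstein_le t N (g h : R -> R) a : 0 <= t <= 1 -> (forall x, g x <= h x) ->
  bernstein t N g a <= bernstein t N h a.
Proof.
move=> /andP[t0 t1] gh; elim: N a => [|N IH] a //=.
by rewrite lerD // ler_wpM2l // subr_ge0.
Qed.

(** The second moment is the squared bias plus the variance of the binomial sum. *)
Lemma bernstein_sqr t N (c d m a : R) :
  bernstein t N (fun x => c + d * (x - m) ^+ 2) a =
  c + d * ((a + N%:R * t - m) ^+ 2 + N%:R * (t * (1 - t))).
Proof.
by elim: N a => [|N IH] a /=; rewrite ?IH -?natr1; ring.
Qed.

Lemma approximable_bernstein B (X : R[i] -> R) (G : R[i] -> R -> R) N a :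
  approximable B X -> (forall x, approximable B (fun z => G z x)) ->
  approximable B (fun z => bernstein (X z) N (G z) a).
Proof.
move=> aX aG; elim: N a => [|N IH] a //=.
apply: approximableD; first exact: approximableM.
apply: approximableM => //; apply: approximableD; first exact: approximable_cst.
by under eq_fun do rewrite -mulN1r; apply: approximableM => //; exact: approximable_cst.
Qed.

(** [F] lies between two quadratic functions whose Bernstein means are explicit, and each of the two
    variances is at most [N / 4]. *)
Lemma bernstein2_dist (X Y : R) N (F : R -> R -> R) (v c d : R) :
  0 <= X <= 1 -> 0 <= Y <= 1 -> 0 <= d ->
  (forall a b, `|F a b - v| <= c + d * ((a - N%:R * X) ^+ 2 + (b - N%:R * Y) ^+ 2)) ->
  `|v - bernstein X N (fun a => bernstein Y N (F a) 0) 0| <= c + d * N%:R / 2.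
Proof.
move=> X01 Y01 d0 h.
have q4 (t : R) : N%:R * (t * (1 - t)) <= N%:R / 4.
  by rewrite ler_wpM2l ?ler0n //; have := sqr_ge0 (t - 2^-1); lra.
have qX := ler_wpM2l d0 (q4 X); have qY := ler_wpM2l d0 (q4 Y).
have hu : bernstein X N (fun a => bernstein Y N (F a) 0) 0 <= v + c + d * N%:R / 2.
  have inner a : bernstein Y N (F a) 0 <=
      (v + c + d * (N%:R * (Y * (1 - Y)))) + d * (a - N%:R * X) ^+ 2.
    pose g x := (v + c + d * (a - N%:R * X) ^+ 2) + d * (x - N%:R * Y) ^+ 2.
    have le_g x : F a x <= g x by have := h a x; rewrite ler_norml /g; lra.
    apply: le_trans (bernstein_le N 0 Y01 le_g) _.
    by rewrite bernstein_sqr add0r subrr; lra.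
  apply: le_trans (bernstein_le N 0 X01 inner) _.
  by rewrite bernstein_sqr add0r subrr; lra.
have hl : v - c - d * N%:R / 2 <= bernstein X N (fun a => bernstein Y N (F a) 0) 0.
  have inner a : (v - c - d * (N%:R * (Y * (1 - Y)))) + - d * (a - N%:R * X) ^+ 2
      <= bernstein Y N (F a) 0.
    pose g x := (v - c - d * (a - N%:R * X) ^+ 2) + - d * (x - N%:R * Y) ^+ 2.
    have le_g x : g x <= F a x by have := h a x; rewrite ler_norml /g; lra.
    apply: le_trans (bernstein_le N 0 Y01 le_g).
    by rewrite bernstein_sqr add0r subrr; lra.
  apply: le_trans (bernstein_le N 0 X01 inner).
  by rewrite bernstein_sqr add0r subrr; lra.
by rewrite ler_norml; apply/andP; split; lra.
Qed.

Lemma bounded_fun_le f : bounded_fun f -> exists2 M, 0 < M & forall z, `|f z| <= M.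
Proof.
move=> [M0 [_ h]]; exists (`|M0| + 1) => [|z]; first by rewrite ltr_wpDl.
by apply: h => //; rewrite (le_lt_trans (ler_norm _)) // ltrDl.
Qed.

Lemma approximable_continuous B f : 0 < B -> continuous f -> bounded_fun f ->
  approximable B f.
Proof.
move=> B0 cf bdf; have [M M0 fM] := bounded_fun_le bdf; have B0' := ltW B0.
have cD : compact [set z : R[i] | normc z <= B].
  by apply: (@compact_closed_bounded _ _ B) => //; exact/closed_sublevel/continuous_normc.
apply: approximable_lim => e e0; have e20 : 0 < e / 2 by rewrite divr_gt0.
have [del del0 hdel] := compact_uniform_continuity cD cf e20.
(* Makes [fA] hold at every distance: below [del] by uniform continuity, and beyond it because the
   oscillation [2 * M] is at most [A] times the squared distance. *)
pose A := 2 * M / del ^+ 2.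
have A0 : 0 <= A by rewrite divr_ge0 ?sqr_ge0 // mulr_ge0 // ltW.
have fA z w : normc z <= B -> `|f w - f z| <= e / 2 + A * normc (z - w) ^+ 2.
  move=> zB; have [zw|zw] := ltP (normc (z - w)) del.
    rewrite distrC; apply: le_trans (ltW (hdel z w zB zw)) _.
    by rewrite lerDl mulr_ge0 // sqr_ge0.
  apply: (@le_trans _ _ (2 * M)).
    by rewrite mulr_natl mulr2n (le_trans (ler_normB _ _)) // lerD.
  rewrite ler_wpDl ?(ltW e20) // /A mulrAC ler_pdivlMr ?exprn_gt0 //.
  by rewrite ler_wpM2l ?mulr_ge0 ?(ltW M0) // ler_pXn2r ?nnegrE ?normc_ge0 // ltW.
have K0 : 0 <= 4 * A * B ^+ 2 / e by rewrite divr_ge0 ?(ltW e0) // mulr_ge0 ?sqr_ge0 // mulr_ge0.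
(* With mesh [c = 2 * B / N] the variance term of [bernstein2_dist] is 2 A B^2 / N, at most e / 2
   for this [N]. *)
pose N := (Num.bound (4 * A * B ^+ 2 / e)).+1.
have N0 : (0 : R) < N%:R by rewrite ltr0n.
have hN : 4 * A * B ^+ 2 / N%:R <= e.
  rewrite ler_pdivrMr // -ler_pdivrMl // mulrC; apply: ltW.
  by apply: lt_le_trans (archi_boundP K0) _; rewrite ler_nat.
pose c := 2 * B / N%:R.
pose F a b := f ((c * a - B) +i* (c * b - B)).
pose X z := (complex.Re z + B) / (2 * B); pose Y z := (complex.Im z + B) / (2 * B).
have B2 : 2 * B != 0 by rewrite mulf_neq0 // gt_eqF.
have h01 x : `|x| <= B -> 0 <= (x + B) / (2 * B) <= 1.
  rewrite ler_norml => /andP[x1 x2]; rewrite ler_pdivrMr ?mulr_gt0 //.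
  by rewrite divr_ge0 ?mulr_ge0 //=; lra.
have aff g : approximable B g -> approximable B (fun z => (g z + B) / (2 * B)).
  move=> ag; apply: approximableM; last exact: approximable_cst.
  by apply: approximableD => //; exact: approximable_cst.
exists (fun z => bernstein (X z) N (fun a => bernstein (Y z) N (F a) 0) 0) => [|z zB].
  apply: approximable_bernstein => [|a]; first exact/aff/approximable_Re.
  apply: approximable_bernstein => [|b]; first exact/aff/approximable_Im.
  exact: approximable_cst.
have Xz : 0 <= X z <= 1 by apply: h01; exact: le_trans (Re_le_normc z) zB.
have Yz : 0 <= Y z <= 1 by apply: h01; exact: le_trans (Im_le_normc z) zB.
have d0 : 0 <= A * c ^+ 2 by rewrite mulr_ge0 // sqr_ge0.
apply: (@le_trans _ _ (e / 2 + A * c ^+ 2 * N%:R / 2)); last first.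
  rewrite [leRHS]splitr lerD2l ler_pM2r ?invr_gt0 //.
  suff -> : A * c ^+ 2 * N%:R = 4 * A * B ^+ 2 / N%:R by [].
  by rewrite /c; field; rewrite gt_eqF.
apply: bernstein2_dist => // a b; apply: le_trans (fA z _ zB) _.
rewrite lerD2l -[leRHS]mulrA ler_wpM2l // normc_sqrE.
rewrite le_eqVlt; apply/orP; left; apply/eqP.
have cX : c * (N%:R * X z) = complex.Re z + B.
  by rewrite /c /X mulrA divfK ?gt_eqF // mulrC divfK.
have cY : c * (N%:R * Y z) = complex.Im z + B.
  by rewrite /c /Y mulrA divfK ?gt_eqF // mulrC divfK.
have -> : complex.Re (z - ((c * a - B) +i* (c * b - B))) = c * (N%:R * X z - a).
  by rewrite mulrBr cX; case: (z) => x y /=; ring.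
have -> : complex.Im (z - ((c * a - B) +i* (c * b - B))) = c * (N%:R * Y z - b).
  by rewrite mulrBr cY; case: (z) => x y /=; ring.
by ring.
Qed.

Lemma sphere_poly_int_cvg (mu : nat -> probability (borelC R) R) nu p :
  (forall k (w : {ffun 'I_k -> 'I_6}), moment (mu n) w @[n --> \oo] --> moment nu w) ->
  sphere_poly p -> \int[mu n]_z p z @[n --> \oo] --> \int[nu]_z p z.
Proof.
move=> h; elim=> [k w|p1 p2 q1 h1 q2 h2|a p1 q1 h1]; first exact: h.
- rewrite RintD; [|exact: bmf_sphere_poly..].
  under eq_fun => n do rewrite (RintD (mu n) (bmf_sphere_poly q1) (bmf_sphere_poly q2)).
  exact: cvgD.
- rewrite RintZ; last exact: bmf_sphere_poly.
  under eq_fun => n do rewrite (RintZ (mu n) a (bmf_sphere_poly q1)).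
  exact: cvgMl_tmp.
Qed.

Lemma Rint_dist_le nu (S : set R[i]) f g e : closed S -> supported_on S nu ->
  bmf (f : borelC R -> R) -> bmf (g : borelC R -> R) ->
  (forall z, S z -> `|f z - g z| <= e) ->
  `|\int[nu]_z f z - \int[nu]_z g z| <= e.
Proof.
move=> clS nuS bf bg fg; have mS := measurable_closed clS.
have be : bmf (cst e : borelC R -> R) by exact: bmf_cst.
have h1 : \int[nu]_z f z <= \int[nu]_z (g z + e).
  apply: (@Rint_le_ae _ _ _ nu S) => //; first exact: bmfD.
  by move=> z /fg; rewrite ler_norml; lra.
have h2 : \int[nu]_z g z <= \int[nu]_z (f z + e).
  apply: (@Rint_le_ae _ _ _ nu S) => //; first exact: bmfD.
  by move=> z /fg; rewrite ler_norml; lra.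
move: h1 h2; rewrite !RintD // Rint_cst => h1 h2.
by rewrite ler_norml; apply/andP; split; lra.
Qed.

(** With all supports in one disc, uniform approximation there suffices. The threshold [m] leaves
    room for [omega 0] and [omega 1], which are arbitrary. *)
Lemma cvg_weak_star_moment (mu : nat -> probability (borelC R) R) nu B (m : nat) :
  0 < B ->
  (forall n, (m <= n)%N -> supported_on [set z | normc z <= B] (mu n)) ->
  supported_on [set z | normc z <= B] nu ->
  (forall k (w : {ffun 'I_k -> 'I_6}), moment (mu n) w @[n --> \oo] --> moment nu w) ->
  cvg_weak_star mu nu.
Proof.
move=> B0 smu snu hm f cf bdf.
have [M _ fM] := bounded_fun_le bdf.
have bf : bmf (f : borelC R -> R).
  by split; [exact: continuous_measurable|exists M].
have clD : closed [set z : R[i] | normc z <= B].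
  by apply: closed_sublevel; exact: continuous_normc.
apply/cvgrPdist_le => e e0; have e30 : 0 < e / 3 by rewrite divr_gt0.
have [p pp fp] := approximable_continuous B0 cf bdf e30.
have bp := bmf_sphere_poly pp.
have hn := Rint_dist_le clD snu bf bp fp.
have /cvgrPdist_le/(_ _ e30) hc := sphere_poly_int_cvg hm pp.
near=> n.
have hmu : `|\int[mu n]_z f z - \int[mu n]_z p z| <= e / 3.
  by apply: (Rint_dist_le clD) => //; apply: smu; near: n; exact: nbhs_infty_ge.
have hcn : `|\int[nu]_z p z - \int[mu n]_z p z| <= e / 3 by near: n.
move: hn hmu hcn; rewrite !ler_norml => /andP[? ?] /andP[? ?] /andP[? ?].
by apply/andP; split; lra.
Unshelve. all: by end_near. Qed.

End Density.

Theorem theorem1p2 (R : realType) (K : set R[i])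
    (T : nat -> {poly R[i]})
    (omega : nat -> probability (borelC R) R)
    (omegaK : probability (borelC R) R) :
  compact K -> non_polar K ->
  (forall n : nat, (1 <= n)%N -> is_chebyshev_poly K n (T n)) ->
  (forall n : nat, (2 <= n)%N ->
     is_equilibrium_measure (filled_julia (dual_poly K (T n))) (omega n)) ->
  is_equilibrium_measure K omegaK ->
  cvg_weak_star omega omegaK.
Proof.
move=> cK npK chebT eqT eqK; have [r r1 hr] := compact_bounded_cplx cK.
apply: (@cvg_weak_star_moment _ _ _ (R0 r) 2).
- by apply: lt_le_trans (R0_ge1 r1).
- by move=> n n2; apply: (supported_disc_omega cK npK chebT eqT eqK r1 hr).
- exact: (supported_disc_omegaK cK eqK r1 hr).
- by move=> k w; apply: (moment_cvg cK npK chebT eqT eqK r1 hr).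
Qed.
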